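(* If $Y$ is a semi-equivelar map on the real projective plane $\mathbb{RP}^2$, then the vertex-type of $Y$ is one of $[5^3]$, $[3^5]$, $[4^1,6^2]$, $[3^1,5^1,3^1,5^1]$, $[3^1,4^3]$, $[4^1,6^1,8^1]$, $[3^1,4^1,5^1,4^1]$, $[4^1,6^1,10^1]$, $[3^1,10^2]$, $[5^1,6^2]$. Moreover, for each of these ten vertex-types there exists a semi-equivelar map on $\mathbb{RP}^2$ of that vertex-type, and it is unique up to isomorphism.
   Context: A map is a polyhedral map on a surface: a decomposition of the surface into faces, each an $n$-gon for some $n\ge 3$, such that any two intersecting faces meet either in exactly one vertex or in exactly one edge. Isomorphism means combinatorial isomorphism. For a vertex $u$, the faces containing $u$ form a cycle (the face-cycle of $u$) of the form $(F_{1,1}\text{-}\cdots\text{-}F_{1,n_1})\text{-}\cdots\text{-}(F_{k,1}\text{-}\cdots\text{-}F_{k,n_k})\text{-}F_{1,1}$ where each $F_{i,l}$ is a $p_i$-gon, $p_r\ne p_{r+1}$ and $p_k\ne p_1$. A map is semi-equivelar of vertex-type $[p_1^{n_1},\dots,p_k^{n_k}]$ if the face-cycle of every vertex has this same form (cyclic tuples identified up to rotation and reversal). *)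

(* Defs.v *)
From HB Require Import structures.
From mathcomp Require Import all_boot all_order all_algebra generic_quotient.
From mathcomp Require Import all_classical all_reals topology normedtype.

Set Implicit Arguments.
Unset Strict Implicit.
Unset Printing Implicit Defensive.

Import Order.TTheory GRing.Theory Num.Theory.
Import numFieldNormedType.Exports.

Local Open Scope classical_set_scope.
Local Open Scope ring_scope.
Local Open Scope quotient_scope.

(* Equality of cyclic sequences up to rotation and reversal. *)
Definition cyclic_eq (T : Type) (s t : seq T) : Prop :=
  exists i : nat, s = rot i t \/ s = rot i (rev t).

(* Combinatorial data of a decomposition of a surface into polygons: [bnd f]
   lists the vertices of the face [f] in the order in which they occur along its
   boundary.  In a polyhedral map an edge is determined by its two ends (a face
   has at least three vertices, and two distinct faces share at most one edge),
   so edges need not be recorded separately. *)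
Record cellmap : Type := CellMap {
  vert : finType;
  face : finType;
  bnd : face -> seq vert
}.

Definition edge_of (Y : cellmap) (f : face Y) (u v : vert Y) : bool :=
  (u \in bnd f) && ((v == next (bnd f) u) || (v == prev (bnd f) u)).

Definition common_vertices (Y : cellmap) (f g : face Y) : {set vert Y} :=
  [set x | (x \in bnd f) && (x \in bnd g)].

Definition faces_meet_properly (Y : cellmap) (f g : face Y) : Prop :=
  [\/ common_vertices f g = finset.set0,
      exists u, common_vertices f g = [set u]%SET
    | exists u v, [/\ edge_of f u v, edge_of g u v
                    & common_vertices f g = [set u; v]%SET]].

Definition adjacent_at (Y : cellmap) (u : vert Y) : rel (face Y) :=
  fun f g => (f != g) && [exists w, edge_of f u w && edge_of g u w].

Definition face_cycle (Y : cellmap) (u : vert Y) (c : seq (face Y)) : Prop :=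
  [/\ uniq c, forall f, (f \in c) = (u \in bnd f) & cycle (adjacent_at u) c].

(* Since an edge lies in exactly two faces, the face-cycle of a vertex is unique
   up to rotation and reversal.  The last two conditions make [Y] a closed
   surface; connectedness is left to the underlying space. *)
Definition polyhedral_map (Y : cellmap) : Prop :=
  [/\ forall f : face Y, uniq (bnd f) /\ (3 <= size (bnd f))%N,
      forall u : vert Y, exists f, u \in bnd f,
      forall f g : face Y, f != g -> faces_meet_properly f g,
      forall (f : face Y) (u v : vert Y),
        edge_of f u v -> #|[pred g | edge_of g u v]| = 2%N
    & forall u : vert Y, exists c, face_cycle u c].

(* The underlying space.  Each face is the cone, with apex a new point [inr f],
   over its boundary cycle; all these cones are realised as unions of triangles
   of the standard simplex spanned by the vertices and the apices. *)
Definition realization (R : realType) (Y : cellmap) :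
    set 'rV[R]_#|{: vert Y + face Y}| :=
  [set x | [/\ forall i, 0 <= x 0 i, \sum_i x 0 i = 1
    & exists (f : face Y) (u v : vert Y), edge_of f u v /\
        forall p, x 0 (enum_rank p) != 0 ->
          p \in [:: inl u; inl v; inr f]]].
Arguments realization : clear implicits.

Definition homeomorphic (S T : topologicalType) : Prop :=
  exists (f : S -> T) (g : T -> S),
    [/\ continuous f, continuous g, cancel f g & cancel g f].

(* [set_type (realization R Y)] carries the subspace topology. *)
Definition map_on (R : realType) (T : topologicalType) (Y : cellmap) : Prop :=
  polyhedral_map Y /\ homeomorphic (set_type (realization R Y)) T.

(* The norm of ['rV[R]_3] in the library is the sup norm, so the Euclidean unit
   sphere is spelled out. *)
Definition sphere2 (R : realType) : set 'rV[R]_3 :=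
  [set x | \sum_i x 0 i ^+ 2 = 1].
Arguments sphere2 : clear implicits.

Section ProjectivePlane.
Variable R : realType.

Definition antipodal_rel (x y : sphere2 R) : bool :=
  (val x == val y) || (val x == - val y).

Lemma antipodal_refl : reflexive antipodal_rel.
Proof. by move=> x; rewrite /antipodal_rel eqxx. Qed.

Lemma antipodal_sym : symmetric antipodal_rel.
Proof.
by move=> x y; rewrite /antipodal_rel eq_sym [val x == - _]eq_sym eqr_oppLR.
Qed.

Lemma antipodal_trans : transitive antipodal_rel.
Proof.
move=> y x z; rewrite /antipodal_rel.
by case/orP=> /eqP -> /orP[] /eqP ->; rewrite ?opprK eqxx ?orbT.
Qed.

Definition antipodal : equiv_rel (sphere2 R) :=
  EquivRel antipodal_rel antipodal_refl antipodal_sym antipodal_trans.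

Definition RP2 : topologicalType := quotient_topology {eq_quot antipodal}.

End ProjectivePlane.

(* [:: (p1, n1); ...; (pk, nk)] stands for [p1^n1, ..., pk^nk]. *)
Notation vtype := (seq (nat * nat)).

Definition proper_vtype (t : vtype) : bool :=
  [&& t != [::], all (fun x => 0 < x.2)%N t
    & (size t == 1%N) || cycle (fun x y => x.1 != y.1) t].

Definition expand (t : vtype) : seq nat := flatten [seq nseq x.2 x.1 | x <- t].

Definition semi_equivelar (Y : cellmap) (t : vtype) : Prop :=
  proper_vtype t /\
  forall u : vert Y, exists c : seq (face Y),
    face_cycle u c /\ [seq size (bnd f) | f <- c] = expand t.

Definition isomorphic (Y Z : cellmap) : Prop :=
  exists (phi : vert Y -> vert Z) (psi : face Y -> face Z),
    [/\ bijective phi, bijective psi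
      & forall f, cyclic_eq (map phi (bnd f)) (bnd (psi f))].

(* Main.v *)
(* Connectedness and the first Betti number mod 2, computed with Alexander-Spanier
   cochains on the underlying compact space, are topological invariants, and so is
   the Euler characteristic; it is 1 on the projective plane, as the
   hemi-icosahedron shows.  Hence a semi-equivelar map with V vertices and with
   faces of sizes p_1, ..., p_d around each vertex satisfies
   V (1 - d/2 + sum_i 1/p_i) = 1.  The faces at a vertex have altogether
   1 + sum_i (p_i - 2) vertices, a lower bound for V which leaves finitely many
   solutions.  A parity argument along the boundary of a face of odd size excludes
   all of them but the ten types of the theorem and the snub types [3^4, 4] and
   [3^4, 5].  For each of these, gluing faces around a vertex as the type forces
   builds a few maps with 2 V vertices, one of which covers the given map.  The
   latter is thus determined by this cover and the involution of its flags that
   exchanges the two sheets.  Enumerating the involutions that do not move a vertex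
   within its star leaves at most one pair of a cover and an involution for each of
   the ten types, and none for the snub types.  The ten maps exist as quotients of
   centrally symmetric convex polytopes by the antipodal map. *)

Require Import Defs.
From HB Require Import structures.
From Stdlib Require Import BinInt.
From mathcomp Require Import all_boot all_order all_algebra generic_quotient.
From mathcomp Require Import all_classical all_reals topology normedtype.
From mathcomp Require Import zify ssrZ ring lra.

Set Implicit Arguments.
Unset Strict Implicit.
Unset Printing Implicit Defensive.

Import Order.TTheory GRing.Theory Num.Theory.
Import numFieldNormedType.Exports.

(* [ssrZ] binds the key [N] to binary numbers. *)
Delimit Scope nat_scope with N.

(** A homeomorphism of realizations need not respect cells. Functions of pairs of nearby points
    nevertheless pull back along every continuous map; compactness then supplies one common scale,
    and a Poincare lemma on each triangle leads back to simplicial cocycles. Coefficients mod 2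
    avoid orientations, which the projective plane lacks, and make the top cohomology of every
    connected closed map one-dimensional, so that only connectedness and the first Betti number have
    to be transferred. The gluing of faces adds a new vertex whenever no face forces an
    identification, so it unfolds the map as a universal cover does; this explains the number 2 V.
    Nothing has to be proved about the topology of the result: counting flags shows that the fibres
    of the projection have two elements. The condition on stars reflects that no face of a
    polyhedral map passes twice through a vertex. The tests imposed on an involution are only
    necessary conditions, which is enough because at most one candidate survives them. *)

Section Next.
Variable T : eqType.
Implicit Type s : seq T.

Lemma next_nth_mod x0 s i : uniq s -> i < size s ->
  next s (nth x0 s i) = nth x0 s (i.+1 %% size s).
Proof.
move=> us si; rewrite next_nth mem_nth //.
case: s us si => // y s us si; rewrite index_uniq // /=.
have := si; rewrite /= ltnS leq_eqVlt => /orP[/eqP ->|lt].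
  by rewrite modnn nth_default.
by rewrite modn_small ?ltnS //=; apply: set_nth_default.
Qed.

Lemma iter_next_nth x0 s i k : uniq s -> i < size s ->
  iter k (next s) (nth x0 s i) = nth x0 s ((i + k) %% size s).
Proof.
move=> us si; elim: k => [|k IH]; first by rewrite addn0 modn_small.
rewrite iterS IH next_nth_mod ?ltn_pmod ?(leq_ltn_trans _ si) //.
by congr nth; rewrite -[_.+1]addn1 modnDml addn1 addnS.
Qed.

Lemma iter_next_eq s x k : uniq s -> x \in s -> k < size s ->
  iter k (next s) x = x -> k = 0.
Proof.
move=> us xs ks; rewrite -{2}(nth_index x xs) -[in iter _ _ _](nth_index x xs).
rewrite iter_next_nth ?index_mem //.
have i_s : index x s < size s by rewrite index_mem.
move=> /eqP; rewrite nth_uniq ?ltn_pmod ?(leq_ltn_trans _ i_s) //.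
rewrite -{2}[index x s](modn_small i_s) -{2}[index x s]addn0 => /eqP/eqP.
by rewrite eqn_modDl mod0n modn_small // => /eqP.
Qed.

Lemma iter_next_size s x : uniq s -> x \in s -> iter (size s) (next s) x = x.
Proof.
move=> us xs; rewrite -[in LHS](nth_index x xs) iter_next_nth ?index_mem //.
by rewrite modnDr modn_small ?index_mem // nth_index.
Qed.

Lemma next_neq s x : uniq s -> x \in s -> 1 < size s -> next s x != x.
Proof. by move=> us xs s1; apply/eqP => /(@iter_next_eq s x 1 us xs s1). Qed.

Lemma next_neq_prev s x : uniq s -> x \in s -> 2 < size s ->
  next s x != prev s x.
Proof.
move=> us xs s2; apply/eqP => h.
have : iter 2 (next s) x = x by rewrite /= h next_prev.
by move/(@iter_next_eq s x 2 us xs s2).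
Qed.

End Next.

(** * Edges and faces of a polyhedral map *)

Section PolyhedralMaps.
Variable Y : cellmap.
Hypothesis pY : polyhedral_map Y.
Implicit Types (f g : face Y) (u v : vert Y).

Lemma bnd_uniq f : uniq (bnd f).
Proof. by case: pY => + _ _ _ _ => /(_ f)[]. Qed.

Lemma bnd_size f : 2 < size (bnd f).
Proof. by case: pY => + _ _ _ _ => /(_ f)[]. Qed.

Lemma edge_ofl f u v : edge_of f u v -> u \in bnd f.
Proof. by case/andP. Qed.

Lemma edge_ofr f u v : edge_of f u v -> v \in bnd f.
Proof. by case/andP => uf /orP[] /eqP ->; rewrite ?mem_next ?mem_prev. Qed.

Lemma edge_of_next f u : u \in bnd f -> edge_of f u (next (bnd f) u).
Proof. by rewrite /edge_of => ->; rewrite eqxx. Qed.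

Lemma edge_of_prev f u : u \in bnd f -> edge_of f u (prev (bnd f) u).
Proof. by rewrite /edge_of => ->; rewrite eqxx orbT. Qed.

Lemma edge_of_symW f u v : edge_of f u v -> edge_of f v u.
Proof.
move=> e; rewrite /edge_of (edge_ofr e) /=; case/andP: e => _.
by case/orP => /eqP ->; rewrite ?prev_next ?next_prev ?bnd_uniq ?eqxx ?orbT.
Qed.

Lemma edge_of_sym f u v : edge_of f u v = edge_of f v u.
Proof. by apply/idP/idP; exact: edge_of_symW. Qed.

Lemma edge_of_neq f u v : edge_of f u v -> u != v.
Proof.
move=> e; apply/eqP => uv; rewrite -{v}uv in e.
have uf := edge_ofl e; have nu := next_neq (bnd_uniq f) uf (ltnW (bnd_size f)).
case/andP: e => _ /orP[] /eqP h; first by rewrite -h eqxx in nu.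
by have := next_prev (bnd_uniq f) u; rewrite -h => h'; rewrite h' eqxx in nu.
Qed.

Lemma vert_face u : exists f, u \in bnd f.
Proof. by case: pY. Qed.

Lemma face_vert f : exists u, u \in bnd f.
Proof. by have := bnd_size f; case: (bnd f) => // x s _; exists x; rewrite mem_head. Qed.

Lemma edge_card f u v : edge_of f u v -> #|[pred g | edge_of g u v]| = 2.
Proof. by case: pY => _ _ _ + _; apply. Qed.

End PolyhedralMaps.

(** Connectedness in terms of two-colourings, that is, of degree-0 cocycles mod 2. In this form it
    transfers along homeomorphisms and describes the kernel of [coboundary0] directly. *)
Definition incidence_connected (Y : cellmap) :=
  forall S : vert Y + face Y -> bool,
    (forall f u, u \in bnd f -> S (inl u) = S (inr f)) ->
    forall p q, S p = S q.

Local Open Scope classical_set_scope.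
Local Open Scope ring_scope.

(** * Alexander-Spanier cochains on the realization *)

Section Cochains.
Variables (R : realType) (n : nat).
Local Notation V := 'rV[R]_n.

Definition convex_set (S : set V) :=
  forall a b, S a -> S b -> forall t, 0 <= t <= 1 -> S (a + t *: (b - a)).

(** The Alexander-Spanier cocycle condition mod 2 at the fixed scale [d]. It is centred at [x], so
    [a] and [b] may be up to 2 d apart; taking points equal yields vanishing on the diagonal and
    symmetry at distance below [d]. *)
Definition unif_cocycle (S : set V) (d : R) (f : V -> V -> bool) :=
  forall x a b, S x -> S a -> S b -> `|x - a| < d -> `|x - b| < d ->
    f a b = f x a (+) f x b.

Definition unif_cobound (S : set V) (d : R) (f : V -> V -> bool)
    (g : V -> bool) :=
  forall a b, S a -> S b -> `|a - b| < d -> f a b = g a (+) g b.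

Lemma convex_setI (S S' : set V) :
  convex_set S -> convex_set S' -> convex_set (S `&` S').
Proof.
by move=> cS cS' a b [Sa S'a] [Sb S'b] t ht; split; [exact: cS|exact: cS'].
Qed.

Lemma convex_unif_const (S : set V) (d : R) (k : V -> bool) :
  convex_set S -> 0 < d ->
  (forall a b, S a -> S b -> `|a - b| < d -> k a = k b) ->
  forall a b, S a -> S b -> k a = k b.
Proof.
move=> cS d0 kd a b Sa Sb.
(* The segment is walked in [N] equal steps; the successor makes the step length strictly smaller
   than [d]. *)
pose N := (Num.truncn (`|b - a| / d)).+1.
have N0 : 0 < N%:R :> R by rewrite ltr0n.
have hN : `|b - a| / N%:R < d.
  rewrite ltr_pdivrMr // mulrC -ltr_pdivrMr //.
  by have /andP[] := Num.Theory.truncn_itv (divr_ge0 (normr_ge0 (b - a)) (ltW d0)).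
pose pt (i : nat) := a + (i%:R / N%:R) *: (b - a).
have Spt i : (i <= N)%N -> S (pt i).
  move=> iN; apply: cS => //; rewrite divr_ge0 ?ler0n //=.
  by rewrite ler_pdivrMr // mul1r ler_nat.
have step i : (i < N)%N -> k (pt i) = k (pt i.+1).
  move=> iN; apply: kd; [exact: Spt (ltnW iN)|exact: Spt|].
  rewrite /pt opprD addrACA subrr add0r -scalerBl -mulrBl -natr1.
  rewrite opprD addrA subrr add0r normrZ normrM normrN1 mul1r normfV.
  by rewrite ger0_norm ?ler0n // mulrC.
have kpt i : (i <= N)%N -> k (pt i) = k a.
  elim: i => [_|i IH iN]; first by rewrite /pt mul0r scale0r addr0.
  by rewrite -step // IH // ltnW.
by rewrite -(kpt N) // /pt divff ?gt_eqF // scale1r addrC subrK.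
Qed.

Lemma unif_cocycleS (S S' : set V) d f :
  S' `<=` S -> unif_cocycle S d f -> unif_cocycle S' d f.
Proof. by move=> ss cf x a b /ss ? /ss ? /ss ?; exact: cf. Qed.

Lemma unif_cocycle_refl (S : set V) d f x :
  0 < d -> unif_cocycle S d f -> S x -> f x x = false.
Proof.
by move=> d0 cf Sx; rewrite (cf x x x) ?subrr ?normr0 // addbb.
Qed.

(* Along the line from [a] to [b] pick the point of the cutting hyperplane: it
   is at distance less than [d] from both ends. *)
Lemma unif_cobound_glue (S : set V) (d : R) f (i : 'I_n) (c : R) g1 g2 :
  0 < d -> convex_set S -> unif_cocycle S d f ->
  unif_cobound (S `&` [set x : V | x 0 i <= c]) d f g1 ->
  unif_cobound (S `&` [set x : V | c <= x 0 i]) d f g2 ->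
  exists g, unif_cobound S d f g.
Proof.
move=> d0 cS cf h1 h2.
pose H := S `&` [set x : V | x 0 i = c].
have cH : convex_set H.
  apply: convex_setI => // a b /= ha hb t _.
  by rewrite !mxE ha hb subrr mulr0 addr0.
(* On the convex section [H] the two primitives differ by a constant [e], which is then absorbed
   into the second one. If [H] is empty, any [e] will do. *)
have [e he] : exists e, forall x, H x -> g1 x = e (+) g2 x.
  have [[x0 Hx0]|nH] := pselect (exists x, H x); last first.
    by exists false => x Hx; case: nH; exists x.
  exists (g1 x0 (+) g2 x0) => x Hx.
  have kk a b : H a -> H b -> `|a - b| < d -> g1 a (+) g2 a = g1 b (+) g2 b.
    move=> [Sa /= ha] [Sb /= hb] ab.
    have := h1 a b; have := h2 a b; rewrite /= ha hb lexx.
    move=> -> // /(_ (conj Sa isT) (conj Sb isT) ab).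
    by case: (g1 a); case: (g1 b); case: (g2 a); case: (g2 b).
  have := convex_unif_const cH d0 kk Hx Hx0.
  by case: (g1 x); case: (g2 x); case: (g1 x0); case: (g2 x0).
pose g (x : V) := if x 0 i <= c then g1 x else e (+) g2 x.
have cross a b : S a -> S b -> a 0 i <= c -> c < b 0 i -> `|a - b| < d ->
    f a b = g a (+) g b.
  move=> Sa Sb ac cb ab.
  pose t := (c - a 0 i) / (b 0 i - a 0 i).
  have q0 : 0 < b 0 i - a 0 i by lra.
  have t01 : 0 <= t <= 1.
    rewrite /t; apply/andP; split; first by apply: divr_ge0; lra.
    by rewrite ler_pdivrMr // mul1r; lra.
  pose x := a + t *: (b - a).
  have Sx : S x by exact: cS.
  have Hx : H x.
    split=> //=; rewrite !mxE /t -mulrA mulVf ?gt_eqF //; ring.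
  have xa : `|x - a| < d.
    rewrite /x addrAC subrr add0r normrZ; move: t01 => /andP[t0 t1].
    rewrite ger0_norm // distrC; apply: le_lt_trans ab.
    by rewrite ler_piMl.
  have xb : `|x - b| < d.
    have -> : x - b = (1 - t) *: (a - b).
      by rewrite /x; apply/matrixP => k j; rewrite !mxE; ring.
    rewrite normrZ; move: t01 => /andP[t0 t1].
    rewrite ger0_norm ?subr_ge0 //; apply: le_lt_trans ab.
    by rewrite ler_piMl // gerBl.
  rewrite (cf x a b) // /g ac leNgt cb /= .
  have [_ /= xc] := Hx.
  rewrite (h1 x a) //=; last by rewrite xc.
  rewrite (h2 x b) //=; [|by rewrite xc|by split => //; exact: ltW].
  rewrite he //.
  by case: e {he g} => /=; case: (g1 a); case: (g2 x); case: (g2 b).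
exists g => a b Sa Sb ab.
have sym u v : S u -> S v -> `|u - v| < d -> f u v = f v u.
  move=> Su Sv uv; rewrite (cf u v u) ?subrr ?normr0 //.
  by rewrite (unif_cocycle_refl d0 cf Su) addbF.
case: (leP (a 0 i) c) => ac; case: (leP (b 0 i) c) => bc.
- by rewrite /g ac bc h1.
- exact: cross.
- by rewrite sym // addbC cross // distrC.
- rewrite /g !leNgt ac bc /= h2 //=; [|by split=> //; exact: ltW..].
  by case: e {he g cross}; case: (g2 a); case: (g2 b).
Qed.

Lemma convex_unif_cobound (S : set V) (d M : R) f :
  0 < d -> convex_set S -> (forall x, S x -> `|x| <= M) ->
  unif_cocycle S d f -> exists g, unif_cobound S d f g.
Proof.
move=> d0 cS bS cf.
(* Induction on the number [k] of coordinates in which the set may be thick. For [k = 0] its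
   diameter in the sup norm is below [d], and [f x] for any base point [x] is a primitive. *)
suff main : forall k, (k <= n)%N -> forall S', S' `<=` S -> convex_set S' ->
    (forall i : 'I_n, (k <= i)%N -> forall a b, S' a -> S' b ->
       `|a 0 i - b 0 i| < d) ->
    exists g, unif_cobound S' d f g.
  by apply: (main n) => // i; rewrite leqNgt ltn_ord.
elim=> [_ S' sS' cS' ext|k IH kn S' sS' cS' ext].
  have [[x Sx]|nS] := pselect (exists x, S' x); last first.
    by exists xpredT => a b Sa; case: nS; exists a.
  exists (f x) => a b Sa Sb _.
  have near y : S' y -> `|x - y| < d.
    move=> Sy; rewrite [ltLHS]/Num.norm /= mx_normrE.
    apply/bigmax_ltP; split=> // -[i j] _ /=; rewrite !mxE (ord1 i).
    exact: ext.
  by apply: cf; [exact: sS'..|exact: near|exact: near].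
pose i := Ordinal kn.
(* Coordinate [i] is cut into slabs of width d / 2, thin enough for the induction hypothesis, and
   primitives are glued slab after slab. The norm bound places the whole set above the first cut, at
   -M. *)
pose lo := - M; pose cut m := lo + m%:R * (d / 2).
have coordM x : S' x -> `|x 0 i| <= M.
  move=> /sS' /bS; apply: le_trans; rewrite [leRHS]/Num.norm /= mx_normrE.
  by apply/bigmax_geP; right => /=; exists (0, i).
suff sl m : exists g, unif_cobound (S' `&` [set x : V | x 0 i <= cut m]) d f g.
  pose m := (Num.truncn ((M + M) / (d / 2))).+1.
  have hm : M <= cut m.
    have := Num.Theory.truncnS_gt ((M + M) / (d / 2)).
    rewrite ltr_pdivrMr ?divr_gt0 // -/m /cut /lo; lra.
  have [g hg] := sl m; exists g => a b Sa Sb; apply: hg; split=> //=.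
    by apply: le_trans hm; apply: le_trans (coordM _ Sa); exact: ler_norm.
  by apply: le_trans hm; apply: le_trans (coordM _ Sb); exact: ler_norm.
have half c : convex_set [set x : V | x 0 i <= c].
  move=> a b /= ha hb t /andP[t0 t1]; rewrite !mxE; nra.
have half' c : convex_set [set x : V | c <= x 0 i].
  move=> a b /= ha hb t /andP[t0 t1]; rewrite !mxE; nra.
have slab c (W : set V) : W `<=` S' -> convex_set W ->
    (forall x, W x -> c <= x 0 i <= c + d / 2) ->
    exists g, unif_cobound W d f g.
  move=> WS cW hW; apply: IH => //; [exact: ltnW|exact: subset_trans sS'|].
  move=> j; rewrite leq_eqVlt => /orP[/eqP kj|kj] a b Wa Wb; last first.
    by apply: ext => //; exact: WS.
  have -> : j = i by exact/val_inj.
  have /andP[? ?] := hW a Wa; have /andP[? ?] := hW b Wb.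
  rewrite ltr_norml; apply/andP; split; lra.
elim: m => [|m [g1 hg1]].
  apply: (slab (lo - d / 2)); [by move=> x []|exact: convex_setI|].
  move=> x [Sx /=]; rewrite /cut mul0r addr0 => xc.
  have := coordM _ Sx; rewrite ler_norml /lo in xc * => /andP[? ?].
  by apply/andP; split; lra.
pose W := S' `&` [set x : V | x 0 i <= cut m.+1].
have cW : convex_set W by exact: convex_setI.
have WS : W `<=` S by move=> x [/sS'].
have [||x|g2 hg2] :=
    slab (cut m) (W `&` [set x : V | cut m <= x 0 i]).
- by move=> x [[]].
- exact: convex_setI.
- case=> -[_ h1] h2; rewrite h2 /=; move: h1; rewrite /= /cut -natr1; lra.
apply: (unif_cobound_glue (c := cut m) (i := i) (g1 := g1) (g2 := g2) d0 cW) => //.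
  exact: unif_cocycleS cf.
by move=> a b [[? _] ?] [[? _] ?]; apply: hg1.
Qed.

(** Compactness replaces radii that depend on the point by one scale: each ball of radius [d]
    centred in [X] fits, as far as [e] is concerned, into the ball of some other centre. Every
    passage from local to uniform statements below uses it. *)
Lemma lebesgue_number (X : set V) (e : V -> R) :
  compact X -> (forall x, X x -> 0 < e x) ->
  exists2 d : R, 0 < d &
    forall x, X x -> exists2 y, X y & forall a, `|x - a| < d -> `|y - a| < e y.
Proof.
move=> /compact_near_coveringP cX e0.
pose P (d : R) x := exists2 y, X y & forall a, `|x - a| < d -> `|y - a| < e y.
have : \forall d \near 0^'+, X `<=` P d.
  apply: cX => x Xx.
  exists (ball x (e x / 2), [set d | d < e x / 2]).
    split; first by apply: nbhsx_ballx; rewrite divr_gt0 ?e0.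
    by apply: nbhs_right_lt; rewrite divr_gt0 ?e0.
  move=> [x' d] /= [xx' dx]; exists x => // a x'a.
  move: xx'; rewrite -ball_normE /= => xx'.
  rewrite -(subrKA x'); apply: le_lt_trans (ler_normD _ _) _; lra.
move=> h; near (0 : R)^'+ => d.
exists d => //; suff : X `<=` P d by [].
by near: d.
Unshelve. all: by end_near. Qed.

End Cochains.

(** * The realization as a compact union of simplices *)

Section Realization.
Variables (R : realType) (Y : cellmap).
Hypothesis pY : polyhedral_map Y.
Local Notation P := (vert Y + face Y)%type.
Local Notation V := 'rV[R]_#|{: vert Y + face Y}|.
Local Notation X := (realization R Y).

Definition coord (x : V) (p : P) : R := x 0 (enum_rank p).

Definition corner_pt (p : P) : V := delta_mx 0 (enum_rank p).

Lemma coord_corner p q : coord (corner_pt p) q = (q == p)%:R.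
Proof. by rewrite /coord mxE eqxx (inj_eq enum_rank_inj). Qed.

Definition tri (f : face Y) (u v : vert Y) : seq P := [:: inl u; inl v; inr f].

Definition simplex (s : seq P) : set V :=
  [set x : V | [/\ forall i, 0 <= x 0 i, \sum_i x 0 i = 1
    & forall p, coord x p != 0 -> p \in s]].

Lemma realizationP x : X x <->
  exists f u v, edge_of f u v /\ simplex (tri f u v) x.
Proof.
split=> [[x0 x1 [f [u [v [e h]]]]]|[f [u [v [e [x0 x1 h]]]]]].
  by exists f, u, v.
by split=> //; exists f, u, v.
Qed.

Lemma simplex_realization f u v :
  edge_of f u v -> simplex (tri f u v) `<=` X.
Proof. by move=> e x sx; apply/realizationP; exists f, u, v. Qed.

Lemma simplexS (s s' : seq P) : {subset s <= s'} -> simplex s `<=` simplex s'.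
Proof. by move=> ss x [x0 x1 h]; split=> // p /h /ss. Qed.

Lemma simplex_coord_ge0 s x p : simplex s x -> 0 <= coord x p.
Proof. by case=> + _ _; apply. Qed.

Lemma simplex_convex s : convex_set (simplex s).
Proof.
move=> a b [a0 a1 ha] [b0 b1 hb] t /andP[t0 t1]; split.
- by move=> i; rewrite !mxE; have := a0 i; have := b0 i; nra.
- rewrite (eq_bigr (fun i => a 0 i + t * (b 0 i - a 0 i))); last first.
    by move=> i _; rewrite !mxE.
  by rewrite big_split /= -mulr_sumr sumrB a1 b1 subrr mulr0 addr0.
- move=> p; rewrite /coord !mxE => h.
  have [ap|/ha //] := eqVneq (coord a p) 0.
  have [bp|/hb //] := eqVneq (coord b p) 0.
  by move: h; rewrite /coord in ap bp; rewrite ap bp subrr mulr0 addr0 eqxx.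
Qed.

Lemma corner_simplex s p : p \in s -> simplex s (corner_pt p).
Proof.
move=> ps; split.
- by move=> i; rewrite mxE ler0n.
- rewrite (bigD1 (enum_rank p)) //= mxE !eqxx big1 ?addr0 // => i ip.
  by rewrite mxE (negPf ip) andbF.
- by move=> q; rewrite coord_corner; have [->|_] := eqVneq q p; rewrite ?eqxx.
Qed.

Lemma coord_dist (x y : V) p : `|coord x p - coord y p| <= `|x - y|.
Proof.
rewrite [leRHS]/Num.norm /= mx_normrE.
by apply/bigmax_geP; right => /=; exists (0, enum_rank p); rewrite ?mxE.
Qed.

Lemma realization_bounded x : X x -> `|x| <= 1.
Proof.
case=> x0 x1 _; rewrite [leLHS]/Num.norm /= mx_normrE.
apply/bigmax_leP; split=> // -[i j] _ /=; rewrite (ord1 i).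
rewrite ger0_norm // -x1 (bigD1 j) //= lerDl.
by apply: sumr_ge0.
Qed.

Lemma continuous_sum_coord n : continuous (fun x : 'rV[R]_n => \sum_i x 0 i).
Proof.
apply: (@continuous_big R 'I_n +%R 0 xpredT) => [|i _].
  exact: add_continuous.
exact: coord_continuous.
Qed.

Lemma simplex_closed s : closed (simplex s).
Proof.
have -> : simplex s = \bigcap_i [set x : V | 0 <= x 0 i] `&`
    [set x : V | \sum_i x 0 i = 1] `&`
    \bigcap_(p in [set p | p \notin s]) [set x : V | coord x p = 0].
  apply/seteqP; split=> [x [x0 x1 h]|x [[x0 x1] h]].
    split; [split=> //= i _; exact: x0|move=> p /= ps].
    by apply/eqP; apply: contraNT ps; exact: h.
  split=> // [i|p hp]; first exact: x0.
  by apply: contraNT hp => ps; apply/eqP; exact: (h p).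
apply: closedI; first apply: closedI.
- apply: closed_bigI => i _.
  apply: (preimage_closed (f := fun x : V => x 0 i) _ (@closed_ge _ 0)) => x _.
  exact: coord_continuous.
- apply: (preimage_closed (f := fun x : V => \sum_i x 0 i) _ (@closed_eq _ 1)) => x _.
  exact: continuous_sum_coord.
- apply: closed_bigI => p _.
  apply: (preimage_closed (f := fun x : V => coord x p) _ (@closed_eq _ 0)) => x _.
  exact: coord_continuous.
Qed.

Lemma realization_compact : compact X.
Proof.
apply: bounded_closed_compact.
  exists 1; split; first exact: num_real.
  by move=> M M1 x /realization_bounded /le_trans; apply; exact: ltW.
have -> : X = \bigcup_(t in [set t : face Y * (vert Y * vert Y) |
    edge_of t.1 t.2.1 t.2.2]) simplex (tri t.1 t.2.1 t.2.2).
  apply/seteqP; split=> [x /realizationP[f [u [v [e sx]]]]|x [[f [u v]] /= e sx]].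
    by exists (f, (u, v)).
  exact: simplex_realization sx.
apply: closed_bigcup => [|t _]; last exact: simplex_closed.
exact: finite_finset.
Qed.

End Realization.

Section CornerCochains.
Variable Y : cellmap.
Hypothesis pY : polyhedral_map Y.
Local Notation P := (vert Y + face Y)%type.
Implicit Types (a : face Y -> vert Y -> bool).

(* The triangulation of the realization has the edges [uv] of the map and the
   edges from a vertex to the apex of an incident face.  Its simplicial
   1-cocycles mod 2 are determined by their values [a f u] on the latter. *)
Definition corner_cocycle a :=
  forall f g u v, edge_of f u v -> edge_of g u v ->
    a f u (+) a f v = a g u (+) a g v.

(** A primitive of the cocycle on the cone over [f], normalized to vanish at the apex. *)
Definition corner_pot a (f : face Y) (p : P) : bool :=
  if p is inl u then a f u else false.

(** The cocycle on all edges of the triangulation. On an edge of the map the value may be read in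
    either adjacent face, because [corner_cocycle] makes them agree. *)
Definition edge_cochain a (p q : P) : bool :=
  match p, q with
  | inl u, inl v =>
      if [pick f | edge_of f u v] is Some f then a f u (+) a f v else false
  | inl u, inr f | inr f, inl u => (u \in bnd f) && a f u
  | inr _, inr _ => false
  end.

Lemma edge_cochain_tri a f u v p q : corner_cocycle a -> edge_of f u v ->
  p \in tri f u v -> q \in tri f u v ->
  edge_cochain a p q = corner_pot a f p (+) corner_pot a f q.
Proof.
move=> ca e.
have edge x y : edge_of f x y ->
    edge_cochain a (inl x) (inl y) = a f x (+) a f y.
  move=> exy /=; case: pickP => [g gxy|/(_ f)]; last by rewrite exy.
  exact: ca.
have diag x : edge_cochain a (inl x) (inl x) = false.
  by rewrite /=; case: pickP => // g; rewrite addbb.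
rewrite !inE => /or3P[] /eqP -> /or3P[] /eqP ->;
  rewrite ?diag ?addbb ?(edge _ _ e) //= ?addbF ?addFb ?(edge_ofl e) ?(edge_ofr e) //.
by rewrite -/(edge_cochain a (inl v) (inl u)) edge // edge_of_sym.
Qed.

Lemma edge_cochainD a b p q :
  edge_cochain (fun f u => a f u (+) b f u) p q =
  edge_cochain a p q (+) edge_cochain b p q.
Proof.
case: p q => [u|f] [v|g] //=; rewrite ?andb_addr //.
by case: pickP => // f _; rewrite addbACA.
Qed.

Lemma eq_edge_cochain a b : (forall f u, u \in bnd f -> a f u = b f u) ->
  edge_cochain a =2 edge_cochain b.
Proof.
move=> ab [u|f] [v|g] //=.
- by case: pickP => // f e; rewrite !ab //; [exact: edge_ofr e|exact: edge_ofl e].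
- by have := ab g u; case: (u \in bnd g) => //= ->.
- by have := ab f v; case: (v \in bnd f) => //= ->.
Qed.

End CornerCochains.

(** * Simplicial and Alexander-Spanier cocycles compared *)

Section RealizationCochains.
Variables (R : realType) (Y : cellmap).
Hypothesis pY : polyhedral_map Y.
Local Notation P := (vert Y + face Y)%type.
Local Notation V := 'rV[R]_#|{: vert Y + face Y}|.
Local Notation X := (realization R Y).
Variable p0 : P.
Local Notation pt := (corner_pt R).

(** A discretization: a point of a triangle has three barycentric coordinates of sum 1, so one of
    them is at least 1/3. The default [p0] is never taken on the realization. *)
Definition near_corner (x : V) : P := odflt p0 [pick p | 3^-1 <= coord x p].

Lemma near_corner_large x : X x -> 3^-1 <= coord x (near_corner x).
Proof.
move=> /realizationP[f [u [v [e [x0 x1 h]]]]].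
rewrite /near_corner; case: pickP => //= hn.
have lt p : coord x p < 3^-1 by rewrite ltNge hn.
have uv : inl v != inl u :> P.
  by apply/eqP => -[uv]; move: (edge_of_neq pY e); rewrite uv eqxx.
suff : \sum_i x 0 i < 1 by rewrite x1 ltxx.
rewrite (reindex_onto (@enum_rank P) enum_val) => [|i _]; last exact: enum_valK.
rewrite (eq_bigl xpredT) => [|p]; last by rewrite enum_rankK eqxx.
rewrite (bigD1 (inl u)) // (bigD1 (inl v)) // (bigD1 (inr f)) //= big1.
  by have := lt (inl u); have := lt (inl v); have := lt (inr f); rewrite /coord; lra.
move=> p /andP[/andP[pu pv] pf]; apply/eqP; apply/negPn/negP => /h.
by rewrite !inE (negPf pu) (negPf pv) (negPf pf).
Qed.

Lemma near_corner_pt p : near_corner (pt p) = p.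
Proof.
rewrite /near_corner; case: pickP => [q|/(_ p)]; rewrite coord_corner ?eqxx /=.
  by have [->//|_] := eqVneq q p => h; exfalso; move: h => /=; lra.
by move=> h; exfalso; move: h => /=; lra.
Qed.

(** A coordinate that is at least 1/3 at [y] is still positive at [x], coordinates being
    1-Lipschitz. This is where the scale [3^-1] of all simplicial cochains comes from. *)
Lemma near_corner_mem x y s : simplex s x -> X y -> `|x - y| < 3^-1 ->
  near_corner y \in s.
Proof.
move=> [x0 x1 h] Xy xy; apply: h; rewrite gt_eqF //.
have := near_corner_large Xy; have := coord_dist x y (near_corner y).
rewrite ler_norml => /andP[? ?]; lra.
Qed.

Lemma near_corner_self x s : X x -> simplex s x -> near_corner x \in s.
Proof.
by move=> Xx sx; apply: near_corner_mem sx Xx _; rewrite subrr normr0; lra.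
Qed.

Definition as_cochain (a : face Y -> vert Y -> bool) (x y : V) : bool :=
  edge_cochain a (near_corner x) (near_corner y).

Lemma as_cochain_tri a f u v x y : corner_cocycle a -> edge_of f u v ->
  near_corner x \in tri f u v -> near_corner y \in tri f u v ->
  as_cochain a x y =
    corner_pot a f (near_corner x) (+) corner_pot a f (near_corner y).
Proof. by move=> ca e xT yT; rewrite /as_cochain (edge_cochain_tri pY ca e). Qed.

(** The near corners of all points within 1/3 of [x] lie in a single triangle carrying [x], and
    there the cochain is the coboundary of [corner_pot]. *)
Lemma as_cochain_cocycle a : corner_cocycle a ->
  unif_cocycle X 3^-1 (as_cochain a).
Proof.
move=> ca x y z Xx Xy Xz xy xz.
have /realizationP[f [u [v [e Tx]]]] := Xx.
have mx := near_corner_self Xx Tx.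
have [my mz] := (near_corner_mem Tx Xy xy, near_corner_mem Tx Xz xz).
by rewrite !(as_cochain_tri ca e) //; do 3 case: (corner_pot _ _ _).
Qed.

(** Injectivity from simplicial to Alexander-Spanier cohomology: on the segment from [u] to the apex
    of [f], the sum of [g] and the simplicial potential is locally constant, hence equal at the two
    ends. *)
Lemma as_cochain_inj a d g : corner_cocycle a -> 0 < d ->
  unif_cobound X d (as_cochain a) g ->
  forall f u, u \in bnd f -> a f u = g (pt (inl u)) (+) g (pt (inr f)).
Proof.
move=> ca d0 hg f u uf.
have e := edge_of_next uf.
pose s : seq P := [:: inl u; inr f].
have ss : {subset s <= tri f u (next (bnd f) u)}.
  by move=> p; rewrite !inE => /orP[] ->; rewrite ?orbT.
have sX x : simplex s x -> X x.
  by move=> sx; apply: (simplex_realization e); exact: simplexS sx.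
pose k x := g x (+) corner_pot a f (near_corner x).
pose d' := Num.min d 3^-1.
have d'0 : 0 < d' by rewrite lt_min d0 invr_gt0 ltr0Sn.
have := @convex_unif_const _ _ (simplex s) d' k (@simplex_convex R Y s) d'0.
move=> /(_ _ (pt (inl u)) (pt (inr f))).
rewrite /k !near_corner_pt /= addbF => <-; first by case: (a f u); case: (g _).
- move=> x y sx sy; rewrite lt_min => /andP[xy xy3].
  have := hg x y (sX _ sx) (sX _ sy) xy.
  rewrite (as_cochain_tri ca e); [|apply/ss..].
  + by do 2 case: (corner_pot _ _ _); case: (g x); case: (g y).
  + by apply: near_corner_self => //; exact: sX.
  + by apply: near_corner_self => //; exact: sX.
- by apply: corner_simplex; rewrite mem_head.
- by apply: corner_simplex; rewrite !inE eqxx orbT.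
Qed.

Lemma coord_lower_bound (z : V) : (forall i, 0 <= z 0 i) ->
  exists2 e : R, 0 < e & forall p, coord z p != 0 -> e <= coord z p.
Proof.
move=> z0.
have [e e0 he] : exists2 e : R, 0 < e &
    forall p, p \in enum {: P} -> coord z p != 0 -> e <= coord z p.
  elim: (enum {: P}) => [|p s [e e0 IH]]; first by exists 1.
  exists (if coord z p == 0 then e else Num.min e (coord z p)).
    case: ifP => // /negbT zp; rewrite lt_min e0 lt_def zp /=; exact: z0.
  move=> q; rewrite inE => /predU1P[->|qs] zq.
    by rewrite (negPf zq) ge_min lexx orbT.
  by case: ifP => _; [exact: IH|rewrite ge_min IH].
by exists e => // p; apply: he; rewrite mem_enum.
Qed.

(** Surjectivity. The Poincare lemma gives a primitive [G t] on each triangle; on a common part of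
    two triangles primitives differ by a constant. Hence differences of [G t] between corners define
    [a], and the difference between a point and its near corner defines [g]. *)
Lemma as_cochain_surj d f : 0 < d -> unif_cocycle X d f ->
  exists a, corner_cocycle a /\ exists g : V -> bool,
    forall z, X z -> exists2 e : R, 0 < e & forall x y, X x -> X y ->
      `|z - x| < e -> `|z - y| < e ->
      f x y (+) as_cochain a x y = g x (+) g y.
Proof.
move=> d0 cf.
pose T (t : face Y * vert Y * vert Y) := tri t.1.1 t.1.2 t.2.
pose edge (t : face Y * vert Y * vert Y) := edge_of t.1.1 t.1.2 t.2.
have TX t x : edge t -> simplex (T t) x -> X x.
  by move=> et; exact: simplex_realization.
have [G hG] : {G : face Y * vert Y * vert Y -> V -> bool &
    forall t, edge t -> unif_cobound (simplex (T t)) d f (G t)}.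
  apply: (@boolp.choice _ _ (fun t g => edge t ->
    unif_cobound (simplex (T t)) d f g)) => t; have [et|_] := boolP (edge t); last by exists xpredT.
  have [g hg] := @convex_unif_cobound _ _ (simplex (T t)) d 1 f d0
    (@simplex_convex R Y _) (fun x sx => realization_bounded (TX t x et sx))
    (unif_cocycleS (fun x => TX t x et) cf).
  by exists g.
have indep t t' x y : edge t -> edge t' -> simplex (T t) x -> simplex (T t) y ->
    simplex (T t') x -> simplex (T t') y ->
    G t x (+) G t y = G t' x (+) G t' y.
  move=> et et' Tx Ty T'x T'y.
  have kk z w : (simplex (T t) `&` simplex (T t')) z ->
      (simplex (T t) `&` simplex (T t')) w -> `|z - w| < d ->
      G t z (+) G t' z = G t w (+) G t' w.
    move=> [Tz T'z] [Tw T'w] zw.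
    have := hG t et z w Tz Tw zw; rewrite (hG t' et' z w) //.
    by case: (G t z); case: (G t w); case: (G t' z); case: (G t' w).
  have := convex_unif_const (convex_setI (@simplex_convex R Y _) (@simplex_convex R Y _))
    d0 kk (conj Tx T'x) (conj Ty T'y).
  by case: (G t x); case: (G t y); case: (G t' x); case: (G t' y).
pose a f' u := let t := (f', u, next (bnd f') u) in
  G t (pt (inl u)) (+) G t (pt (inr f')).
have hT0 t : inl t.1.2 \in T t by rewrite mem_head.
have hT1 t : inl t.2 \in T t by rewrite !inE eqxx orbT.
have hT2 t : inr t.1.1 \in T t by rewrite !inE eqxx !orbT.
have aE t u : edge t -> u \in bnd t.1.1 -> inl u \in T t ->
    a t.1.1 u = G t (pt (inl u)) (+) G t (pt (inr t.1.1)).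
  move=> et ut uT; apply: indep => //.
  - exact: edge_of_next.
  - exact: corner_simplex (hT0 (_, u, _)).
  - exact: corner_simplex (hT2 (t.1.1, _, _)).
  - exact: corner_simplex.
  - exact: corner_simplex.
have ca : corner_cocycle a.
  move=> f1 f2 u v e1 e2.
  have A (f' : face Y) (e' : edge_of f' u v) : a f' u (+) a f' v =
      G (f', u, v) (pt (inl u)) (+) G (f', u, v) (pt (inl v)).
    rewrite (aE (f', u, v) u) ?(aE (f', u, v) v) //=.
    - by do 3 case: (G _ _).
    - exact: edge_ofr e'.
    - exact: (hT1 (f', u, v)).
    - exact: edge_ofl e'.
    - exact: (hT0 (f', u, v)).
  rewrite !A //; apply: indep => //; apply: corner_simplex.
  - exact: (hT0 (f1, u, v)).
  - exact: (hT1 (f1, u, v)).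
  - exact: (hT0 (f2, u, v)).
  - exact: (hT1 (f2, u, v)).
have aT t p q : edge t -> p \in T t -> q \in T t ->
    edge_cochain a p q = G t (pt p) (+) G t (pt q).
  move=> et pT qT; rewrite (edge_cochain_tri pY ca et) //.
  have B r : r \in T t ->
      corner_pot a t.1.1 r = G t (pt r) (+) G t (pt (inr t.1.1)).
    rewrite !inE => /or3P[] /eqP -> /=; last by rewrite addbb.
      by apply: aE => //; exact: edge_ofl et.
    by apply: aE => //; exact: edge_ofr et.
  by rewrite !B //; do 3 case: (G _ _).
have [t ht] : {t : V -> face Y * vert Y * vert Y &
    forall x, X x -> edge (t x) /\ simplex (T (t x)) x}.
  apply: (@boolp.choice _ _ (fun x t => X x ->
    edge t /\ simplex (T t) x)) => x; have [Xx|nX] := pselect (X x); last first.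
    have [f0 _] : exists f0 : face Y, True.
      by case: p0 => [u|f0]; [have [f0 _] := vert_face pY u; exists f0|exists f0].
    by have [u _] := face_vert pY f0; exists (f0, u, u).
  by move/realizationP: Xx => [f1 [u [v [e sx]]]]; exists (f1, u, v).
pose g x := G (t x) x (+) G (t x) (pt (near_corner x)).
have gE t' x : edge t' -> simplex (T t') x ->
    g x = G t' x (+) G t' (pt (near_corner x)).
  move=> et' T'x; have Xx := TX _ _ et' T'x; have [et Tx] := ht x Xx.
  by apply: indep => //; apply: corner_simplex; exact: near_corner_self.
exists a; split=> //; exists g => z Xz.
have z0 : forall i, 0 <= z 0 i by case/realizationP: Xz => ? [? [? [? []]]].
have [e1 e10 he1] := coord_lower_bound z0.
(* Within [e1] of [z] the positive coordinates of [z] stay positive, so every triangle carrying [x]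
   carries [z] too and one primitive serves both. The other two bounds are the scales of [f] and of
   the simplicial cochain. *)
exists (Num.min e1 (Num.min d 3^-1)); first by rewrite !lt_min e10 d0 /= invr_gt0.
have main x : X x -> `|z - x| < e1 -> `|z - x| < d ->
    f z x (+) as_cochain a z x = g z (+) g x.
  move=> Xx zx1 zxd; have [et Tx] := ht x Xx.
  have Tz : simplex (T (t x)) z.
    have [_ _ hx] := Tx; have [_ z1 _] := Xz; split=> // p zp; apply: hx.
    rewrite gt_eqF //; have := he1 p zp; have := coord_dist z x p.
    rewrite ler_norml => /andP[? ?] ?; lra.
  rewrite (hG _ et) // /as_cochain (aT _ _ _ et); last 2 first.
  - exact: near_corner_self.
  - exact: near_corner_self.
  by rewrite !(gE (t x)) // addbACA.
move=> x y Xx Xy; rewrite !lt_min => /and3P[zx1 zxd zx3] /and3P[zy1 zyd zy3].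
rewrite (cf z x y) // (as_cochain_cocycle ca Xz Xx Xy) //.
have := main x Xx zx1 zxd; have := main y Xy zy1 zyd.
case: (f z x); case: (f z y); case: (as_cochain a z x);
  case: (as_cochain a z y); case: (g z); by case: (g x); case: (g y).
Qed.

Lemma realization_const_incidence (S : P -> bool) :
  (forall f u, u \in bnd f -> S (inl u) = S (inr f)) ->
  forall x y, X x -> X y -> `|x - y| < 3^-1 ->
    S (near_corner x) = S (near_corner y).
Proof.
move=> hS x y Xx Xy xy.
have /realizationP[f [u [v [e Tx]]]] := Xx.
have A p : p \in tri f u v -> S p = S (inr f).
  by rewrite !inE => /or3P[] /eqP -> //; apply: hS;
     [exact: edge_ofl e|exact: edge_ofr e].
by rewrite !A //; [exact: near_corner_mem Tx Xy xy|exact: near_corner_self].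
Qed.

Lemma realization_connected (d : R) (g : V -> bool) :
  incidence_connected Y -> 0 < d ->
  (forall x y, X x -> X y -> `|x - y| < d -> g x = g y) ->
  forall x y, X x -> X y -> g x = g y.
Proof.
move=> cY d0 hg.
have simp f u v x y : edge_of f u v -> simplex (tri f u v) x ->
    simplex (tri f u v) y -> g x = g y.
  move=> e; apply: (convex_unif_const (@simplex_convex R Y _) d0) => z w Tz Tw.
  by apply: hg; exact: (simplex_realization e).
have corner : forall p q, g (pt p) = g (pt q).
  apply: (cY (fun p => g (pt p))) => f u uf; apply: (simp f u _ _ _ (edge_of_next uf)).
    by apply: corner_simplex; rewrite mem_head.
  by apply: corner_simplex; rewrite !inE eqxx !orbT.
have near x : X x -> g x = g (pt p0).
  move=> /realizationP[f [u [v [e Tx]]]].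
  rewrite (simp f u v x (pt (inl u)) e Tx) //.
  by apply: corner_simplex; rewrite mem_head.
by move=> x y Xx Xy; rewrite !near.
Qed.

End RealizationCochains.

Section SetType.
Variables (R : realType) (n : nat) (A : set 'rV[R]_n).

Lemma nbhs_set_typeP (x : set_type A) (U : set (set_type A)) :
  nbhs x U <-> exists2 e : R, 0 < e &
    forall y : set_type A, `|val x - val y| < e -> U y.
Proof.
split.
  move=> [_ [/= [W oW <-] Wx sWU]].
  have /nbhs_ballP[e /= e0 he] : nbhs (val x) W by exact: open_nbhs_nbhs.
  by exists e => // y xy; apply: sWU; apply: he; rewrite -ball_normE.
move=> [e e0 he].
have : nbhs (val x) (ball (val x) e) by exact: nbhsx_ballx.
rewrite nbhsE => -[W [oW Wx sW]].
exists (val @^-1` W); split => //=; first by exists W.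
by move=> y /= /sW; rewrite -ball_normE => /he.
Qed.

Definition in_set_type (x : 'rV[R]_n) (Ax : A x) : set_type A :=
  exist (fun x => x \in A) x (mem_set Ax).

Lemma set_type_in (x : set_type A) : A (val x).
Proof. exact/set_mem/valP. Qed.

Lemma insubd_set (x0 : set_type A) x : A x -> val (insubd x0 x) = x.
Proof. by move=> Ax; rewrite val_insubd mem_set. Qed.

End SetType.

(** * Transfer of cohomology classes along a homeomorphism *)

Section Transfer.
Variables (R : realType) (Y Z : cellmap).
Hypotheses (pY : polyhedral_map Y) (pZ : polyhedral_map Z).
Local Notation VY := 'rV[R]_#|{: vert Y + face Y}|.
Local Notation VZ := 'rV[R]_#|{: vert Z + face Z}|.
Local Notation XY := (set_type (realization R Y)).
Local Notation XZ := (set_type (realization R Z)).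
Variables (h : XY -> XZ) (k : XZ -> XY).
Hypotheses (ch : continuous h) (ck : continuous k).
Hypotheses (hk : cancel h k) (kh : cancel k h).
Variables (pY0 : vert Y + face Y) (pZ0 : vert Z + face Z).

Let corner_in (W : cellmap) (pW : polyhedral_map W) (p : vert W + face W) :
  realization R W (corner_pt R p).
Proof.
have [f [u [uf hp]]] : exists f u, u \in bnd f /\ p \in [:: inl u; inr f].
  case: p => [u|f].
    by have [f uf] := vert_face pW u; exists f, u; rewrite mem_head.
  by have [u uf] := face_vert pW f; exists f, u; rewrite !inE eqxx orbT.
apply: (simplex_realization (edge_of_next uf)); apply: corner_simplex.
by move: hp; rewrite !inE => /orP[] ->; rewrite ?orbT.
Qed.

Let xY0 : XY := in_set_type (corner_in pY pY0).

Lemma continuous_ball (x : XY) (e : R) : 0 < e ->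
  exists2 d : R, 0 < d &
    forall y : XY, `|val x - val y| < d -> `|val (h x) - val (h y)| < e.
Proof.
move=> e0.
have : nbhs (h x) [set z : XZ | `|val (h x) - val z| < e].
  by apply/nbhs_set_typeP; exists e.
by move/ch => /nbhs_set_typeP[d d0 hd]; exists d.
Qed.

(** The cochain of [a] and the pull-back along [h] of the cochain of [b] differ by the coboundary of
    a global [g], at a scale that may depend on the point. Only continuity of [h] is thus required
    to produce such relations. *)
Definition cohomologous (a : face Y -> vert Y -> bool)
    (b : face Z -> vert Z -> bool) :=
  exists g : XY -> bool, forall x : XY, exists2 e : R, 0 < e &
    forall y y' : XY, `|val x - val y| < e -> `|val x - val y'| < e ->
      as_cochain pY0 a (val y) (val y') (+)
      as_cochain pZ0 b (val (h y)) (val (h y')) = g y (+) g y'.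

Lemma cohomologousD a a' b b' : cohomologous a b -> cohomologous a' b' ->
  cohomologous (fun f u => a f u (+) a' f u) (fun f u => b f u (+) b' f u).
Proof.
move=> [g hg] [g' hg']; exists (fun x => g x (+) g' x) => x.
have [e e0 he] := hg x; have [e' e'0 he'] := hg' x.
exists (Num.min e e'); first by rewrite lt_min e0.
move=> y y'; rewrite !lt_min => /andP[xy1 xy2] /andP[xy3 xy4].
rewrite /as_cochain !edge_cochainD addbACA.
by rewrite /as_cochain in he he'; rewrite he // he' // addbACA.
Qed.

Lemma cohomologous0 : cohomologous (fun _ _ => false) (fun _ _ => false).
Proof.
exists xpredT => x; exists 1 => // y y' _ _; rewrite /as_cochain.
have E (W : cellmap) p q : edge_cochain (fun (f : face W) u => false) p q = false.
  by case: p q => [u|f] [v|g] //=; rewrite ?andbF //; case: pickP.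
by rewrite !E.
Qed.

Lemma eq_cohomologous a b b' : (forall f u, u \in bnd f -> b f u = b' f u) ->
  cohomologous a b -> cohomologous a b'.
Proof.
move=> bb [g hg]; exists g => x; have [e e0 he] := hg x; exists e => // y y' xy xy'.
by rewrite -he // /as_cochain (eq_edge_cochain bb).
Qed.

Lemma unif_of_local_cobound (a : VY -> VY -> bool) (g : XY -> bool) :
  (forall x : XY, exists2 e : R, 0 < e &
    forall y y' : XY, `|val x - val y| < e -> `|val x - val y'| < e ->
      a (val y) (val y') = g y (+) g y') ->
  exists2 d : R, 0 < d & exists G, unif_cobound (realization R Y) d a G.
Proof.
move=> hg.
have [e he] : {e : XY -> R & forall x, 0 < e x /\
    forall y y' : XY, `|val x - val y| < e x -> `|val x - val y'| < e x ->
      a (val y) (val y') = g y (+) g y'}.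
  apply: (@boolp.choice _ _ (fun x e => 0 < e /\
    forall y y' : XY, `|val x - val y| < e -> `|val x - val y'| < e ->
      a (val y) (val y') = g y (+) g y')) => x.
  by have [e e0 h1] := hg x; exists e.
have [|d d0 hd] := @lebesgue_number _ _ (realization R Y)
  (fun x => e (insubd xY0 x)) (@realization_compact R Y).
  by move=> x _; have [] := he (insubd xY0 x).
exists d => //; exists (fun x => g (insubd xY0 x)) => x y Xx Xy xy.
have [z Xz hz] := hd x Xx; have [_ hez] := he (insubd xY0 z).
have := hez (insubd xY0 x) (insubd xY0 y); rewrite !insubd_set //.
by apply; apply: hz; rewrite ?subrr ?normr0.
Qed.

(** A primitive of [b] evaluated at the near corner of [h y] turns the relation into a local
    primitive of [a]; [lebesgue_number] makes it uniform, and [as_cochain_inj] makes it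
    simplicial. *)
Lemma cohomologous_inj a b : corner_cocycle a -> cohomologous a b ->
  (exists s t, forall f u, u \in bnd f -> b f u = s u (+) t f) ->
  exists s t, forall f u, u \in bnd f -> a f u = s u (+) t f.
Proof.
move=> ca [g hg] [s [t st]].
pose S (p : vert Z + face Z) := match p with inl u => s u | inr f => t f end.
pose G (x : XY) := g x (+) S (near_corner pZ0 (val (h x))).
have cb : corner_cocycle b.
  move=> f f' u v e e'.
  rewrite !st ?(edge_ofl e) ?(edge_ofl e') ?(edge_ofr e) ?(edge_ofr e') //.
  by case: (s u); case: (s v); case: (t f); case: (t f').
have [|d d0 [G' hG']] := @unif_of_local_cobound (as_cochain pY0 a) G.
  move=> x; have [e e0 he] := hg x.
  have i3 : 0 < 3^-1 :> R by rewrite invr_gt0 ltr0Sn.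
  have [d d0 hd] := continuous_ball x i3.
  exists (Num.min e d); first by rewrite lt_min e0.
  move=> y y'; rewrite !lt_min => /andP[xy xyd] /andP[xy' xyd'].
  have := he y y' xy xy'.
  have /realizationP[f [u [v [eu Tx]]]] := set_type_in (h x).
  have my := near_corner_mem pZ pZ0 Tx (set_type_in (h y)) (hd _ xyd).
  have my' := near_corner_mem pZ pZ0 Tx (set_type_in (h y')) (hd _ xyd').
  rewrite (as_cochain_tri pZ cb eu my my').
  have A p : p \in tri f u v -> corner_pot b f p = S p (+) t f.
    rewrite !inE => /or3P[] /eqP -> /=; last by rewrite addbb.
      by rewrite st //; exact: edge_ofl eu.
    by rewrite st //; exact: edge_ofr eu.
  rewrite !A // /G.
  by case: (as_cochain _ _ _ _); do 2 case: (S _); case: (t f); do 2 case: (g _).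
exists (fun u => G' (corner_pt R (inl u))), (fun f => G' (corner_pt R (inr f))).
exact: (as_cochain_inj pY ca d0 hG').
Qed.

(** The cochain of [a] is carried to the other realization by the inverse map [k]; it is a uniform
    cocycle there, and [as_cochain_surj] approximates it by a simplicial one. *)
Lemma cohomologous_ex a : corner_cocycle a ->
  exists2 b, corner_cocycle b & cohomologous a b.
Proof.
move=> ca; pose z0 := h xY0.
pose f (z z' : VZ) :=
  as_cochain pY0 a (val (k (insubd z0 z))) (val (k (insubd z0 z'))).
(* Half of 1/3, since two points at distance below [d] are compared through a common centre. *)
have loc (z : XZ) : exists2 e : R, 0 < e &
    forall z' : XZ, `|val z - val z'| < e ->
      `|val (k z) - val (k z')| < 3^-1 / 2.
  have : nbhs (k z) [set y : XY | `|val (k z) - val y| < 3^-1 / 2].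
    by apply/nbhs_set_typeP; exists (3^-1 / 2) => //; rewrite !divr_gt0 ?invr_gt0 ?ltr0Sn.
  by move/ck => /nbhs_set_typeP[e e0 he]; exists e.
have [e he] : {e : XZ -> R & forall z, 0 < e z /\
    forall z' : XZ, `|val z - val z'| < e z ->
      `|val (k z) - val (k z')| < 3^-1 / 2}.
  apply: (@boolp.choice _ _ (fun z e => 0 < e /\
    forall z' : XZ, `|val z - val z'| < e ->
      `|val (k z) - val (k z')| < 3^-1 / 2)) => z.
  by have [e e0 h1] := loc z; exists e.
have [|d d0 hd] := @lebesgue_number _ _ (realization R Z)
  (fun x => e (insubd z0 x)) (@realization_compact R Z).
  by move=> x _; have [] := he (insubd z0 x).
have near x y : realization R Z x -> realization R Z y -> `|x - y| < d ->
    `|val (k (insubd z0 x)) - val (k (insubd z0 y))| < 3^-1.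
  move=> Xx Xy xy; have [z Xz hz] := hd x Xx; have [_ hez] := he (insubd z0 z).
  have := hez (insubd z0 x); have := hez (insubd z0 y); rewrite !insubd_set //.
  move=> /(_ (hz _ xy)) h1 /(_ (hz x _)); rewrite subrr normr0 => /(_ d0) h2.
  rewrite -(subrKA (val (k (insubd z0 z)))).
  by apply: le_lt_trans (ler_normD _ _) _; rewrite [ltRHS]splitr ltrD // distrC.
have cf : unif_cocycle (realization R Z) d f.
  move=> x y y' Xx Xy Xy' xy xy'.
  by apply: (as_cochain_cocycle pY pY0 ca); try exact: set_type_in; exact: near.
have [b [cb [g hg]]] := as_cochain_surj pZ pZ0 d0 cf.
exists b => //; exists (fun x => g (val (h x))) => x.
have [e1 e10 he1] := hg _ (set_type_in (h x)).
have [d1 d10 hd1] := continuous_ball x e10.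
exists d1 => // y y' xy xy'.
have := he1 _ _ (set_type_in (h y)) (set_type_in (h y')) (hd1 _ xy) (hd1 _ xy').
by rewrite /f !valKd !hk.
Qed.

(** A colouring of cells of [Y] becomes the colour of the near corner of [k z], which is locally
    constant in [z], hence constant over the connected [Z]. *)
Lemma incidence_connected_transfer :
  incidence_connected Z -> incidence_connected Y.
Proof.
move=> cZ S hS p q.
pose z0 := h xY0.
pose g (z : VZ) := S (near_corner pY0 (val (k (insubd z0 z)))).
have i3 : 0 < 3^-1 :> R by rewrite invr_gt0 ltr0Sn.
have [e he] : {e : XZ -> R & forall z, 0 < e z /\
    forall z' : XZ, `|val z - val z'| < e z ->
      `|val (k z) - val (k z')| < 3^-1}.
  apply: (@boolp.choice _ _ (fun z e => 0 < e /\
    forall z' : XZ, `|val z - val z'| < e ->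
      `|val (k z) - val (k z')| < 3^-1)) => z.
  have : nbhs (k z) [set y : XY | `|val (k z) - val y| < 3^-1].
    by apply/nbhs_set_typeP; exists 3^-1.
  by move/ck => /nbhs_set_typeP[e e0 he]; exists e.
have [|d d0 hd] := @lebesgue_number _ _ (realization R Z)
  (fun x => e (insubd z0 x)) (@realization_compact R Z).
  by move=> x _; have [] := he (insubd z0 x).
have hg x y : realization R Z x -> realization R Z y -> `|x - y| < d ->
    g x = g y.
  move=> Xx Xy xy; have [z Xz hz] := hd x Xx; have [_ hez] := he (insubd z0 z).
  have A w : `|x - w| < d -> realization R Z w ->
      g w = S (near_corner pY0 (val (k (insubd z0 z)))).
    move=> xw Xw; symmetry; apply: realization_const_incidence => //;
      try exact: set_type_in.
    by apply: hez; rewrite !insubd_set //; exact: hz.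
  by rewrite !A // subrr normr0.
have G := realization_connected pZ0 cZ d0 hg.
have E r : S r = g (val (h (in_set_type (corner_in pY r)))).
  by rewrite /g valKd hk /= near_corner_pt.
by rewrite (E p) (E q); apply: G; exact: set_type_in.
Qed.

End Transfer.

(** * Betti numbers mod 2 and the Euler characteristic *)

Section Betti.
Local Open Scope nat_scope.
Local Open Scope ring_scope.
Variable Y : cellmap.
Hypothesis pY : polyhedral_map Y.
Hypothesis cY : incidence_connected Y.
Variable q0 : vert Y + face Y.
Local Notation K := 'F_2.
Implicit Types (f g : face Y) (u v : vert Y).

Definition corner := {c : face Y * vert Y | c.2 \in bnd c.1}.

Definition edge_pred : pred (vert Y * vert Y) := fun e =>
  (enum_rank e.1 < enum_rank e.2)%N && [exists f, edge_of f e.1 e.2].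

Definition edge := {e : vert Y * vert Y | edge_pred e}.

Definition coboundary0 : 'M[K]_(#|{: vert Y + face Y}|, #|{: corner}|) :=
  \matrix_(i, j) let c := val (enum_val j) in
    ((enum_val i == inl c.2) || (enum_val i == inr c.1))%:R.

Definition constraint (c : corner) (e : edge) : bool :=
  edge_of (val c).1 (val e).1 (val e).2 &&
  (((val c).2 == (val e).1) || ((val c).2 == (val e).2)).

(** Once the values on the edges of the map are eliminated, the cocycle condition leaves one
    equation per edge: its two faces give the same sum over its ends. The columns are these
    equations. *)
Definition coboundary1 : 'M[K]_(#|{: corner}|, #|{: edge}|) :=
  \matrix_(i, j) (constraint (enum_val i) (enum_val j))%:R.

Lemma F2_case (x : K) : x = 0 \/ x = 1.
Proof. by case: x => [[|[|//]] ?]; [left|right]; exact/val_inj. Qed.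

Lemma F2_addxx (x : K) : x + x = 0.
Proof. by case: (F2_case x) => ->; exact/val_inj. Qed.

Lemma F2_sum_eq0 (x y : K) : x + y = 0 -> x = y.
Proof. by case: (F2_case x) => ->; case: (F2_case y) => ->. Qed.

Lemma F2_addb (a b : bool) : (a (+) b)%:R = a%:R + b%:R :> K.
Proof. by case: a; case: b => //; exact/val_inj. Qed.

Lemma F2_eq1 (x : K) : (x == 1)%:R = x.
Proof. by case: (F2_case x) => ->. Qed.

Lemma rank_const_kernel m n (A : 'M[K]_(m, n)) : (0 < m)%N ->
  (forall x : 'rV_m, x *m A = 0 <-> exists k : K, x = k *: const_mx 1) ->
  (\rank A).+1 = m.
Proof.
move=> m0 hA; have : \rank (kermx A) = 1%N.
  have /eqmxP h : (kermx A == (const_mx 1 : 'rV[K]_m))%MS.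
    apply/andP; split.
      apply/rV_subP => x /sub_kermxP /hA[k ->]; exact: scalemx_sub.
    by apply/sub_kermxP/hA; exists 1; rewrite scale1r.
  by rewrite h rank_rV; case: eqP => // /matrixP/(_ 0 (Ordinal m0)); rewrite !mxE.
by rewrite mxrank_ker; have := rank_leq_row A; lia.
Qed.

Lemma sum_enum_val (T : finType) (F : T -> K) :
  \sum_(i < #|T|) F (enum_val i) = \sum_t F t.
Proof.
by rewrite [RHS](reindex_onto (@enum_val T T) enum_rank) => [|t _];
  rewrite ?enum_rankK //; apply: eq_bigl => i; rewrite enum_valK eqxx.
Qed.

Lemma sum_corner (F : face Y -> vert Y -> K) :
  \sum_(c : corner) F (val c).1 (val c).2 =
  \sum_(f : face Y) \sum_(u | u \in bnd f) F f u.
Proof.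
rewrite pair_big_dep /= (reindex_omap (val : corner -> _) insub) /=; last first.
  by move=> [f u] /= uf; rewrite insubT.
by apply: eq_bigl => c; rewrite (valP c) valK eqxx.
Qed.

Lemma mulmx_coboundary0 (x : 'rV[K]_#|{: vert Y + face Y}|) (c : corner) :
  (x *m coboundary0) 0 (enum_rank c) =
    x 0 (enum_rank (inl (val c).2)) + x 0 (enum_rank (inr (val c).1)).
Proof.
rewrite mxE; transitivity (\sum_(p : vert Y + face Y) x 0 (enum_rank p) *
    ((p == inl (val c).2) || (p == inr (val c).1))%:R).
  by rewrite -[RHS]sum_enum_val; apply: eq_bigr => i _; rewrite mxE /= !enum_rankK enum_valK.
rewrite (bigD1 (inl (val c).2)) // (bigD1 (inr (val c).1)) //= big1.
  by rewrite !eqxx /= !mulr1 addr0.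
by move=> p /andP[/negPf -> /negPf ->]; rewrite mulr0.
Qed.

Lemma rank_coboundary0 : (\rank coboundary0).+1 = #|{: vert Y + face Y}|.
Proof.
apply: rank_const_kernel; first by apply/card_gt0P; exists q0.
move=> x; split=> [h|[k ->]].
  exists (x 0 (enum_rank q0)); apply/rowP => i; rewrite !mxE mulr1.
  have := cY (S := fun p => x 0 (enum_rank p) == x 0 (enum_rank q0)).
  move=> /(_ _ (enum_val i) q0); rewrite eqxx enum_valK => H; apply/eqP; apply: H.
  move=> f u uf; congr (_ == _); apply: F2_sum_eq0.
  pose c : corner := exist (fun c : face Y * vert Y => c.2 \in bnd c.1) (f, u) uf.
  by rewrite -(mulmx_coboundary0 x c) h mxE.
apply/rowP => j; rewrite -(enum_valK j) mulmx_coboundary0 !mxE !mulr1.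
exact: F2_addxx.
Qed.

Definition ordered_edges : pred (vert Y * vert Y) :=
  fun e => [exists f, edge_of f e.1 e.2].

Lemma card_ordered_edges : #|ordered_edges| = (2 * #|{: edge}|)%N.
Proof.
rewrite -(cardID (fun e : vert Y * vert Y => (enum_rank e.1 < enum_rank e.2)%N)).
have -> : #|[predD ordered_edges & fun e : vert Y * vert Y =>
    (enum_rank e.1 < enum_rank e.2)%N]| = #|{: edge}|.
  have inj : injective (fun e : vert Y * vert Y => (e.2, e.1)).
    by move=> [a b] [c d] [-> ->].
  rewrite card_sig -[RHS](fintype.card_image inj).
  apply: eq_card => -[u v]; apply/idP/mapP.
    rewrite !inE /= -leqNgt => /andP[le /existsP[f /= e]].
    exists (v, u) => //; rewrite mem_enum /in_mem /= /edge_pred /= ltn_neqAle le andbT.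
    apply/andP; split; last by apply/existsP; exists f; rewrite edge_of_sym.
    apply/eqP => /val_inj/enum_rank_inj uv.
    by move: (edge_of_neq pY e); rewrite uv eqxx.
  case=> -[v' u']; rewrite mem_enum /in_mem /= /edge_pred /= => /andP[h /existsP[f e]] [-> ->].
  rewrite /= -leqNgt ltnW //=.
  by apply/existsP; exists f; rewrite edge_of_sym.
have -> : #|[predI ordered_edges & fun e : vert Y * vert Y =>
    (enum_rank e.1 < enum_rank e.2)%N]| = #|{: edge}|.
  by rewrite card_sig; apply: eq_card => e; rewrite !inE andbC.
by rewrite mul2n addnn.
Qed.

Lemma card_corner_sum : #|{: corner}| = (\sum_(f : face Y) size (bnd f))%N.
Proof.
rewrite card_sig -sum1_card.
rewrite (eq_bigl (fun c : face Y * vert Y => c.2 \in bnd c.1)) //.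
rewrite -(pair_big_dep xpredT (fun (f : face Y) u => u \in bnd f) (fun _ _ => 1%N)) /=.
apply: eq_bigr => f _; rewrite sum1_card.
exact: card_uniqP (bnd_uniq pY f).
Qed.

Lemma card_flags_edges : (\sum_(f : face Y) \sum_(u | u \in bnd f) 2 = \sum_(e | ordered_edges e) 2)%N.
Proof.
transitivity (\sum_(f : face Y) \sum_(u | u \in bnd f) \sum_(v | edge_of f u v) 1)%N.
  apply: eq_bigr => f _; apply: eq_bigr => u uf; rewrite sum1_card.
  rewrite (eq_card (B := pred2 (next (bnd f) u) (prev (bnd f) u))).
    by rewrite card2 next_neq_prev ?(bnd_uniq pY) ?(bnd_size pY).
  by move=> v; rewrite !inE -[LHS]/(edge_of f u v) /edge_of uf.
transitivity (\sum_(e | ordered_edges e) \sum_(f | edge_of f e.1 e.2) 1)%N; last first.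
  by apply: eq_bigr => e /existsP[f ef]; rewrite sum1_card (edge_card pY ef).
rewrite [RHS](exchange_big_dep xpredT) //=; apply: eq_bigr => f _.
rewrite pair_big_dep /=; apply: eq_bigl => -[u v] /=.
apply/andP/andP => [[uf e]|[_ e]]; split=> //.
  by apply/existsP; exists f.
exact: edge_ofl e.
Qed.

(** Flags are counted in two ways: each corner has two edges of its face, each oriented edge lies in
    two faces, and each edge has two orientations. *)
Lemma card_corner : #|{: corner}| = (2 * #|{: edge}|)%N.
Proof.
have := card_flags_edges.
rewrite [X in _ = X -> _]sum_nat_const [#|_|]card_ordered_edges.
have -> : (\sum_(f : face Y) \sum_(u | u \in bnd f) 2 = \sum_(f : face Y) size (bnd f) * 2)%N.
  apply: eq_bigr => f _; rewrite sum_nat_const; congr (_ * _)%N.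
  exact: card_uniqP (bnd_uniq pY f).
rewrite -big_distrl /= -card_corner_sum.
by move/eqP; rewrite eqn_mul2r /= => /eqP.
Qed.

Definition corner_vec (a : face Y -> vert Y -> bool) : 'rV[K]_#|{: corner}| :=
  \row_i (a (val (enum_val i)).1 (val (enum_val i)).2)%:R.

Definition vec_corner (x : 'rV[K]_#|{: corner}|) f u : bool :=
  if insub (f, u) is Some c then x 0 (enum_rank (c : corner)) == 1 else false.

Lemma vec_cornerK x : corner_vec (vec_corner x) = x.
Proof.
apply/rowP => i; rewrite mxE /vec_corner -surjective_pairing valK enum_valK.
exact: F2_eq1.
Qed.

Lemma vec_cornerE x f u (uf : u \in bnd f) :
  (vec_corner x f u)%:R =
  x 0 (enum_rank (exist (fun c : face Y * vert Y => c.2 \in bnd c.1) (f, u) uf : corner)).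
Proof.
rewrite /vec_corner insubT /= F2_eq1; congr (x 0 (enum_rank _)).
Qed.

Lemma edge_faces f g u v : edge_of f u v -> edge_of g u v -> f != g ->
  forall h, edge_of h u v = (h == f) || (h == g).
Proof.
move=> ef eg fg h; have c2 := edge_card pY ef.
have sub : {subset pred2 f g <= [pred h | edge_of h u v]}.
  by move=> k; rewrite !inE => /orP[] /eqP ->.
have E : pred2 f g =i [pred h | edge_of h u v].
  by apply/subset_cardP; [rewrite c2 card2 fg|exact/fintype.subsetP].
by have := E h; rewrite !inE => ->.
Qed.

Lemma mulmx_coboundary1 a f g (e : edge) :
  edge_of f (val e).1 (val e).2 -> edge_of g (val e).1 (val e).2 -> f != g ->
  (corner_vec a *m coboundary1) 0 (enum_rank e) =
  ((a f (val e).1 (+) a f (val e).2) (+) (a g (val e).1 (+) a g (val e).2))%:R.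
Proof.
case: e => -[u v] euv /= ef eg fg.
pose F h w : K := (a h w)%:R * (edge_of h u v && ((w == u) || (w == v)))%:R.
rewrite mxE; transitivity (\sum_(c : corner) F (val c).1 (val c).2).
  by rewrite -[RHS]sum_enum_val; apply: eq_bigr => i _; rewrite !mxE /= !enum_rankK.
rewrite sum_corner /F (bigD1 f) // (bigD1 g) 1?eq_sym //=.
rewrite [X in _ + (_ + X)]big1 ?addr0; last first.
  move=> h /andP[hf hg]; apply: big1 => w _.
  by rewrite (edge_faces ef eg fg) (negPf hf) (negPf hg) mulr0.
have uv := edge_of_neq pY ef.
have A h : edge_of h u v -> \sum_(w | w \in bnd h)
    (a h w)%:R * (edge_of h u v && ((w == u) || (w == v)))%:R =
    (a h u)%:R + (a h v)%:R :> K.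
  move=> eh; rewrite (bigD1 u) ?(edge_ofl eh) //= (bigD1 v) /=; last first.
    by rewrite (edge_ofr eh) eq_sym.
  rewrite big1 ?addr0 ?eh ?eqxx ?orbT ?mulr1 //=.
  by move=> w /andP[/andP[_ /negPf ->] /negPf ->]; rewrite mulr0.
by rewrite !A // !F2_addb.
Qed.

Lemma other_face f u v : edge_of f u v -> exists2 g, g != f & edge_of g u v.
Proof.
move=> e; have := edge_card pY e.
rewrite (cardD1 f) inE e /= => -[] /eqP; rewrite eqn_leq => /andP[_] /card_gt0P.
by case=> g; rewrite !inE => /andP[gf eg]; exists g.
Qed.

Lemma canonical_edge f u v : edge_of f u v ->
  exists e : edge, val e = (u, v) \/ val e = (v, u).
Proof.
move=> ef; have uv := edge_of_neq pY ef.
have [lt|lt|/val_inj/enum_rank_inj h] := ltngtP (enum_rank u) (enum_rank v).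
- have h : edge_pred (u, v) by rewrite /edge_pred /= lt; apply/existsP; exists f.
  by exists (exist edge_pred _ h); left.
- have h : edge_pred (v, u).
    by rewrite /edge_pred /= lt; apply/existsP; exists f; rewrite edge_of_sym.
  by exists (exist edge_pred _ h); right.
- by rewrite h eqxx in uv.
Qed.

Lemma corner_cocycleP x : corner_cocycle (vec_corner x) <-> x *m coboundary1 = 0.
Proof.
split=> [ca|h].
  apply/rowP => j; rewrite -(enum_valK j) -[x]vec_cornerK [RHS]mxE.
  set e := enum_val j; have /andP[_ /existsP[f ef]] := valP e.
  have [g gf eg] := other_face ef.
  rewrite (mulmx_coboundary1 _ ef eg) 1?eq_sym //.
  by rewrite (ca f g _ _ ef eg) addbb.
move=> f g u v ef eg; have [->//|fg] := eqVneq f g.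
have [e he] := canonical_edge ef.
suff H u' v' : val e = (u', v') -> edge_of f u' v' -> edge_of g u' v' ->
    vec_corner x f u' (+) vec_corner x f v' = vec_corner x g u' (+) vec_corner x g v'.
  case: he => he; first exact: H.
  by rewrite addbC [RHS]addbC; apply: H => //; rewrite edge_of_sym.
move=> {}he ef' eg'; have := @mulmx_coboundary1 (vec_corner x) f g e.
rewrite he /= => /(_ ef' eg' fg); rewrite vec_cornerK h mxE.
by do 4 case: (vec_corner x _ _).
Qed.

Lemma corner_coboundaryP x :
  (exists s t, forall f u, u \in bnd f -> vec_corner x f u = s u (+) t f) <->
  (x <= coboundary0)%MS.
Proof.
split=> [[s [t st]]|/submxP[y hy]].
  apply/submxP; exists (\row_i match enum_val i with
     inl u => (s u)%:R | inr f => (t f)%:R end).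
  apply/rowP => j; rewrite -(enum_valK j) mulmx_coboundary0 !mxE !enum_rankK.
  case: (enum_val j) => -[f u] /= uf; rewrite -F2_addb -(st f u uf).
  by rewrite vec_cornerE.
exists (fun u => y 0 (enum_rank (inl u)) == 1),
  (fun f => y 0 (enum_rank (inr f)) == 1) => f u uf.
have := vec_cornerE x uf; rewrite [in X in _ = X -> _]hy mulmx_coboundary0 /=.
set A := y 0 _; set B := y 0 _; case: (vec_corner _ _ _).
  by case: (F2_case A) => ->; case: (F2_case B) => ->.
by case: (F2_case A) => ->; case: (F2_case B) => ->.
Qed.

Lemma face_cycle_const (T : eqType) u (t : face Y -> T) :
  (forall f g, adjacent_at u f g -> t f = t g) ->
  forall f g, u \in bnd f -> u \in bnd g -> t f = t g.
Proof.
move=> ht; have [c [_ cu cyc]] : exists c, face_cycle u c by case: pY.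
case: c cyc cu => [_ cu|h c cyc cu] f g; first by rewrite -cu.
suff A k : k \in h :: c -> t k = t h by rewrite -!cu => /A -> /A ->.
have {cu}: path (adjacent_at u) h c.
  by move: cyc => /=; rewrite rcons_path => /andP[].
rewrite inE => + /predU1P[->//|].
elim: c h {cyc} => // x c IH h /= /andP[/ht -> pc].
by rewrite inE => /predU1P[->//|]; exact: IH.
Qed.

(** The top cohomology mod 2 has dimension 1. A dependency between the edge equations takes equal
    values on consecutive edges of a face, so it is constant on each face, then on all faces around
    a vertex by the face-cycle, and everywhere by connectedness. *)
Lemma rank_coboundary1 : (\rank coboundary1).+1 = #|{: edge}|.
Proof.
rewrite -mxrank_tr; apply: rank_const_kernel.
  have [f [u uf]] : exists f u, u \in bnd f.
    case: q0 => [u|f]; first by have [f ?] := vert_face pY u; exists f, u.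
    by have [u ?] := face_vert pY f; exists f, u.
  have [e _] := canonical_edge (edge_of_next uf).
  by apply/card_gt0P; exists e.
move=> x.
have E (c : corner) : (x *m coboundary1^T) 0 (enum_rank c) =
    \sum_e x 0 (enum_rank e) * (constraint c e)%:R.
  rewrite mxE -[RHS]sum_enum_val; apply: eq_bigr => i _.
  by rewrite !mxE enum_rankK enum_valK.
have val_e (e e' : edge) u v : val e = (u, v) \/ val e = (v, u) ->
    val e' = (u, v) \/ val e' = (v, u) -> e = e'.
  have lt (e1 : edge) : (enum_rank (val e1).1 < enum_rank (val e1).2)%N.
    by have /andP[] := valP e1.
  by move=> [] h [] h'; apply/val_inj; rewrite h h' //; have := lt e;
    have := lt e'; rewrite h h' /= => h1 h2; have := ltn_trans h1 h2; rewrite ltnn.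
(* A corner occurs in the equations of just two edges, its neighbours along the face; in
   characteristic 2 a vanishing sum means equal values. *)
have E2 f u (uf : u \in bnd f) (e1 e2 : edge) :
    val e1 = (u, next (bnd f) u) \/ val e1 = (next (bnd f) u, u) ->
    val e2 = (u, prev (bnd f) u) \/ val e2 = (prev (bnd f) u, u) ->
    (x *m coboundary1^T) 0 (enum_rank (exist (fun c : face Y * vert Y => c.2 \in bnd c.1) (f, u) uf : corner)) =
    x 0 (enum_rank e1) + x 0 (enum_rank e2).
  move=> h1 h2; rewrite E.
  have np := next_neq_prev (bnd_uniq pY f) uf (bnd_size pY f).
  have nn := edge_of_neq pY (edge_of_next uf).
  have pp := edge_of_neq pY (edge_of_prev uf).
  have e12 : e2 != e1.
    apply/eqP => h; move: h1 h2; rewrite h => -[] -> [] [] // => h1.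
    - by rewrite h1 eqxx in np.
    - by move=> h2; rewrite h2 eqxx in nn.
    - by move=> h2; rewrite h1 eqxx in nn.
    - by rewrite h1 eqxx in np.
  have C e v : edge_of f u v -> val e = (u, v) \/ val e = (v, u) ->
      constraint (exist (fun c : face Y * vert Y => c.2 \in bnd c.1) (f, u) uf : corner) e.
    by move=> ef [] he; rewrite /constraint he /= ?[edge_of f v u](edge_of_sym pY) ef eqxx ?orbT.
  rewrite (bigD1 e1) //= (bigD1 e2) //= (C _ _ (edge_of_next uf) h1).
  rewrite (C _ _ (edge_of_prev uf) h2) !mulr1 big1 ?addr0 //.
  move=> e /andP[ne1 ne2]; rewrite (_ : constraint _ _ = false) ?mulr0 //.
  apply/negP => /andP[/= ef /= he].
  have [v [he' efv]] : exists v, (val e = (u, v) \/ val e = (v, u)) /\ edge_of f u v.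
    case/orP: he => /eqP he; [exists (val e).2|exists (val e).1]; split.
    - by left; rewrite he -surjective_pairing.
    - by rewrite he.
    - by right; rewrite he -surjective_pairing.
    - by rewrite (edge_of_sym pY) he.
  case/andP: efv => _ /orP[] /eqP hv.
    by case/negP: ne1; apply/eqP; apply: (val_e _ _ u v) => //; rewrite hv.
  by case/negP: ne2; apply/eqP; apply: (val_e _ _ u v) => //; rewrite hv.
split=> [h|[k hx]]; last first.
  apply/rowP => j; rewrite [RHS]mxE -(enum_valK j); case: (enum_val j) => -[f u] uf.
  have [e1 h1] := canonical_edge (edge_of_next uf).
  have [e2 h2] := canonical_edge (edge_of_prev uf).
  etransitivity; first exact: (E2 f u uf e1 e2).
  by rewrite hx !mxE mulr1 F2_addxx.
have eq_at f u e1 e2 (uf : u \in bnd f) :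
    val e1 = (u, next (bnd f) u) \/ val e1 = (next (bnd f) u, u) ->
    val e2 = (u, prev (bnd f) u) \/ val e2 = (prev (bnd f) u, u) ->
    x 0 (enum_rank e1) = x 0 (enum_rank e2).
  by move=> h1 h2; apply: F2_sum_eq0; rewrite -(E2 f u uf) // h mxE.
pose val_uv u v : K := if [pick e : edge | (val e == (u, v)) || (val e == (v, u))]
  is Some e then x 0 (enum_rank e) else 0.
have valE u v e : val e = (u, v) \/ val e = (v, u) ->
    val_uv u v = x 0 (enum_rank e).
  move=> he; rewrite /val_uv; case: pickP => [e' he'|/(_ e)].
    congr (x 0 (enum_rank _)); apply: (val_e _ _ u v) => //.
    by case/orP: he' => /eqP; [left|right].
  by case: he => ->; rewrite eqxx ?orbT.
have val_sym u v : val_uv u v = val_uv v u.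
  by rewrite /val_uv; under eq_pick do rewrite orbC.
have val_np f u : u \in bnd f ->
    val_uv u (next (bnd f) u) = val_uv u (prev (bnd f) u).
  move=> uf; have [e1 h1] := canonical_edge (edge_of_next uf).
  have [e2 h2] := canonical_edge (edge_of_prev uf).
  by rewrite (valE _ _ _ h1) (valE _ _ _ h2); exact: eq_at h1 h2.
have val_face f u w : u \in bnd f -> w \in bnd f ->
    val_uv u (next (bnd f) u) = val_uv w (next (bnd f) w).
  move=> uf wf; rewrite -[w](nth_index u wf) -[u in LHS](nth_index u uf).
  have : (index w (bnd f) < size (bnd f))%N by rewrite index_mem.
  have : (index u (bnd f) < size (bnd f))%N by rewrite index_mem.
  suff H i : (i < size (bnd f))%N -> val_uv (nth u (bnd f) i) (next (bnd f) (nth u (bnd f) i)) =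
      val_uv (nth u (bnd f) 0) (next (bnd f) (nth u (bnd f) 0)) by move=> /H -> /H ->.
  elim: i => // i IH si; rewrite -IH; last exact: ltnW.
  have hn : nth u (bnd f) i.+1 = next (bnd f) (nth u (bnd f) i).
    by rewrite next_nth_mod ?(bnd_uniq pY) ?(ltnW si) // modn_small.
  rewrite hn val_np ?prev_next ?(bnd_uniq pY) //.
  by rewrite mem_next mem_nth // ltnW.
have [t ht] : exists t : face Y -> K, forall f u v, edge_of f u v -> val_uv u v = t f.
  have [w0 _] : exists w0 : vert Y, True.
    by case: q0 => [u|f]; [exists u|have [u _] := face_vert pY f; exists u].
  exists (fun f => let w := head w0 (bnd f) in val_uv w (next (bnd f) w)) => f u v e.
  have hw : head w0 (bnd f) \in bnd f.
    by have := bnd_size pY f; case: (bnd f) => //= y s _; rewrite mem_head.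
  rewrite /= -(val_face f u _ (edge_ofl e) hw).
  by case/andP: e => uf /orP[] /eqP -> //; rewrite val_np.
have t_vert u f g : u \in bnd f -> u \in bnd g -> t f = t g.
  apply: face_cycle_const => {}f {}g /andP[_ /existsP[w /andP[e1 e2]]].
  by rewrite -(ht _ _ _ e1) (ht _ _ _ e2).
have [tv htv] : exists tv : vert Y -> K, forall f u, u \in bnd f -> tv u = t f.
  exists (fun u => if [pick f | u \in bnd f] is Some f then t f else 0) => f u uf.
  by case: pickP => [g ug|/(_ f)]; [exact: t_vert uf|rewrite uf].
pose S p := match p with inl u => tv u | inr f => t f end.
have Sc p : S p = S q0.
  apply/eqP; have := cY (S := fun p => S p == S q0).
  by move=> /(_ _ p q0); rewrite eqxx; apply => f u uf; rewrite /= (htv _ _ uf).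
exists (S q0); apply/rowP => j; rewrite !mxE mulr1.
have /andP[_ /existsP[f ef]] := valP (enum_val j).
rewrite -(Sc (inr f)) /= -(ht _ _ _ ef) (valE _ _ (enum_val j)) ?enum_valK //.
by left; case: (val _).
Qed.

Lemma coboundary01 : coboundary0 *m coboundary1 = 0.
Proof.
apply/row_matrixP => i; rewrite row_mul row0.
apply/corner_cocycleP.
have /corner_coboundaryP[s [t st]] := row_sub i coboundary0.
move=> f g u v ef eg.
rewrite !st ?(edge_ofl ef) ?(edge_ofl eg) ?(edge_ofr ef) ?(edge_ofr eg) //.
by case: (s u); case: (s v); case: (t f); case: (t g).
Qed.

Lemma betti_numbers :
  (\rank (kermx coboundary1) + #|{: vert Y + face Y}| =
   \rank coboundary0 + #|{: edge}| + 2)%N.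
Proof.
rewrite mxrank_ker.
have := rank_coboundary0; have := rank_coboundary1; have := card_corner.
move: (\rank coboundary0) (\rank coboundary1) => r0 r1.
move: #|{: corner}| #|{: edge}| #|{: vert Y + face Y}| => c e p; lia.
Qed.

End Betti.

(** * Invariance of the first Betti number *)

Section EulerInvariance.
Variables (R : realType) (Y Z : cellmap).
Hypotheses (pY : polyhedral_map Y) (pZ : polyhedral_map Z).
Local Notation XY := (set_type (realization R Y)).
Local Notation XZ := (set_type (realization R Z)).
Variables (h : XY -> XZ) (k : XZ -> XY).
Hypotheses (ch : continuous h) (ck : continuous k).
Hypotheses (hk : cancel h k).
Variables (p0 : vert Y + face Y) (q0 : vert Z + face Z).

Lemma vec_cornerD (W : cellmap) (x y : 'rV['F_2]_#|{: corner W}|) f u :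
  vec_corner (x + y) f u = vec_corner x f u (+) vec_corner y f u.
Proof.
rewrite /vec_corner; case: insubP => [c _ _|//]; rewrite mxE.
by case: (F2_case (x 0 (enum_rank c))) => ->;
  case: (F2_case (y 0 (enum_rank c))) => ->.
Qed.

Lemma vec_corner_corner_vec (W : cellmap) (a : face W -> vert W -> bool) f u :
  u \in bnd f -> vec_corner (corner_vec a) f u = a f u.
Proof.
move=> uf; rewrite /vec_corner insubT mxE enum_rankK /=.
by case: (a f u).
Qed.

Local Notation coh x y := (cohomologous h p0 q0 (vec_corner x) (vec_corner y)).

Lemma cohomologous_mul r (A : 'M['F_2]_(r, #|{: corner Y}|))
    (B : 'M_(r, #|{: corner Z}|)) (x : 'rV_r) :
  (forall i, coh (row i A) (row i B)) -> coh (x *m A) (x *m B).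
Proof.
move=> hAB; rewrite !mulmx_sum_row.
have ext (W : cellmap) (v w : 'rV['F_2]_#|{: corner W}|) : vec_corner (v + w) =
    (fun f u => vec_corner v f u (+) vec_corner w f u).
  by apply/funext => f; apply/funext => u; exact: vec_cornerD.
have z (W : cellmap) : vec_corner (0 : 'rV['F_2]_#|{: corner W}|) = fun _ _ => false.
  apply/funext => f; apply/funext => u; rewrite /vec_corner.
  by case: insubP => // c _ _; rewrite mxE.
have big := @big_ind2 'rV['F_2]_#|{: corner Y}| 'rV['F_2]_#|{: corner Z}| (fun v w => coh v w) 0 +%R 0 +%R.
apply: big.
- by rewrite !z; exact: cohomologous0.
- by move=> v w v' w' H H'; rewrite !ext; exact: cohomologousD.
- move=> i _; case: (F2_case (x 0 i)) => ->; last by rewrite !scale1r.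
  by rewrite !scale0r !z; exact: cohomologous0.
Qed.

(** A complement [W] of the coboundaries represents the first cohomology of [Y]. Cohomologous
    cocycles chosen for a basis of [W] stay independent modulo coboundaries of [Z], by
    [cohomologous_inj]. Equality follows later by exchanging the two maps. *)
Lemma betti_le : (\rank (kermx (@coboundary1 Y)) + \rank (@coboundary0 Z) <=
   \rank (kermx (@coboundary1 Z)) + \rank (@coboundary0 Y))%N.
Proof.
set W := (kermx (@coboundary1 Y) :\: @coboundary0 Y)%MS.
have sub0 : (@coboundary0 Y <= kermx (@coboundary1 Y))%MS.
  exact/sub_kermxP/coboundary01.
have subZ : (@coboundary0 Z <= kermx (@coboundary1 Z))%MS.
  exact/sub_kermxP/coboundary01.
have rW : (\rank W + \rank (@coboundary0 Y) = \rank (kermx (@coboundary1 Y)))%N.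
  by rewrite -(mxrank_cap_compl (kermx _) (@coboundary0 Y)) addnC (capmx_idPr sub0).
pose A := row_base W.
have Arow i : corner_cocycle (vec_corner (row i A)).
  apply/(corner_cocycleP pY)/sub_kermxP.
  by rewrite (submx_trans (row_sub _ _)) // eq_row_base diffmxSl.
have [b hb] : {b : 'I_(\rank W) -> face Z -> vert Z -> bool & forall i,
    corner_cocycle (b i) /\ cohomologous h p0 q0 (vec_corner (row i A)) (b i)}.
  apply: (@boolp.choice _ _ (fun i b => corner_cocycle b /\
     cohomologous h p0 q0 (vec_corner (row i A)) b)) => i.
  by have [b cb Hb] := cohomologous_ex pY pZ ch ck hk p0 q0 (Arow i); exists b.
pose D := \matrix_i corner_vec (b i).
have AD i : coh (row i A) (row i D).
  rewrite rowK; apply: eq_cohomologous (proj2 (hb i)) => f u uf.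
  by rewrite vec_corner_corner_vec.
have Dker : (D <= kermx (@coboundary1 Z))%MS.
  apply/row_subP => i; apply/sub_kermxP/(corner_cocycleP pZ) => f g u v ef eg.
  rewrite rowK !vec_corner_corner_vec ?(edge_ofl ef) ?(edge_ofl eg) ?(edge_ofr ef)
    ?(edge_ofr eg) //.
  exact: (proj1 (hb i)).
have inj (x : 'rV_(\rank W)) : (x *m D <= @coboundary0 Z)%MS -> x = 0.
  move=> /corner_coboundaryP H.
  have xA : (x *m A <= kermx (@coboundary1 Y))%MS.
    by rewrite (submx_trans (submxMl _ _)) // eq_row_base diffmxSl.
  have /corner_coboundaryP : exists s t, forall f u, u \in bnd f ->
      vec_corner (x *m A) f u = s u (+) t f.
    apply: (cohomologous_inj pY pZ ch _ (cohomologous_mul x AD) H).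
    exact/(corner_cocycleP pY)/sub_kermxP.
  move=> xA0; have : (x *m A <= W :&: @coboundary0 Y)%MS.
    by rewrite sub_capmx xA0 andbT -(eq_row_base W) submxMl.
  rewrite capmx_diff submx0 mulmx_free_eq0 ?row_base_free //.
  by move/eqP.
have freeD : row_free D.
  rewrite -kermx_eq0; apply/rowV0P => x /sub_kermxP xD; apply: inj.
  by rewrite xD sub0mx.
have capD : (D :&: @coboundary0 Z = 0)%MS.
  apply/eqP/rowV0P => y; rewrite sub_capmx => /andP[/submxP[x ->]].
  by move/inj => ->; rewrite mul0mx.
have : (\rank (D + @coboundary0 Z)%MS <= \rank (kermx (@coboundary1 Z)))%N.
  by apply: mxrankS; rewrite addsmx_sub Dker subZ.
rewrite mxrank_disjoint_sum // -rW.
by move: freeD; rewrite /row_free => /eqP ->; lia.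
Qed.

End EulerInvariance.

(* [#vertices - #edges + #faces = 2 - dim H^1(-; F_2)]. *)
Theorem euler_invariance (R : realType) (Y Z : cellmap) :
  polyhedral_map Y -> polyhedral_map Z ->
  incidence_connected Y -> vert Y + face Y -> vert Z + face Z ->
  homeomorphic (set_type (realization R Y)) (set_type (realization R Z)) ->
  incidence_connected Z /\
  (#|{: vert Y + face Y}| + #|{: edge Z}| = #|{: vert Z + face Z}| + #|{: edge Y}|)%N.
Proof.
move=> pY pZ cY p0 q0 [h [k [ch ck hk kh]]].
have cZ := incidence_connected_transfer pZ ch kh q0 p0 cY.
split=> //.
have := betti_le pY pZ ch ck hk p0 q0; have := betti_le pZ pY ck ch kh q0 p0.
have := betti_numbers pY cY p0; have := betti_numbers pZ cZ q0.
move: (\rank (kermx (@coboundary1 Y))) (\rank (kermx (@coboundary1 Z))) => k1 k2.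
move: (\rank (@coboundary0 Y)) (\rank (@coboundary0 Z)) => r1 r2.
move: #|{: edge Y}| #|{: edge Z}| #|{: vert Y + face Y}| #|{: vert Z + face Z}|.
by move=> a b c d; lia.
Qed.

(** * Convex polytopes and their antipodal quotients *)

Section Homeo.

Lemma compact_bijection_homeomorphic (S T : topologicalType) (G : S -> T) :
  continuous G -> compact [set: S] -> hausdorff_space T -> injective G ->
  (forall y, exists x, G x = y) -> homeomorphic T S.
Proof.
move=> cG cS hT inj surj.
have [k hk] : {k : T -> S & forall y, G (k y) = y}.
  exact: (@boolp.choice _ _ (fun y x => G x = y)).
have kG x : k (G x) = x by apply: inj; rewrite hk.
exists k, G; split=> //; apply/continuous_closedP => A cA.
have -> : k @^-1` A = G @` A.
  apply/seteqP; split=> [y Aky|_ [x Ax <-]]; first by exists (k y).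
  by rewrite /= kG.
apply: compact_closed => //; apply: continuous_compact.
  exact: continuous_subspaceT.
exact: subclosed_compact cA cS _.
Qed.

Variables (R : realType) (n : nat) (A : set 'rV[R]_n).

Lemma set_type_hausdorff : hausdorff_space (set_type A).
Proof.
move=> x y clxy; apply/val_inj; apply/eqP; apply: contraT => xy.
have e0 : 0 < `|val x - val y| / 2 by rewrite divr_gt0 // normr_gt0 subr_eq0.
have [||z [/= h1 h2]] := clxy [set z | `|val x - val z| < `|val x - val y| / 2]
    [set z | `|val y - val z| < `|val x - val y| / 2].
- by apply/nbhs_set_typeP; exists (`|val x - val y| / 2).
- by apply/nbhs_set_typeP; exists (`|val x - val y| / 2).
have : `|val x - val y| < `|val x - val y|; last by rewrite ltxx.
rewrite -{1}(subrKA (val z)); apply: le_lt_trans (ler_normD _ _) _.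
by rewrite [`|val z - _|]distrC; lra.
Qed.

Lemma set_type_compact : compact A -> compact [set: set_type A].
Proof.
move=> cA F PF _.
pose G := [set U : set 'rV[R]_n | F (val @^-1` U)].
have PG : ProperFilter G.
  split; first by rewrite /G /= preimage_set0; exact: filter_not_empty.
  split; first by rewrite /G /= preimage_setT; exact: filterT.
    by move=> U V FU FV; rewrite /G /= preimage_setI; exact: filterI.
  by move=> U V UV; apply: filterS => x /=; exact: UV.
have GA : G A by apply: (@filterS _ F _ setT) => [x _|]; [exact: set_type_in|exact: filterT].
have [p [Ap clp]] := cA G PG GA.
exists (in_set_type Ap); split=> // U V FU /nbhs_set_typeP[e e0 he].
have [||q [[y Uy <-] py]] := clp (val @` U) (ball p e).
- by apply: (@filterS _ F _ U) => // x Ux /=; exists x.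
- exact: nbhsx_ballx.
by exists y; split=> //; apply: he; move: py; rewrite -ball_normE.
Qed.

End Homeo.

Section Polytope.
Local Open Scope quotient_scope.
Variables (R : realType) (Y : cellmap).
Hypothesis pY : polyhedral_map Y.
Local Notation P := (vert Y + face Y)%type.
Local Notation N := #|{: vert Y + face Y}|.
Variables (pos : P -> 'rV[R]_3) (sg : face Y -> vert Y -> bool).

(** Each cell of the quotient has two antipodal lifts. The face [f] is lifted so that its apex takes
    the positive sign, and [sg f u] tells which lift of [u] belongs to this copy of [f]. *)
Definition lift_pt (f : face Y) (p : P) : 'rV[R]_3 :=
  if p is inl u then (-1) ^+ sg f u *: pos p else pos p.

Definition lift_mx (f : face Y) : 'M[R]_(N, 3) :=
  \matrix_i lift_pt f (enum_val i).

Variable C : face Y * vert Y * vert Y -> 'M[R]_(3, N).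

Definition trit (t : face Y * vert Y * vert Y) := tri t.1.1 t.1.2 t.2.
Definition edget (t : face Y * vert Y * vert Y) := edge_of t.1.1 t.1.2 t.2.
Definition height t (x : 'rV[R]_3) : R := \sum_i (x *m C t) 0 i.

(** [C t] expresses a vector in the basis formed by the three lifted corners of [t], and [height t]
    is the linear form equal to 1 on their plane. Thus [hD] is strict convexity together with its
    antipodal image, and [hS] says that the lifts of two faces along a common edge agree up to one
    sign. *)
Hypothesis hA : forall t, edget t -> C t *m lift_mx t.1.1 = 1%:M.
Hypothesis hB : forall t p, edget t -> p \in trit t ->
  lift_pt t.1.1 p *m C t = corner_pt R p.
Hypothesis hC : forall t x p, edget t -> p \notin trit t ->
  coord (x *m C t) p = 0.
Hypothesis hD : forall t q, edget t -> q \notin trit t ->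
  `|height t (pos q)| < 1.
Hypothesis hS : forall f g u v, edge_of f u v -> edge_of g u v ->
  sg f u (+) sg f v = sg g u (+) sg g v.

Lemma coordZ a (x : 'rV[R]_N) p : coord (a *: x) p = a * coord x p.
Proof. by rewrite /coord mxE. Qed.

Lemma sum_coord (x : 'rV[R]_N) : \sum_i x 0 i = \sum_p coord x p.
Proof.
rewrite (reindex_onto (@enum_rank P) enum_val) => [|i _]; last exact: enum_valK.
by apply: eq_bigl => p; rewrite enum_rankK eqxx.
Qed.

Lemma lift_mxE f (w : 'rV[R]_N) :
  w *m lift_mx f = \sum_p coord w p *: lift_pt f p.
Proof.
rewrite mulmx_sum_row.
rewrite (reindex_onto (@enum_rank P) enum_val) => [|i _]; last exact: enum_valK.
rewrite (eq_bigl xpredT) => [|p]; last by rewrite enum_rankK eqxx.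
by apply: eq_bigr => p _; rewrite rowK enum_rankK.
Qed.

Lemma lift_pm f g p : exists b : bool, lift_pt f p = (-1) ^+ b *: lift_pt g p.
Proof.
case: p => [u|h] /=; last by exists false; rewrite expr0 scale1r.
exists (sg f u (+) sg g u); rewrite scalerA signr_addb -mulrA -signr_addb addbb.
by rewrite expr0 mulr1.
Qed.

Lemma heightZ t a x : height t (a *: x) = a * height t x.
Proof.
by rewrite /height -scalemxAl mulr_sumr; apply: eq_bigr => i _; rewrite mxE.
Qed.

Lemma heightD t x y : height t (x + y) = height t x + height t y.
Proof.
by rewrite /height mulmxDl -big_split; apply: eq_bigr => i _; rewrite mxE.
Qed.

Lemma height_sum t f (w : 'rV[R]_N) :
  height t (w *m lift_mx f) = \sum_p coord w p * height t (lift_pt f p).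
Proof.
rewrite lift_mxE (big_morph (height t) (heightD t) (id1 := 0)); last first.
  by rewrite -(scale0r 0) heightZ mul0r.
by apply: eq_bigr => p _; rewrite heightZ.
Qed.

Lemma height_lift t p : edget t -> p \in trit t -> height t (lift_pt t.1.1 p) = 1.
Proof.
move=> et pt; rewrite /height hB // sum_coord (bigD1 p) //= coord_corner eqxx.
by rewrite big1 ?addr0 // => q /negPf qp; rewrite coord_corner qp.
Qed.

Lemma norm_height_lift t f p :
  `|height t (lift_pt f p)| = `|height t (pos p)|.
Proof.
case: p => // u; rewrite /= heightZ normrM normrX normrN1.
by rewrite expr1n mul1r.
Qed.

Lemma norm_height_le1 t f p : edget t -> `|height t (lift_pt f p)| <= 1.
Proof.
move=> et; have [pt|pt] := boolP (p \in trit t).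
  have [b ->] := lift_pm f t.1.1 p.
  by rewrite heightZ height_lift // mulr1 normrX normrN1 expr1n.
by rewrite norm_height_lift ltW // hD.
Qed.

(** Coordinates of one common sign: the union of the cone over the triangle and its antipode, a form
    that needs no choice of lift. *)
Definition cone t (x : 'rV[R]_3) :=
  forall p q, 0 <= coord (x *m C t) p * coord (x *m C t) q.

Lemma coneN t x : cone t x -> cone t (- x).
Proof.
have E p : coord (- x *m C t) p = - coord (x *m C t) p.
  by rewrite mulNmx /coord mxE.
by move=> h p q; rewrite !E mulrNN; exact: h.
Qed.

Lemma cone_sign t x : cone t x ->
  (forall p, 0 <= coord (x *m C t) p) \/ (forall p, coord (x *m C t) p <= 0).
Proof.
move=> h; have [[p hp]|H] := pselect (exists p, coord (x *m C t) p < 0).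
  by right => q; have := h p q; rewrite nmulr_rge0.
by left => p; rewrite leNgt; apply/negP => hp; apply: H; exists p.
Qed.

Lemma cone_norm_height t x : cone t x ->
  `|height t x| = \sum_p `|coord (x *m C t) p|.
Proof.
rewrite /height sum_coord => /cone_sign[h|h].
  rewrite ger0_norm ?sumr_ge0 //.
  by apply: eq_bigr => p _; rewrite ger0_norm.
rewrite ler0_norm ?sumr_le0 // -sumrN.
by apply: eq_bigr => p _; rewrite ler0_norm.
Qed.

Lemma cone_expand t (x : 'rV[R]_3) : edget t -> x = (x *m C t) *m lift_mx t.1.1.
Proof. by move=> et; rewrite -mulmxA hA // mulmx1. Qed.

(** All lifted corners have height at most 1 in absolute value, so expanding [x] in the corners of
    [t'] bounds its height over any other triangle. On its own cone the height is the gauge of the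
    polytope. *)
Lemma cone_height_le t t' x : edget t -> edget t' -> cone t' x ->
  `|height t x| <= `|height t' x|.
Proof.
move=> et et' cx; rewrite (cone_norm_height cx) [in leLHS](cone_expand x et').
rewrite height_sum; apply: le_trans (ler_norm_sum _ _ _) _.
apply: ler_sum => p _; rewrite normrM ler_piMr //; exact: norm_height_le1.
Qed.

Lemma cone_height_neq0 t x : edget t -> cone t x -> x != 0 -> height t x != 0.
Proof.
move=> et cx; apply: contraNneq => h0.
have := cone_norm_height cx; rewrite h0 normr0 => /esym/eqP.
rewrite psumr_eq0 // => /allP h; rewrite (cone_expand x et) lift_mxE big1 //.
move=> p _; have := h p (mem_index_enum p); rewrite normr_eq0 => /eqP ->.
by rewrite scale0r.
Qed.

(** A nonzero coordinate at a corner outside [t] would make the comparison of heights strict, by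
    strict convexity, although both heights equal the gauge of [x]. *)
Lemma cone_supp t t' x p : edget t -> edget t' -> cone t x -> cone t' x ->
  coord (x *m C t') p != 0 -> p \in trit t.
Proof.
move=> et et' cx cx' wp; apply: contraT => pt.
have lt : `|height t x| < `|height t' x|.
  rewrite (cone_norm_height cx') [in ltLHS](cone_expand x et').
  rewrite height_sum; apply: le_lt_trans (ler_norm_sum _ _ _) _.
  rewrite (bigD1 p) //= [ltRHS](bigD1 p) //=; apply: ltr_leD.
    rewrite normrM gtr_pMr ?normr_gt0 // norm_height_lift; exact: hD.
  apply: ler_sum => q _; rewrite normrM ler_piMr //; exact: norm_height_le1.
by have := cone_height_le et' et cx; rewrite leNgt lt.
Qed.

Lemma cone_norm_coord t t' x p : edget t -> edget t' -> cone t x -> cone t' x ->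
  `|coord (x *m C t) p| = `|coord (x *m C t') p|.
Proof.
move=> et et' cx cx'.
have [s hs] : {s : P -> bool & forall q,
    lift_pt t'.1.1 q = (-1) ^+ s q *: lift_pt t.1.1 q}.
  apply: (@boolp.choice _ _ (fun q b =>
    lift_pt t'.1.1 q = (-1) ^+ (nat_of_bool b) *: lift_pt t.1.1 q)) => q.
  exact: lift_pm.
have E : x *m C t = \sum_q coord (x *m C t') q *: (lift_pt t'.1.1 q *m C t).
  rewrite [in LHS](cone_expand x et') lift_mxE mulmx_suml.
  by apply: eq_bigr => q _; rewrite -scalemxAl.
have -> : coord (x *m C t) p =
    \sum_q coord (x *m C t') q * coord (lift_pt t'.1.1 q *m C t) p.
  by rewrite [in LHS]E [LHS]summxE; apply: eq_bigr => q _; exact: coordZ.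
have X q : coord (x *m C t') q * coord (lift_pt t'.1.1 q *m C t) p =
    coord (x *m C t') q * ((-1) ^+ (s q) * (p == q)%:R).
  have [->|h] := eqVneq (coord (x *m C t') q) 0; first by rewrite !mul0r.
  by rewrite hs -scalemxAl coordZ hB ?coord_corner //; exact: (cone_supp et et').
rewrite (bigD1 p) //= big1 ?addr0 => [|q qp]; last first.
  by rewrite X eq_sym (negPf qp) !mulr0.
by rewrite X eqxx mulr1 normrM normrX normrN1 expr1n mulr1.
Qed.

(** Radial projection to the boundary of the polytope, read in barycentric coordinates. Division by
    the signed height identifies [x] with its antipode. *)
Definition proj_cone t (x : 'rV[R]_3) : 'rV[R]_N := (height t x)^-1 *: (x *m C t).

Lemma proj_coneE t x p : cone t x ->
  coord (proj_cone t x) p = `|coord (x *m C t) p| / `|height t x|.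
Proof.
move=> cx; rewrite coordZ mulrC; case: (cone_sign cx) => h.
  rewrite (ger0_norm (h p)) ger0_norm // /height sum_coord; exact: sumr_ge0.
rewrite (ler0_norm (h p)) ler0_norm ?invrN ?mulrNN //.
rewrite /height sum_coord; exact: sumr_le0.
Qed.

Lemma proj_cone_eq t t' x : edget t -> edget t' -> cone t x -> cone t' x ->
  proj_cone t x = proj_cone t' x.
Proof.
move=> et et' cx cx'; apply/rowP => i; rewrite -(enum_valK i).
apply: etrans (proj_coneE _ cx) (etrans _ (esym (proj_coneE _ cx'))).
rewrite (cone_norm_coord _ et et') //; congr (_ / _).
by apply/eqP; rewrite eq_le !cone_height_le.
Qed.

Lemma proj_cone_simplex t x : edget t -> cone t x -> x != 0 ->
  simplex (trit t) (proj_cone t x).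
Proof.
move=> et cx x0; have h0 := cone_height_neq0 et cx x0; split.
- move=> i; rewrite -(enum_valK i) [leRHS](proj_coneE (enum_val i) cx).
  by rewrite divr_ge0.
- rewrite /proj_cone (eq_bigr (fun i => (height t x)^-1 * (x *m C t) 0 i)).
    by rewrite -mulr_sumr -/(height t x) mulVf.
  by move=> i _; rewrite mxE.
- move=> p; apply: contraR => pt; rewrite coordZ hC //.
  by rewrite mulr0.
Qed.

(** Opposite a vertex the neighbouring triangle lies in the same face; opposite the apex it lies in
    the other face of the edge, whose chosen lift may be the antipodal one, whence the sign [b]. *)
Lemma neighbour t p : edget t -> p \in trit t ->
  exists t' (b : bool), [/\ edget t', p \notin trit t' &
    forall q, q \in trit t -> q != p -> q \in trit t' /\
      lift_pt t'.1.1 q = (-1) ^+ b *: lift_pt t.1.1 q].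
Proof.
case: t => [[f u] v]; rewrite /edget /trit /= => e.
have uv := edge_of_neq pY e.
have side x y : edge_of f x y -> exists z, edge_of f y z /\ x \notin [:: y; z].
  move=> exy; have yf := edge_ofr exy; have xy := edge_of_neq pY exy.
  have np := next_neq_prev (bnd_uniq pY f) yf (bnd_size pY f).
  move: exy; rewrite (edge_of_sym pY) => /andP[_ /orP[] /eqP xE].
    by exists (prev (bnd f) y); rewrite edge_of_prev // !inE (negPf xy) xE.
  by exists (next (bnd f) y); rewrite edge_of_next // !inE (negPf xy) xE eq_sym.
rewrite !inE => /or3P[] /eqP ->.
- have [z [ez xz]] := side u v e.
  exists (f, v, z), false; split=> //=.
  move=> q; rewrite !inE => /or3P[] /eqP -> //; rewrite ?eqxx ?orbT //= => _.
    by rewrite expr0 scale1r.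
  by rewrite expr0 scale1r.
- have [z [ez xz]] := side v u (edge_of_symW pY e).
  exists (f, u, z), false; split=> //=.
  move=> q; rewrite !inE => /or3P[] /eqP -> //; rewrite ?eqxx ?orbT //= => _.
    by rewrite expr0 scale1r.
  by rewrite expr0 scale1r.
- have [g gf eg] := other_face pY e.
  exists (g, u, v), (sg f u (+) sg g u); split=> //=.
    by rewrite !inE /= eq_sym; apply/eqP => -[fg]; rewrite fg eqxx in gf.
  have K w : sg g w = sg f u (+) sg g u (+) sg f w ->
      lift_pt g (inl w) = (-1) ^+ (sg f u (+) sg g u) *: lift_pt f (inl w).
    by move=> h; rewrite /= h scalerA signr_addb.
  move=> q; rewrite !inE => /or3P[] /eqP -> //; rewrite ?eqxx ?orbT // => _.
    by split=> //; apply: K; case: (sg f u); case: (sg g u).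
  split=> //; apply: K; have := hS e eg.
  by case: (sg f u); case: (sg g u); case: (sg f v); case: (sg g v).
Qed.

(* [x] lies in the cone of the triangle maximizing [|height t x|]: if a
   coordinate of [x] were negative, moving across the opposite edge would
   increase the height. *)
Lemma cone_cover x : (exists t, edget t) -> exists2 t, edget t & cone t x.
Proof.
move=> [t0 et0].
pose m := [arg max_(t > t0 | edget t) `|height t x|]%O.
have [et hm] : edget m /\ forall t, edget t -> `|height t x| <= `|height m x|.
  by rewrite /m; case: arg_maxP.
exists m => //.
suff main y : 0 <= height m y ->
    (forall t, edget t -> `|height t y| <= height m y) -> cone m y.
  have [h0|h0] := leP 0 (height m x).
    by apply: main => // t /hm; rewrite (ger0_norm h0).
  have hN t : height t (- x) = - height t x by rewrite -scaleN1r heightZ mulN1r.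
  rewrite -[x]opprK; apply/coneN/main; rewrite hN ?oppr_ge0 ?ltW //.
  by move=> t /hm; rewrite hN normrN (ltr0_norm h0).
move=> h0 hmax; suff pos_y p : 0 <= coord (y *m C m) p.
  by move=> p q; rewrite mulr_ge0.
rewrite leNgt; apply/negP => neg.
have pm : p \in trit m.
  by apply: contraTT neg => /(hC y et) ->; rewrite ltxx.
have [t' [b [et' pt' hq]]] := neighbour et pm.
have := hmax t' et'; rewrite leNgt => /negP; apply.
have sgn1 : (-1) ^+ b * (-1) ^+ b = 1 :> R by rewrite -signr_addb addbb.
have : (-1) ^+ b * height t' y <= `|height t' y|.
  by apply: le_trans (ler_norm _) _; rewrite normrM normrX normrN1 expr1n mul1r.
apply: lt_le_trans.
rewrite [in ltRHS](cone_expand y et) height_sum mulr_sumr /height sum_coord.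
rewrite (bigD1 p) //= [ltRHS](bigD1 p) //=; apply: ltr_leD.
  rewrite mulrCA -[ltLHS]mulr1 ltr_nM2l //.
  have : `|(-1) ^+ b * height t' (lift_pt m.1.1 p)| < 1.
    by rewrite normrM normrX normrN1 expr1n mul1r norm_height_lift hD.
  by rewrite ltr_norml => /andP[].
apply: ler_sum => q qp; have [qm|qm] := boolP (q \in trit m); last first.
  by rewrite hC // mul0r mulr0.
have [qt' hq'] := hq q qm qp; rewrite mulrCA.
have := height_lift et' qt'; rewrite hq' heightZ => ->.
by rewrite mulr1.
Qed.

Lemma lift_common t t' (s : seq P) : edget t -> edget t' ->
  {subset s <= trit t} -> {subset s <= trit t'} ->
  exists b : bool, forall p, p \in s ->
    lift_pt t'.1.1 p = (-1) ^+ b *: lift_pt t.1.1 p.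
Proof.
case: t t' => [[f u] v] [[g u'] v']; rewrite /edget /trit /= => e e' st st'.
have [<-|fg] := eqVneq f g.
  by exists false => p _; rewrite expr0 scale1r.
have K w : lift_pt g (inl w) = (-1) ^+ (sg f w (+) sg g w) *: lift_pt f (inl w).
  by rewrite /= scalerA -signr_addb addbAC addbb.
have noface h : inr h \in s -> False.
  move=> hs; have := st _ hs; have := st' _ hs; rewrite !inE /=.
  by move=> /eqP[hg] /eqP[hf]; rewrite -hf -hg eqxx in fg.
have [us|us] := boolP (inl u \in s); last first.
  exists (sg f v (+) sg g v) => -[w|h] ps; last by case: (noface h).
  have := st _ ps; rewrite !inE /= => /or3P[]// /eqP[wE]; rewrite wE in ps *.
    by rewrite ps in us.
  exact: K.
exists (sg f u (+) sg g u) => -[w|h] ps; last by case: (noface h).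
have := st _ ps; rewrite !inE /= => /or3P[]// /eqP[wE]; rewrite wE in ps *.
  exact: K.
apply: etrans (K v) _; congr (_ ^+ (nat_of_bool _) *: _).
have eg : edge_of g u v.
  have := st' _ us; have := st' _ ps; rewrite !inE /=.
  move=> /or3P[]// /eqP[vE] /or3P[]// /eqP[uE]; rewrite vE uE //.
  - by have := edge_of_neq pY e; rewrite vE uE eqxx.
  - exact: edge_of_symW.
  - by have := edge_of_neq pY e; rewrite vE uE eqxx.
have := hS e eg.
by case: (sg f u); case: (sg g u); case: (sg f v); case: (sg g v).
Qed.

(** Equal images have the same support, which lies in both triangles and is lifted by them up to one
    sign ([lift_common]). Both vectors are then multiples of the same lifted point. *)
Lemma proj_cone_inj t t' x x' : edget t -> edget t' -> cone t x -> cone t' x' ->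
  x != 0 -> x' != 0 -> proj_cone t x = proj_cone t' x' ->
  exists a : R, x' = a *: x.
Proof.
move=> et et' cx cx' x0 x'0 eq.
set y := proj_cone t x in eq.
pose s := [seq p <- enum {: P} | coord y p != 0].
have [b hb] : exists b : bool, forall p, p \in s ->
    lift_pt t'.1.1 p = (-1) ^+ b *: lift_pt t.1.1 p.
  apply: lift_common => // p; rewrite mem_filter => /andP[yp _].
    by have [_ _] := proj_cone_simplex et cx x0; apply.
  by have [_ _] := proj_cone_simplex et' cx' x'0; apply; rewrite -eq.
have X t1 x1 : edget t1 -> cone t1 x1 -> x1 != 0 ->
    x1 = height t1 x1 *: (proj_cone t1 x1 *m lift_mx t1.1.1).
  move=> e1 c1 n1; rewrite /proj_cone -scalemxAl scalerA divff ?scale1r.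
    exact: cone_expand.
  exact: cone_height_neq0.
have Y1 : y *m lift_mx t'.1.1 = (-1) ^+ b *: (y *m lift_mx t.1.1).
  rewrite !lift_mxE scaler_sumr; apply: eq_bigr => p _.
  have [->|yp] := eqVneq (coord y p) 0; first by rewrite !scale0r scaler0.
  have ps : p \in s by rewrite mem_filter yp mem_enum.
  by rewrite hb // !scalerA mulrC.
exists (height t' x' * ((-1) ^+ b / height t x)).
rewrite {1}(X t' x') // -eq Y1 [in X in _ = _ *: X](X t x) // -/y !scalerA; congr (_ *: _).
by rewrite -!mulrA mulVf ?mulr1 //; exact: cone_height_neq0.
Qed.

Lemma lift_cone t y : edget t -> simplex (trit t) y ->
  (y *m lift_mx t.1.1) *m C t = y.
Proof.
move=> et [y0 y1 ht]; rewrite lift_mxE mulmx_suml.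
have X q : coord y q *: lift_pt t.1.1 q *m C t = coord y q *: corner_pt R q.
  have [->|yq] := eqVneq (coord y q) 0; first by rewrite !scale0r mul0mx.
  by rewrite -scalemxAl hB // ht.
rewrite (eq_bigr (fun q => coord y q *: corner_pt R q)) => [|q _]; last exact: X.
apply/rowP => i; rewrite -(enum_valK i); set p := enum_val i.
rewrite summxE (bigD1 p) //= [X in _ + X]big1 ?addr0.
  by rewrite [LHS]coordZ coord_corner eqxx mulr1.
by move=> q /negPf qp; rewrite [LHS]coordZ coord_corner eq_sym qp mulr0.
Qed.

Local Notation S2 := (set_type (sphere2 R)).
Local Notation X := (set_type (realization R Y)).

Lemma sphere_neq0 (x : 'rV[R]_3) : sphere2 R x -> x != 0.
Proof.
move=> hx; apply/eqP => x0; move: hx; rewrite /sphere2 /= x0 big1 => [/eqP|i _].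
  by rewrite eq_sym oner_eq0.
by rewrite mxE expr0n.
Qed.

Lemma continuous_mulmx m k (M : 'M[R]_(m, k)) : continuous (fun x : 'rV[R]_m => x *m M).
Proof.
move=> x U /nbhs_ballP[e /= e0 he].
have c i j : continuous (fun x : 'rV[R]_m => (x *m M) i j).
  rewrite (_ : (fun _ => _) = fun x : 'rV[R]_m => \sum_l x i l * M l j).
    apply: (@continuous_big R 'I_m +%R 0 xpredT) => [|l _]; first exact: add_continuous.
    by move=> z; apply: continuousM; [exact: coord_continuous|exact: cst_continuous].
  by apply/funext => z; rewrite mxE.
have H : nbhs x [set z | forall ij : 'I_1 * 'I_k,
    ball ((x *m M) ij.1 ij.2) e ((z *m M) ij.1 ij.2)].
  apply: (@filter_forall _ _ _ (nbhs x) (nbhs_filter x)) => -[i j] /=.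
  have := c i j x; move/(_ (ball ((x *m M) i j) e)).
  by apply; exact: nbhsx_ballx.
apply: (@filterS _ (nbhs x) _ _ _ _ H) => z hz.
by apply: he; split=> // i j; exact: (hz (i, j)).
Qed.

Lemma continuous_height t : continuous (height t).
Proof.
move=> x; have : {for x, continuous ((fun y : 'rV[R]_N => \sum_i y 0 i) \o
    (fun x : 'rV[R]_3 => x *m C t))}; last by [].
apply: continuous_comp; first exact: continuous_mulmx.
exact: continuous_sum_coord.
Qed.

Lemma proj_cone_continuous t x : height t x != 0 -> {for x, continuous (proj_cone t)}.
Proof.
move=> h0.
have : {for x, continuous (fun y : 'rV[R]_3 => (height t y)^-1 *: (y *m C t))}; last by [].
apply: continuousZ; last exact: continuous_mulmx.
by apply: continuousV => //; exact: continuous_height.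
Qed.

Lemma cone_closed t : closed (cone t).
Proof.
have -> : cone t = \bigcap_p \bigcap_q
    [set x : 'rV[R]_3 | 0 <= coord (x *m C t) p * coord (x *m C t) q].
  by apply/seteqP; split=> [x h p _ q _|x h p q]; [exact: h|exact: (h p I q I)].
apply: closed_bigI => p _; apply: closed_bigI => q _.
apply: (preimage_closed (f := fun x : 'rV[R]_3 =>
    coord (x *m C t) p * coord (x *m C t) q) _ (@closed_ge _ 0)) => x _.
have c r : {for x, continuous (fun x : 'rV[R]_3 => coord (x *m C t) r)}.
  have : {for x, continuous ((fun y : 'rV[R]_N => y 0 (enum_rank r)) \o
      (fun x : 'rV[R]_3 => x *m C t))}; last by [].
  apply: continuous_comp; first exact: continuous_mulmx.
  exact: coord_continuous.
exact: continuousM (c p) (c q).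
Qed.

Lemma sphere_compact : compact (sphere2 R).
Proof.
apply: bounded_closed_compact.
  exists 1; split; first exact: num_real.
  move=> M M1 x hx; apply: (le_trans _ (ltW M1)).
  rewrite [leLHS]/Num.norm /= mx_normrE.
  apply/bigmax_leP; split=> // -[i j] _ /=; rewrite (ord1 i).
  rewrite -(@ler_pXn2r _ 2) ?nnegrE // expr1n -[leRHS]hx real_normK ?num_real //.
  by rewrite (bigD1 j) //= lerDl sumr_ge0 // => l _; exact: sqr_ge0.
apply: (preimage_closed (f := fun x : 'rV[R]_3 => \sum_i x 0 i ^+ 2)
  _ (@closed_eq _ 1)) => x _.
have c : continuous (fun x : 'rV[R]_3 => \sum_i x 0 i ^+ 2).
  apply: (@continuous_big R 'I_3 +%R 0 xpredT) => [|i _]; first exact: add_continuous.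
  by move=> z; apply: continuousM; exact: coord_continuous.
exact: c.
Qed.

(** The cones cover space and their projections agree on overlaps, so they define one map from the
    sphere to the realization. Its fibres are the antipodal pairs; the induced map from the compact
    quotient to a Hausdorff space is a homeomorphism. *)
Theorem polytope_homeomorphic : (exists t, edget t) ->
  homeomorphic (set_type (realization R Y)) (RP2 R).
Proof.
move=> ex.
have [tt htt] : {tt : 'rV[R]_3 -> face Y * vert Y * vert Y &
    forall x, edget (tt x) /\ cone (tt x) x}.
  apply: (@boolp.choice _ _ (fun x t => edget t /\ cone t x)) => x.
  by have [t et ct] := cone_cover x ex; exists t.
have S2_neq0 (x : S2) : val x != 0.
  by apply: sphere_neq0; exact: set_type_in.
have inX (x : S2) : realization R Y (proj_cone (tt (val x)) (val x)).
  have [et ct] := htt (val x); apply: (simplex_realization et).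
  by apply: proj_cone_simplex => //; exact: S2_neq0.
pose h (x : S2) : X := in_set_type (inX x).
have hE t (x : S2) : edget t -> cone t (val x) -> val (h x) = proj_cone t (val x).
  by move=> et ct; have [et' ct'] := htt (val x); exact: proj_cone_eq.
have ch : continuous h.
  move=> x U /nbhs_set_typeP[e e0 he]; apply/nbhs_set_typeP.
  have x0 : val x != 0 by exact: S2_neq0.
  (* Pasting over finitely many closed cones: those containing [x] are controlled by continuity of
     [proj_cone], and a neighbourhood of [x] misses each of the others. *)
  have : \forall y \near val x, forall t, edget t -> cone t y ->
      `|val (h x) - proj_cone t y| < e.
    apply: (@filter_forall _ _ _ (nbhs (val x)) (nbhs_filter _)) => t.
    have [et|/negP net] := boolP (edget t); last first.
      by near=> y.
    have [ct|nct] := pselect (cone t (val x)).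
      rewrite (hE t) //.
      have H := proj_cone_continuous (cone_height_neq0 et ct x0)
        (nbhsx_ballx (proj_cone t (val x)) e e0).
      by apply: (@filterS _ (nbhs (val x)) _ _ _ _ H) => y; rewrite /= -ball_normE /= => ? _ _.
    have H : nbhs (val x) (~` cone t).
      by apply: open_nbhs_nbhs; split=> //; apply: closed_openC; exact: cone_closed.
    by apply: (@filterS _ (nbhs (val x)) _ _ _ _ H).
  move=> /nbhs_ballP[d /= d0 hd]; exists d => // y xy; apply: he.
  have [ety cty] := htt (val y); rewrite (hE _ y ety cty).
  by apply: hd => //; rewrite -ball_normE.
have hsurj (y : X) : exists x : S2, h x = y.
  have /realizationP[f [u [v [e Ty]]]] := set_type_in y.
  pose t := (f, u, v); have et : edget t by [].
  (* The preimage is the point of the polytope with the barycentric coordinates of [y], rescaled to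
     Euclidean norm 1. *)
  pose z := val y *m lift_mx t.1.1.
  have zC : z *m C t = val y by exact: lift_cone.
  have hz : height t z = 1 by rewrite /height zC; case: Ty.
  pose r := \sum_i z 0 i ^+ 2.
  have z0 : z != 0.
    apply/eqP => z0; have : height t z = 0.
      by rewrite z0 -(scale0r (0 : 'rV[R]_3)) heightZ mul0r.
    by rewrite hz => /eqP; rewrite oner_eq0.
  have r0 : 0 < r.
    rewrite lt_def sumr_ge0 => [|i _]; last exact: sqr_ge0.
    rewrite andbT; apply: contraNneq z0; rewrite /r => /eqP.
    rewrite psumr_eq0 => [/allP H|i _]; last exact: sqr_ge0.
    apply/eqP/rowP => i; have := H i (mem_index_enum i).
    by rewrite sqrf_eq0 => /eqP ->; rewrite mxE.
  pose a := (Num.sqrt r)^-1.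
  have a0 : 0 < a by rewrite invr_gt0 sqrtr_gt0.
  have Sx : sphere2 R (a *: z).
    rewrite /sphere2 /= (eq_bigr (fun i => a ^+ 2 * z 0 i ^+ 2)).
      by rewrite -mulr_sumr /a exprVn sqr_sqrtr ?ltW // mulVf // gt_eqF.
    by move=> i _; rewrite mxE exprMn.
  exists (in_set_type Sx); apply/val_inj.
  have ct : cone t (a *: z).
    move=> p q; rewrite -scalemxAl !coordZ zC mulrACA mulr_ge0 //.
      by rewrite mulr_ge0 // ltW.
    by rewrite mulr_ge0 //; exact: simplex_coord_ge0 Ty.
  rewrite (hE t) //= /proj_cone heightZ hz mulr1 -scalemxAl zC scalerA mulVf ?gt_eqF //.
  exact: scale1r.
have hanti (x y : S2) : h x = h y -> antipodal_rel x y.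
  move=> hxy; have [et ct] := htt (val x); have [et' ct'] := htt (val y).
  have [a ha] : exists a : R, val y = a *: val x.
    apply: (proj_cone_inj et et' ct ct').
    - exact: S2_neq0.
    - exact: S2_neq0.
    - exact: (congr1 val hxy).
  have a2 : a ^+ 2 = 1.
    have hx : \sum_i val x 0 i ^+ 2 = 1 := set_type_in x.
    have : \sum_i val y 0 i ^+ 2 = 1 := set_type_in y.
    rewrite ha (eq_bigr (fun i => a ^+ 2 * val x 0 i ^+ 2)).
      by rewrite -mulr_sumr hx mulr1.
    by move=> i _; rewrite mxE exprMn.
  rewrite /antipodal_rel ha; move/eqP: a2; rewrite sqrf_eq1 => /orP[] /eqP ->.
    by rewrite scale1r eqxx.
  by rewrite scaleN1r opprK eqxx orbT.
have hN (x y : S2) : antipodal_rel x y -> h x = h y.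
  move=> /orP[/eqP/val_inj -> //|/eqP xy]; apply/val_inj.
  have [et ct] := htt (val y).
  rewrite (hE _ y et ct) (hE _ x et); last by rewrite xy; exact: coneN.
  rewrite xy /proj_cone -scaleN1r heightZ -scalemxAl scalerA invfM.
  by rewrite invrN1 mulrAC mulrNN mulr1 mul1r.
have piE (x y : S2) : antipodal_rel x y -> \pi_(RP2 R) x = \pi_(RP2 R) y.
  by move=> xy; exact: (elimT (eqmodP (antipodal R) x y)).
have repr_pi (x : S2) : antipodal_rel (repr (\pi_(RP2 R) x)) x.
  by apply: (introT (eqmodP (antipodal R) _ _)); exact: reprK.
pose G : RP2 R -> X := h \o repr.
have cG : continuous G.
  apply: repr_comp_continuous => // x y /eqP /eqmodP xy; apply/eqP; exact: hN.
apply: (compact_bijection_homeomorphic (G := G)) => //.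
- have -> : [set: RP2 R] = (\pi_(RP2 R) : S2 -> RP2 R) @` [set: S2].
    by apply/seteqP; split=> // x _; exists (repr x) => //; exact: reprK.
  apply: continuous_compact; last exact/set_type_compact/sphere_compact.
  by apply: continuous_subspaceT; exact: pi_continuous.
- exact: set_type_hausdorff.
- move=> x y /hanti xy; by rewrite -(reprK x) -(reprK y); exact: piE.
- move=> y; have [x <-] := hsurj y; exists (\pi_(RP2 R) x).
  exact/hN/repr_pi.
Unshelve. all: by end_near. Qed.

End Polytope.

(** * Polytopes with integer coordinates *)

Definition zvec := (Z * Z * Z)%type.

Local Notation "x +z y" := (Z.add x y) (at level 50, left associativity).
Local Notation "x -z y" := (Z.sub x y) (at level 50, left associativity).
Local Notation "x *z y" := (Z.mul x y) (at level 40, left associativity).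

Definition zdot (a b : zvec) : Z :=
  a.1.1 *z b.1.1 +z a.1.2 *z b.1.2 +z a.2 *z b.2.
Definition zcross (a b : zvec) : zvec :=
  (a.1.2 *z b.2 -z a.2 *z b.1.2, a.2 *z b.1.1 -z a.1.1 *z b.2,
   a.1.1 *z b.1.2 -z a.1.2 *z b.1.1).
Definition zadd (a b : zvec) : zvec :=
  (a.1.1 +z b.1.1, a.1.2 +z b.1.2, a.2 +z b.2).
Definition zsign (s : bool) (a : zvec) : zvec :=
  if s then (Z.opp a.1.1, Z.opp a.1.2, Z.opp a.2) else a.
(** A normal of the plane through [a], [b] and [c]: its product with [q], divided by the determinant
    of [a], [b], [c], is the height of [q] over the triangle. *)
Definition znormal (a b c : zvec) : zvec :=
  zadd (zcross b c) (zadd (zcross c a) (zcross a b)).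

(** [md_top] is the number of vertices minus one, which makes the vertex type inhabited by
    construction. [md_signs] runs parallel to [md_faces]; [md_fpos] holds the apexes, and
    [md_cycles] the face-cycles, given as certificates. *)
Record map_data := MapData {
  md_top : nat;
  md_faces : seq (seq nat);
  md_signs : seq (seq bool);
  md_vpos : seq zvec;
  md_fpos : seq zvec;
  md_cycles : seq (seq nat)
}.

Section MapData.
Local Open Scope nat_scope.
Variable d : map_data.
Let n := (md_top d).+1.
Let m := size (md_faces d).
Let z0 : zvec := (Z0, Z0, Z0).

Definition md_face (f : nat) := nth [::] (md_faces d) f.
Definition md_sign (f u : nat) :=
  nth false (nth [::] (md_signs d) f) (index u (md_face f)).
Definition md_v u := nth z0 (md_vpos d) u.
Definition md_f f := nth z0 (md_fpos d) f.

Definition md_edge (l : seq nat) (a b : nat) :=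
  (a \in l) && ((b == next l a) || (b == prev l a)).

Definition md_meet (l l' : seq nat) :=
  match [seq x <- l | x \in l'] with
  | [::] | [:: _] => true
  | [:: u; v] => md_edge l u v && md_edge l' u v
  | _ => false
  end.

Definition md_wf := all (fun l => [&& uniq l, 2 < size l & all (fun u => u < n) l])
  (md_faces d).
Definition md_cover := all (fun u => has (fun l => u \in l) (md_faces d)) (iota 0 n).
Definition md_meets := all (fun i => all (fun j => (i == j) ||
  md_meet (md_face i) (md_face j)) (iota 0 m)) (iota 0 m).
Definition md_flags (P : nat -> nat -> nat -> bool) :=
  all (fun f => let l := md_face f in
    all (fun u => P f u (next l u) && P f u (prev l u)) l) (iota 0 m).
Definition md_edges := md_flags (fun f u v =>
  count (fun g => md_edge (md_face g) u v) (iota 0 m) == 2).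
Definition md_adj u f g := (f != g) &&
  has (fun w => md_edge (md_face f) u w && md_edge (md_face g) u w) (md_face f).
Definition md_rotation (p : seq nat) := all (fun u => let c := nth [::] (md_cycles d) u in
  [&& uniq c, all (fun f => f < m) c,
      all (fun f => (f \in c) == (u \in md_face f)) (iota 0 m), cycle (md_adj u) c
    & [seq size (md_face f) | f <- c] == p]) (iota 0 n).
Definition md_coherent := md_flags (fun f u v =>
  all (fun g => md_edge (md_face g) u v ==>
    (md_sign f u (+) md_sign f v == md_sign g u (+) md_sign g v)) (iota 0 m)).
(** The hypothesis [hD] cleared of denominators: instead of a height below 1, the product with the
    normal is compared with the determinant, over the integers. *)
Definition md_convex := md_flags (fun f u v =>
  let a := zsign (md_sign f u) (md_v u) in let b := zsign (md_sign f v) (md_v v) in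
  let c := md_f f in let D := zdot a (zcross b c) in
  let D' := Z.abs D in let N := znormal a b c in
  [&& ~~ Z.eqb D' Z0,
      all (fun q => [|| q == u, q == v | Z.ltb (Z.abs (zdot (md_v q) N)) D']) (iota 0 n)
    & all (fun g => (g == f) || Z.ltb (Z.abs (zdot (md_f g) N)) D') (iota 0 m)]).

Definition md_check p := [&& md_wf, md_cover, md_meets, md_edges, md_rotation p,
  md_coherent & md_convex].

Definition md_map : cellmap := @CellMap 'I_n 'I_m
  (fun f => [seq inord u | u <- md_face f]).

Hypothesis hwf : md_wf.

Lemma md_bnd (f : face md_map) : [seq val u | u <- bnd f] = md_face (val f).
Proof.
rewrite -map_comp -[RHS]map_id; apply/eq_in_map => u uf /=.
have /allP/(_ _ (mem_nth [::] (ltn_ord f)))/and3P[_ _ /allP/(_ _ uf)] := hwf.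
exact: inordK.
Qed.

Lemma md_mem (f : face md_map) (u : vert md_map) :
  (u \in bnd f) = (val u \in md_face (val f)).
Proof. by rewrite -md_bnd (mem_map val_inj). Qed.

Lemma md_uniq (f : face md_map) : uniq (bnd f).
Proof.
have /allP/(_ _ (mem_nth [::] (ltn_ord f)))/and3P[h _ _] := hwf.
by rewrite -(map_inj_uniq val_inj) md_bnd.
Qed.

Lemma md_next (f : face md_map) (u : vert md_map) :
  val (next (bnd f) u) = next (md_face (val f)) (val u).
Proof. by rewrite -md_bnd (next_map val_inj) // md_uniq. Qed.

Lemma md_prev (f : face md_map) (u : vert md_map) :
  val (prev (bnd f) u) = prev (md_face (val f)) (val u).
Proof. by rewrite -md_bnd (prev_map val_inj) // md_uniq. Qed.

Lemma md_edge_of (f : face md_map) (u v : vert md_map) :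
  edge_of f u v = md_edge (md_face (val f)) (val u) (val v).
Proof. by rewrite /edge_of /md_edge md_mem -md_next -md_prev !(inj_eq val_inj). Qed.

Lemma md_flagsP (P : nat -> nat -> nat -> bool) : md_flags P ->
  forall (f : face md_map) (u v : vert md_map), edge_of f u v ->
    P (val f) (val u) (val v).
Proof.
move=> /allP h f u v e; have fm : val f \in iota 0 m by rewrite mem_iota /= ltn_ord.
have := h _ fm => /allP; move/(_ (val u)).
move: e; rewrite md_edge_of /md_edge => /andP[uf e] /(_ uf) /andP[h1 h2].
by case/orP: e => /eqP ->.
Qed.

Lemma md_count (P : pred nat) :
  #|[pred g : face md_map | P (val g)]| = count P (iota 0 m).
Proof.
rewrite -val_enum_ord count_map -sum1_count -sum1_card.
by rewrite [RHS]big_enum_cond /=; apply: eq_bigl.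
Qed.

Lemma md_lift_seq (c : seq nat) : all (fun f => f < m) c ->
  exists cf : seq 'I_m, map val cf = c.
Proof.
elim: c => [|f c IH] /=; first by exists [::].
by case/andP => fm /IH[cf <-]; exists (Ordinal fm :: cf).
Qed.

Lemma md_adjacent u (f g : face md_map) : md_adj (val u) (val f) (val g) ->
  adjacent_at (Y := md_map) u f g.
Proof.
case/andP => fg /hasP[w]; rewrite -{1}md_bnd => /mapP[v vf ->] /andP[h1 h2].
rewrite /adjacent_at -(inj_eq val_inj) fg; apply/existsP; exists v.
by rewrite !md_edge_of h1.
Qed.

Lemma md_face_cycle p : {in iota 0 n, forall u, let c := nth [::] (md_cycles d) u in
  [&& uniq c, all (fun f => f < m) c,
      all (fun f => (f \in c) == (u \in md_face f)) (iota 0 m), cycle (md_adj u) c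
    & [seq size (md_face f) | f <- c] == p]} ->
  forall u : vert md_map, exists c, face_cycle u c /\ [seq size (bnd f) | f <- c] = p.
Proof.
move=> hrot u; have := hrot (val u); rewrite mem_iota /= ltn_ord => /(_ isT).
set c0 := nth _ _ _; case/and5P => uc /md_lift_seq[c hc] /allP hm cyc /eqP <-.
rewrite -{}hc in uc hm cyc *; exists c; split.
  split.
  - by rewrite -(map_inj_uniq val_inj).
  - move=> f; rewrite md_mem -(mem_map val_inj); apply/eqP/hm.
    by rewrite mem_iota /= ltn_ord.
  - by move: cyc; rewrite cycle_map; apply: sub_cycle => f g; exact: md_adjacent.
by rewrite -map_comp; apply: eq_map => f; rewrite -(size_map val) md_bnd.
Qed.

Lemma md_polyhedral p : md_check p -> polyhedral_map md_map.
Proof.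
case/and5P => _ /allP hcov /allP hmeet hedge /and3P[/allP hrot _ _]; split.
- move=> f; have /allP/(_ _ (mem_nth [::] (ltn_ord f)))/and3P[h1 h2 _] := hwf.
  by rewrite -(map_inj_uniq val_inj) -(size_map val) md_bnd.
- move=> u; have := hcov (val u); rewrite mem_iota /= ltn_ord => /(_ isT).
  case/hasP => l /(nthP [::])[i im <-] uf.
  by exists (Ordinal im); rewrite md_mem.
- move=> f g fg; have fm h : val (h : 'I_m) \in iota 0 m by rewrite mem_iota /= ltn_ord.
  have /allP/(_ _ (fm g)) := hmeet _ (fm f).
  rewrite (inj_eq val_inj) (negPf fg) /= /md_meet -!md_bnd filter_map.
  set s := seq.filter _ _; have hs x : (x \in common_vertices f g) = (x \in s).
    by rewrite inE mem_filter /= (mem_map val_inj) andbC.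
  have E u v : u \in bnd f -> md_edge (md_face (val f)) (val u) (val v) -> edge_of f u v.
    by rewrite md_edge_of.
  case: s hs => [|u [|v [|w s]]] //= hs h.
  + by constructor 1; apply/finset.setP => x; rewrite hs finset.in_set0.
  + by constructor 2; exists u; apply/finset.setP => x; rewrite hs finset.in_set1 inE.
  + constructor 3; exists u, v; move: h; rewrite !md_bnd -!md_edge_of => /andP[h1 h2].
    by split=> //; apply/finset.setP => x; rewrite hs finset.in_set2 !inE.
- move=> f u v e; rewrite -(eqP (md_flagsP hedge e)) -md_count.
  by apply: eq_card => g; rewrite !inE md_edge_of.
- by move=> u; have [c []] := md_face_cycle hrot u; exists c.
Qed.

Lemma md_semi_equivelar t : md_check (Defs.expand t) -> proper_vtype t ->
  semi_equivelar md_map t.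
Proof.
by case/and5P => _ _ _ _ /and3P[/allP hrot _ _] pt; split=> //; exact: md_face_cycle.
Qed.

End MapData.

(** * Dual bases by cross products *)

Section Triples.
Variable R : realType.
Local Notation vec := (R * R * R)%type.

Definition dotp (a b : vec) : R := a.1.1 * b.1.1 + a.1.2 * b.1.2 + a.2 * b.2.
Definition crossp (a b : vec) : vec :=
  (a.1.2 * b.2 - a.2 * b.1.2, a.2 * b.1.1 - a.1.1 * b.2,
   a.1.1 * b.1.2 - a.1.2 * b.1.1).
Definition addp (a b : vec) : vec := (a.1.1 + b.1.1, a.1.2 + b.1.2, a.2 + b.2).
Definition normalp (a b c : vec) : vec :=
  addp (crossp b c) (addp (crossp c a) (crossp a b)).
Definition detp (a b c : vec) := dotp a (crossp b c).

Definition row3 (a : vec) : 'rV[R]_3 := \row_i nth 0 [:: a.1.1; a.1.2; a.2] i.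
Definition mx3 (a b c : vec) : 'M[R]_3 :=
  \matrix_(i, j) row3 (nth a [:: a; b; c] i) 0 j.
Definition dual3 (a b c : vec) : 'M[R]_3 :=
  (detp a b c)^-1 *: (mx3 (crossp b c) (crossp c a) (crossp a b))^T.

Lemma mulmx_dual3 a b c : detp a b c != 0 -> dual3 a b c *m mx3 a b c = 1%:M.
Proof.
move=> D0; apply: mulmx1C; rewrite /dual3 -scalemxAr.
apply/matrixP => i j; rewrite !mxE !big_ord_recl big_ord0 !mxE /=.
case: i j => [[|[|[|//]]] ?] [[|[|[|//]]] ?];
  rewrite /detp /dotp /crossp /= ?mulr1n ?mulr0n in D0 *.
all: by field.
Qed.

Lemma row3_dual3_sum a b c q : \sum_i (row3 q *m dual3 a b c) 0 i =
  dotp q (normalp a b c) / detp a b c.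
Proof.
rewrite !big_ord_recl big_ord0 /dual3 -scalemxAr !mxE !big_ord_recl !big_ord0 !mxE /=.
by rewrite /dotp /normalp /addp /=; ring.
Qed.

Definition zr (z : Z) : R := (int_of_Z z)%:~R.
Definition zrv (a : zvec) : vec := (zr a.1.1, zr a.1.2, zr a.2).

Lemma zrD x y : zr (x +z y) = zr x + zr y.
Proof. by rewrite /zr -intrD; congr (_%:~R); lia. Qed.

Lemma zrN x : zr (Z.opp x) = - zr x.
Proof. by rewrite /zr -mulrNz; congr (_%:~R); lia. Qed.

Lemma zrM x y : zr (x *z y) = zr x * zr y.
Proof. by rewrite /zr -intrM; congr (_%:~R); lia. Qed.

Lemma zrB x y : zr (x -z y) = zr x - zr y.
Proof. by rewrite -zrN -zrD. Qed.

Lemma zr_eq0 x : (zr x == 0) = Z.eqb x Z0.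
Proof. rewrite /zr intr_eq0; lia. Qed.

Lemma zr_lt x y : Z.ltb x y -> zr x < zr y.
Proof. move=> h; rewrite /zr ltr_int; lia. Qed.

Lemma zr_abs x : zr (Z.abs x) = `|zr x|.
Proof. by rewrite /zr -intr_norm; congr (_%:~R); lia. Qed.

Lemma zrv_dot a b : zr (zdot a b) = dotp (zrv a) (zrv b).
Proof. by rewrite /zdot /dotp !zrD !zrM. Qed.

Lemma zrv_cross a b : zrv (zcross a b) = crossp (zrv a) (zrv b).
Proof. by rewrite /zrv /zcross /crossp /= !zrB !zrM. Qed.

Lemma zrv_normal a b c : zrv (znormal a b c) = normalp (zrv a) (zrv b) (zrv c).
Proof. by rewrite /normalp -!zrv_cross /zrv /znormal /addp /= !zrD. Qed.

End Triples.

Lemma sum_corner_rows (R : realType) (Y : cellmap) k (y : 'rV[R]_k)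
    (s : 'I_k -> vert Y + face Y) :
  \sum_j (y *m \matrix_i corner_pt R (s i)) 0 j = \sum_i y 0 i.
Proof.
rewrite (eq_bigr (fun j => \sum_i y 0 i * corner_pt R (s i) 0 j)) => [|j _]; last first.
  by rewrite mxE; apply: eq_bigr => i _; rewrite mxE.
rewrite exchange_big /=; apply: eq_bigr => i _; rewrite -mulr_sumr.
rewrite (bigD1 (enum_rank (s i))) //= big1 => [|j jn]; rewrite mxE ?eqxx /=.
  by rewrite addr0 mulr1.
by rewrite (negPf jn).
Qed.

Section MapDataRealization.
Variables (R : realType) (d : map_data).
Let Y := md_map d.

Definition md_pos (p : vert Y + face Y) : zvec :=
  match p with inl u => md_v d (val u) | inr f => md_f d (val f) end.

Definition md_zlift (f : face Y) (p : vert Y + face Y) : zvec :=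
  if p is inl u then zsign (md_sign d (val f) (val u)) (md_pos p) else md_pos p.

Definition md_posR p := row3 (zrv R (md_pos p)).

Definition md_coords (t : face Y * vert Y * vert Y) : 'M[R]_(3, #|{: vert Y + face Y}|) :=
  let l p := zrv R (md_zlift t.1.1 p) in
  dual3 (l (inl t.1.2)) (l (inl t.2)) (l (inr t.1.1)) *m
  \matrix_i corner_pt R (nth (inr t.1.1) (tri t.1.1 t.1.2 t.2) i).

Theorem md_homeomorphic p : md_check d p -> (exists t, edget (Y := Y) t) ->
  homeomorphic (set_type (realization R Y)) (RP2 R).
Proof.
move=> hc ex; have pY := md_polyhedral (proj1 (andP hc)) hc.
case/and5P: hc => hwf _ _ _ /and3P[_ hcoh hconv].
pose sg (f : face Y) (u : vert Y) := md_sign d (val f) (val u).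
have liftE f q : lift_pt md_posR sg f q = row3 (zrv R (md_zlift f q)).
  case: q => [u|g] //=; rewrite /sg; case: (md_sign _ _ _); last by rewrite expr0 scale1r.
  rewrite expr1; apply/rowP => i; rewrite !mxE.
  by case: i => [[|[|[|//]]] ?] /=; rewrite zrN mulN1r.
pose D (t : face Y * vert Y * vert Y) := let l q := zrv R (md_zlift t.1.1 q) in
  detp (l (inl t.1.2)) (l (inl t.2)) (l (inr t.1.1)).
pose E (t : face Y * vert Y * vert Y) : 'M[R]_(3, #|{: vert Y + face Y}|) :=
  \matrix_i corner_pt R (nth (inr t.1.1) (tri t.1.1 t.1.2 t.2) i).
have tri_nth (t : face Y * vert Y * vert Y) (i : nat) : (i < 3)%nat ->
    nth (inr t.1.1) (tri t.1.1 t.1.2 t.2) i \in trit t.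
  by move=> i3; apply: mem_nth.
have hzr t : edget t -> D t != 0 /\ forall q, q \notin trit t ->
    `|dotp (zrv R (md_pos q)) (let l q := zrv R (md_zlift t.1.1 q) in
       normalp (l (inl t.1.2)) (l (inl t.2)) (l (inr t.1.1)))| < `|D t|.
  case: t => [[f u] v] e; have := md_flagsP hwf hconv e.
  move=> /and3P[/negbTE D0 /allP hv /allP hf]; split.
    rewrite /D /= /detp -zrv_cross -zrv_dot zr_eq0; move: D0 => /=.
    by rewrite /md_zlift /= => /negbT; lia.
  move=> q; rewrite /trit !inE /= => /norP[qu /norP[qv qf]].
  rewrite /D /= -zrv_normal /detp -zrv_cross -!zrv_dot -!zr_abs; apply: zr_lt.
  case: q qu qv qf => [w|g] qu qv qf /=.
    have := hv (val w); rewrite mem_iota /= ltn_ord => /(_ isT).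
    case/or3P => // /eqP/val_inj wE; first by rewrite wE eqxx in qu.
    by rewrite wE eqxx in qv.
  have := hf (val g); rewrite mem_iota /= ltn_ord => /(_ isT).
  by case/orP => // /eqP/val_inj gE; rewrite gE eqxx in qf.
have EL t : E t *m lift_mx md_posR sg t.1.1 =
    let l q := zrv R (md_zlift t.1.1 q) in
    mx3 (l (inl t.1.2)) (l (inl t.2)) (l (inr t.1.1)).
  apply/row_matrixP => i; rewrite row_mul !rowK /corner_pt -rowE rowK enum_rankK.
  rewrite liftE; apply/rowP => j; rewrite !mxE.
  by case: i => [[|[|[|//]]] ?].
have lift_row t i : row i (E t *m lift_mx md_posR sg t.1.1) =
    lift_pt md_posR sg t.1.1 (nth (inr t.1.1) (tri t.1.1 t.1.2 t.2) i).
  by rewrite row_mul rowK /corner_pt -rowE rowK enum_rankK.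
have CE t : md_coords t = (let l q := zrv R (md_zlift t.1.1 q) in
    dual3 (l (inl t.1.2)) (l (inl t.2)) (l (inr t.1.1))) *m E t by [].
apply: (@polytope_homeomorphic R Y pY md_posR sg md_coords) => //.
- move=> t /hzr[D0 _]; rewrite CE -mulmxA EL; exact: mulmx_dual3.
- move=> t q et qt; have [D0 _] := hzr t et.
  have q3 : (index q (trit t) < 3)%nat by move: qt; rewrite -index_mem.
  rewrite -[q in LHS](nth_index (inr t.1.1) qt) -(lift_row t (Ordinal q3)).
  rewrite rowE EL CE -!mulmxA [mx3 _ _ _ *m _]mulmxA.
  rewrite (mulmx1C (mulmx_dual3 D0)) mul1mx -rowE rowK /=.
  by rewrite (nth_index _ qt).
- move=> t x q et qt; rewrite CE mulmxA /coord mxE big1 // => i _.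
  rewrite [E t _ _]mxE -/(coord (corner_pt R _) q) coord_corner.
  rewrite (_ : _ == _ = false) ?mulr0 //.
  by apply: contraNF qt => /eqP ->; exact: tri_nth.
- move=> t q et qt; have [D0 hq] := hzr t et.
  rewrite /height CE mulmxA sum_corner_rows.
  by rewrite row3_dual3_sum normrM normfV ltr_pdivrMr ?normr_gt0 // mul1r; exact: hq.
- move=> f g u v ef eg; have /allP/(_ (val g)) := md_flagsP hwf hcoh ef.
  by rewrite mem_iota /= ltn_ord -md_edge_of // eg => /(_ isT)/eqP.
Qed.

End MapDataRealization.

(** * The ten maps *)

Section Examples.
Local Open Scope nat_scope.
Definition zv (a b c : Z) : zvec := (a, b, c).
Arguments zv (a b c)%_Z_scope.

(* The entry [2 u + s] of a face stands for the vertex [u], taken with the sign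
   [(-1)^s] among the two antipodal lifts of [u] to the polytope. *)
Definition signed_map_data (top : nat) (fs : seq (seq nat)) (vp fp : seq zvec)
    (cs : seq (seq nat)) : map_data :=
  MapData top (map (map half) fs) (map (map odd) fs) vp fp cs.

(** Each face is replaced by a pyramid of triangles whose apex is a further vertex of the polytope,
    so the corners of a face need not be coplanar. Only strict inequalities are then tested, and
    integer coordinates satisfy them even where the regular solid has irrational ones. *)
Definition hemi_dodecahedral := signed_map_data 9
   [:: [:: 0; 2; 10; 12; 4]; [:: 0; 4; 14; 16; 6]; [:: 0; 6; 18; 8; 2]; [:: 2;
    8; 15; 17; 10]; [:: 4; 12; 19; 9; 14]; [:: 6; 16; 11; 13; 18]]
   [:: zv (-3) (-3) 2; zv 0 (-4) 3; zv (-4) 0 3; zv (-4) (-3) (-1); zv 1 (-5)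
    (-1); zv 2 (-2) 4; zv 0 1 5; zv (-4) 3 1; zv (-4) 1 (-2); zv (-1) (-4)
    (-3)]
   [:: zv (-1) (-2) 4; zv (-5) 0 1; zv (-2) (-4) 0; zv 3 (-3) 2; zv (-2) 3 3;
    zv (-3) (-1) (-4)]
   [:: [:: 0; 2; 1]; [:: 2; 0; 3]; [:: 0; 1; 4]; [:: 1; 2; 5]; [:: 2; 3; 4];
    [:: 3; 0; 5]; [:: 0; 4; 5]; [:: 4; 1; 3]; [:: 1; 5; 3]; [:: 5; 2; 4]].

Definition hemi_icosahedral := signed_map_data 5
   [:: [:: 0; 2; 4]; [:: 0; 4; 6]; [:: 0; 6; 8]; [:: 0; 8; 10]; [:: 0; 10; 2];
    [:: 2; 10; 7]; [:: 2; 7; 9]; [:: 2; 9; 4]; [:: 4; 9; 11]; [:: 4; 11; 6]]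
   [:: zv 8 (-2) 2; zv 2 (-8) 1; zv 4 (-4) (-6); zv 6 4 (-3); zv 4 5 5; zv 1
    (-2) 8]
   [:: zv 5 (-5) (-1); zv 6 0 (-3); zv 6 3 1; zv 5 0 5; zv 4 (-4) 4; zv (-1)
    (-5) 4; zv (-3) (-6) 0; zv 1 (-6) (-3); zv 0 (-2) (-7); zv 3 1 (-6)]
   [:: [:: 0; 4; 3; 2; 1]; [:: 4; 0; 7; 6; 5]; [:: 0; 1; 9; 8; 7]; [:: 1; 2;
    6; 5; 9]; [:: 2; 3; 8; 7; 6]; [:: 3; 4; 5; 9; 8]].

Definition hemi_truncated_octahedral := signed_map_data 11
   [:: [:: 0; 2; 10; 4]; [:: 0; 4; 12; 21; 14; 6]; [:: 0; 6; 16; 18; 8; 2];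
    [:: 2; 8; 20; 15; 22; 10]; [:: 4; 10; 22; 17; 19; 12]; [:: 6; 14; 23; 16];
    [:: 8; 18; 13; 20]]
   [:: zv 1 6 2; zv (-1) 6 (-1); zv (-2) 4 4; zv 4 4 2; zv (-1) 4 (-4); zv
    (-4) 4 1; zv (-1) 1 6; zv 5 0 3; zv 5 2 (-2); zv 3 2 (-5); zv (-2) 1 (-5);
    zv (-6) 1 0]
   [:: zv (-2) 5 2; zv 2 3 5; zv 2 5 (-2); zv (-4) 3 (-3); zv (-4) 1 4; zv 6 1
    1; zv 0 2 (-5)]
   [:: [:: 0; 2; 1]; [:: 0; 3; 2]; [:: 0; 1; 4]; [:: 5; 1; 2]; [:: 6; 2; 3];
    [:: 0; 4; 3]; [:: 6; 4; 1]; [:: 5; 3; 1]; [:: 5; 2; 4]; [:: 6; 4; 2]; [::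
    6; 3; 1]; [:: 5; 3; 4]].

Definition hemi_icosidodecahedral := signed_map_data 14
   [:: [:: 0; 2; 4]; [:: 0; 4; 16; 18; 6]; [:: 0; 6; 8]; [:: 0; 8; 24; 10; 2];
    [:: 2; 10; 12]; [:: 2; 12; 28; 14; 4]; [:: 4; 14; 16]; [:: 6; 18; 20]; [::
    6; 20; 29; 22; 8]; [:: 8; 22; 24]; [:: 10; 24; 26]; [:: 10; 26; 19; 21;
    12]; [:: 12; 21; 28]; [:: 14; 28; 23]; [:: 14; 23; 25; 27; 16]; [:: 16;
    27; 18]]
   [:: zv 4 6 10; zv 10 4 6; zv 6 10 4; zv (-4) 6 10; zv 0 0 12; zv 10 (-4) 6;
    zv 12 0 0; zv 6 10 (-4); zv 0 12 0; zv (-6) 10 4; zv (-10) 4 6; zv (-4)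
    (-6) 10; zv 4 (-6) 10; zv 6 (-10) 4; zv 10 4 (-6)]
   [:: zv 7 7 7; zv 0 10 6; zv 0 4 11; zv 6 0 10; zv 11 0 4; zv 10 6 0; zv 4
    11 0; zv (-7) 7 7; zv (-6) 0 10; zv 0 (-4) 11; zv 7 (-7) 7; zv 10 (-6) 0;
    zv 11 0 (-4); zv 7 7 (-7); zv 0 10 (-6); zv (-4) 11 0]
   [:: [:: 0; 3; 2; 1]; [:: 4; 3; 0; 5]; [:: 0; 1; 6; 5]; [:: 7; 1; 2; 8]; [::
    2; 3; 9; 8]; [:: 10; 3; 4; 11]; [:: 4; 5; 12; 11]; [:: 13; 5; 6; 14]; [::
    6; 1; 15; 14]; [:: 15; 1; 7; 11]; [:: 7; 8; 12; 11]; [:: 13; 8; 9; 14];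
    [:: 9; 3; 10; 14]; [:: 10; 11; 15; 14]; [:: 12; 5; 13; 8]].

Definition hemi_rhombicuboctahedral := signed_map_data 11
   [:: [:: 0; 2; 4]; [:: 0; 4; 16; 6]; [:: 0; 6; 20; 8]; [:: 0; 8; 10; 2]; [::
    2; 10; 19; 12]; [:: 2; 12; 14; 4]; [:: 4; 14; 23; 16]; [:: 6; 16; 18]; [::
    6; 18; 13; 20]; [:: 8; 20; 15; 22]; [:: 8; 22; 10]; [:: 10; 22; 17; 19];
    [:: 12; 21; 14]]
   [:: zv (-1) (-8) (-4); zv 0 (-3) (-8); zv 5 (-6) (-5); zv 0 (-9) 2; zv (-7)
    (-5) (-3); zv (-6) 0 (-7); zv 3 3 (-8); zv 8 0 (-5); zv 6 (-7) 1; zv 3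
    (-5) 7; zv (-6) (-6) 4; zv (-9) 1 (-1)]
   [:: zv 1 (-6) (-6); zv 2 (-8) (-2); zv (-4) (-8) 0; zv (-4) (-4) (-6); zv
    (-2) 1 (-8); zv 4 (-2) (-7); zv 8 (-4) (-2); zv 3 (-8) 3; zv (-2) (-6) 6;
    zv (-8) (-3) 1; zv (-8) (-1) (-4); zv (-6) 4 (-4); zv 6 3 (-6)]
   [:: [:: 0; 3; 2; 1]; [:: 0; 5; 4; 3]; [:: 0; 1; 6; 5]; [:: 7; 1; 2; 8]; [::
    10; 9; 2; 3]; [:: 10; 3; 4; 11]; [:: 12; 8; 4; 5]; [:: 12; 5; 6; 9]; [::
    7; 11; 6; 1]; [:: 7; 8; 4; 11]; [:: 12; 8; 2; 9]; [:: 10; 11; 6; 9]].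

Definition hemi_truncated_cuboctahedral := signed_map_data 23
   [:: [:: 0; 2; 10; 4]; [:: 0; 4; 12; 26; 14; 6]; [:: 0; 6; 16; 30; 32; 18;
    8; 2]; [:: 2; 8; 20; 36; 22; 10]; [:: 4; 10; 22; 38; 47; 40; 24; 12]; [::
    6; 14; 28; 16]; [:: 8; 18; 34; 20]; [:: 12; 24; 42; 26]; [:: 14; 26; 42;
    35; 21; 37; 44; 28]; [:: 16; 28; 44; 39; 46; 30]; [:: 18; 32; 41; 25; 43;
    34]; [:: 22; 36; 45; 38]; [:: 30; 46; 41; 32]]
   [:: zv 6 11 (-6); zv 4 8 (-11); zv 0 13 (-5); zv 9 10 (-1); zv 5 3 (-13);
    zv (-2) 10 (-10); zv (-2) 14 1; zv 7 11 5; zv 13 6 1; zv 9 (-2) (-11); zv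
    1 (-1) (-14); zv (-6) 6 (-11); zv (-7) 12 4; zv 1 13 6; zv 10 7 7; zv 14 0
    (-1); zv 12 (-3) (-6); zv 4 (-6) (-12); zv (-5) 1 (-13); zv (-11) 4 (-8);
    zv (-11) 8 3; zv (-3) 11 9; zv 10 2 10; zv 13 (-4) 2]
   [:: zv 2 11 (-8); zv 4 13 0; zv 11 5 (-7); zv 0 5 (-13); zv (-8) 10 (-4);
    zv 10 9 3; zv 5 (-2) (-13); zv (-3) 13 5; zv 4 7 11; zv 13 1 5; zv 9 (-7)
    (-8); zv (-8) 2 (-11); zv 13 (-4) (-2)]
   [:: [:: 0; 1; 2]; [:: 0; 3; 2]; [:: 0; 1; 4]; [:: 5; 1; 2]; [:: 6; 3; 2];
    [:: 0; 3; 4]; [:: 7; 1; 4]; [:: 5; 1; 8]; [:: 5; 9; 2]; [:: 6; 10; 2]; [::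
    6; 3; 8]; [:: 11; 3; 4]; [:: 7; 10; 4]; [:: 7; 1; 8]; [:: 5; 9; 8]; [::
    12; 9; 2]; [:: 12; 10; 2]; [:: 6; 10; 8]; [:: 11; 3; 8]; [:: 11; 9; 4];
    [:: 12; 10; 4]; [:: 7; 10; 8]; [:: 11; 9; 8]; [:: 12; 9; 4]].

Definition hemi_rhombicosidodecahedral := signed_map_data 29
   [:: [:: 0; 2; 4]; [:: 0; 4; 16; 6]; [:: 0; 6; 20; 22; 8]; [:: 0; 8; 10; 2];
    [:: 2; 10; 26; 28; 12]; [:: 2; 12; 14; 4]; [:: 4; 14; 32; 34; 16]; [:: 6;
    16; 18]; [:: 6; 18; 38; 20]; [:: 8; 22; 44; 24]; [:: 8; 24; 10]; [:: 10;
    24; 46; 26]; [:: 12; 28; 52; 30]; [:: 12; 30; 14]; [:: 14; 30; 54; 32];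
    [:: 16; 34; 36; 18]; [:: 18; 36; 49; 51; 38]; [:: 20; 38; 40]; [:: 20; 40;
    42; 22]; [:: 22; 42; 44]; [:: 24; 44; 57; 59; 46]; [:: 26; 46; 48]; [::
    26; 48; 50; 28]; [:: 28; 50; 52]; [:: 30; 52; 41; 43; 54]; [:: 32; 54;
    56]; [:: 32; 56; 58; 34]; [:: 34; 58; 36]; [:: 36; 58; 47; 49]; [:: 38;
    51; 53; 40]; [:: 42; 55; 57; 44]]
   [:: zv (-21) 19 10; zv (-24) 8 16; zv (-15) 15 21; zv (-11) 27 7; zv (-26)
    15 (-2); zv (-30) 3 4; zv (-19) (-3) 23; zv (-10) 5 28; zv (-4) 24 18; zv
    3 29 8; zv (-9) 28 (-7); zv (-19) 20 (-12); zv (-28) 4 (-9); zv (-28)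
    (-10) 4; zv (-22) (-14) 15; zv (-8) (-8) 28; zv 3 7 29; zv 7 18 23; zv 14
    23 13; zv 4 29 (-5); zv (-1) 25 (-17); zv (-11) 17 (-22); zv (-21) 9
    (-19); zv (-27) (-10) (-9); zv (-22) (-20) (-3); zv (-16) (-24) 9; zv
    (-10) (-19) 20; zv 5 (-7) 29; zv 15 1 26; zv 19 13 20]
   [:: zv (-20) 14 16; zv (-13) 22 14; zv (-18) 23 (-1); zv (-26) 11 7; zv
    (-26) (-3) 13; zv (-18) 7 22; zv (-4) 14 25; zv (-4) 27 11; zv (-4) 29 1;
    zv (-24) 12 (-11); zv (-29) 7 (-2); zv (-29) (-3) (-3); zv (-15) (-11) 22;
    zv (-13) (-2) 27; zv (-2) (-1) 29; zv 5 24 16; zv 12 26 2; zv (-2) 28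
    (-10); zv (-11) 23 (-15); zv (-17) 15 (-18); zv (-23) (-2) (-17); zv (-26)
    (-14) (-3); zv (-22) (-18) 7; zv (-16) (-19) 15; zv 0 (-16) 24; zv 8 0 28;
    zv 11 10 25; zv 13 18 19; zv 21 17 11; zv 7 25 (-13); zv (-14) 8 (-25)]
   [:: [:: 0; 3; 2; 1]; [:: 0; 5; 4; 3]; [:: 0; 1; 6; 5]; [:: 7; 1; 2; 8]; [::
    10; 9; 2; 3]; [:: 10; 3; 4; 11]; [:: 13; 12; 4; 5]; [:: 13; 5; 6; 14]; [::
    7; 15; 6; 1]; [:: 7; 8; 16; 15]; [:: 17; 8; 2; 18]; [:: 19; 18; 2; 9]; [::
    10; 11; 20; 9]; [:: 21; 11; 4; 22]; [:: 23; 22; 4; 12]; [:: 13; 14; 24;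
    12]; [:: 25; 14; 6; 26]; [:: 27; 26; 6; 15]; [:: 27; 15; 16; 28]; [:: 17;
    29; 16; 8]; [:: 17; 18; 24; 29]; [:: 19; 30; 24; 18]; [:: 19; 9; 20; 30];
    [:: 21; 28; 20; 11]; [:: 21; 22; 16; 28]; [:: 23; 29; 16; 22]; [:: 23; 12;
    24; 29]; [:: 25; 30; 24; 14]; [:: 25; 26; 20; 30]; [:: 27; 28; 20; 26]].

Definition hemi_truncated_icosidodecahedral := signed_map_data 59
   [:: [:: 0; 2; 10; 4]; [:: 0; 4; 12; 26; 14; 6]; [:: 0; 6; 16; 30; 48; 50;
    32; 18; 8; 2]; [:: 2; 8; 20; 36; 22; 10]; [:: 4; 10; 22; 38; 58; 82; 60;
    40; 24; 12]; [:: 6; 14; 28; 16]; [:: 8; 18; 34; 20]; [:: 12; 24; 42; 26];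
    [:: 14; 26; 42; 64; 88; 112; 90; 66; 44; 28]; [:: 16; 28; 44; 68; 46; 30];
    [:: 18; 32; 52; 74; 54; 34]; [:: 20; 34; 54; 76; 100; 115; 102; 78; 56;
    36]; [:: 22; 36; 56; 38]; [:: 24; 40; 62; 86; 64; 42]; [:: 30; 46; 70;
    48]; [:: 32; 50; 72; 52]; [:: 38; 56; 78; 104; 80; 58]; [:: 40; 60; 84;
    62]; [:: 44; 66; 92; 68]; [:: 46; 68; 92; 116; 105; 81; 107; 118; 94; 70];
    [:: 48; 70; 94; 96; 72; 50]; [:: 52; 72; 96; 109; 85; 63; 87; 111; 98;
    74]; [:: 54; 74; 98; 76]; [:: 58; 80; 106; 82]; [:: 60; 82; 106; 119; 108;
    84]; [:: 64; 86; 110; 88]; [:: 66; 90; 114; 103; 116; 92]; [:: 76; 98;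
    111; 89; 113; 100]; [:: 78; 102; 117; 104]; [:: 90; 112; 101; 114]; [::
    94; 118; 109; 96]]
   [:: zv (-42) (-14) (-23); zv (-40) (-3) (-29); zv (-34) (-20) (-31); zv
    (-45) (-19) (-11); zv (-40) 10 (-28); zv (-32) (-9) (-37); zv (-28) (-32)
    (-27); zv (-39) (-30) (-7); zv (-47) (-16) 2; zv (-41) 20 (-20); zv (-31)
    17 (-35); zv (-23) (-2) (-44); zv (-17) (-38) (-27); zv (-31) (-37) (-15);
    zv (-42) (-27) 6; zv (-49) (-6) 10; zv (-44) 23 (-7); zv (-32) 27 (-27);
    zv (-23) 11 (-43); zv (-11) (-2) (-49); zv (-5) (-38) (-32); zv (-19)
    (-43) (-15); zv (-37) (-28) 18; zv (-44) (-7) 22; zv (-48) 7 11; zv (-46)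
    18 5; zv (-37) 33 (-2); zv (-26) 37 (-21); zv (-10) 11 (-48); zv 0 (-9)
    (-49); zv 4 (-31) (-39); zv 5 (-43) (-24); zv (-10) (-48) (-8); zv (-27)
    (-33) 25; zv (-38) (-18) 26; zv (-44) 6 24; zv (-40) 28 10; zv (-29) 40
    (-9); zv (-15) 43 (-20); zv 1 17 (-47); zv 12 (-3) (-48); zv 6 (-20)
    (-45); zv 14 (-36) (-31); zv 3 (-48) (-13); zv (-5) (-50) 4; zv (-16)
    (-40) 25; zv (-29) (-23) 34; zv (-37) 16 29; zv (-35) 27 23; zv (-17) 46
    (-8); zv (-2) 43 (-25); zv 7 27 (-41); zv 12 10 (-47); zv 18 (-14) (-45);
    zv 26 (-30) (-31); zv 7 (-49) 0; zv (-8) (-46) 17; zv (-6) (-37) 33; zv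
    (-19) (-20) 42; zv (-27) 19 37]
   [:: zv (-38) (-12) (-30); zv (-38) (-26) (-19); zv (-48) 2 (-10); zv (-33)
    4 (-37); zv (-15) (-22) (-41); zv (-44) (-24) (-3); zv (-37) 19 (-28); zv
    (-24) (-38) (-21); zv (-25) (-42) 5; zv (-44) (-18) 14; zv (-36) 31 (-15);
    zv (-14) 29 (-37); zv (-17) 4 (-47); zv (-7) (-45) (-20); zv (-47) 0 17;
    zv (-42) 26 2; zv 1 4 (-49); zv 5 (-38) (-32); zv (-33) (-26) 26; zv (-30)
    (-2) 39; zv (-43) 18 17; zv (-23) 42 12; zv (-22) 42 (-15); zv 9 (-12)
    (-48); zv 16 (-26) (-39); zv (-1) (-50) (-4); zv (-18) (-31) 34; zv (-5)
    48 (-13); zv 10 19 (-45); zv (-7) (-42) 25; zv (-32) 23 30]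
   [:: [:: 0; 1; 2]; [:: 0; 3; 2]; [:: 0; 1; 4]; [:: 5; 1; 2]; [:: 6; 3; 2];
    [:: 0; 3; 4]; [:: 7; 1; 4]; [:: 5; 1; 8]; [:: 5; 9; 2]; [:: 6; 10; 2]; [::
    6; 3; 11]; [:: 12; 3; 4]; [:: 7; 13; 4]; [:: 7; 1; 8]; [:: 5; 9; 8]; [::
    14; 9; 2]; [:: 15; 10; 2]; [:: 6; 10; 11]; [:: 12; 3; 11]; [:: 12; 16; 4];
    [:: 17; 13; 4]; [:: 7; 13; 8]; [:: 18; 9; 8]; [:: 14; 9; 19]; [:: 14; 20;
    2]; [:: 15; 20; 2]; [:: 15; 10; 21]; [:: 22; 10; 11]; [:: 12; 16; 11]; [::
    23; 16; 4]; [:: 17; 24; 4]; [:: 17; 13; 21]; [:: 25; 13; 8]; [:: 18; 26;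
    8]; [:: 18; 9; 19]; [:: 14; 20; 19]; [:: 15; 20; 21]; [:: 22; 10; 21]; [::
    22; 27; 11]; [:: 28; 16; 11]; [:: 23; 16; 19]; [:: 23; 24; 4]; [:: 17; 24;
    21]; [:: 25; 13; 21]; [:: 25; 27; 8]; [:: 29; 26; 8]; [:: 18; 26; 19]; [::
    30; 20; 19]; [:: 30; 20; 21]; [:: 22; 27; 21]; [:: 29; 27; 11]; [:: 28;
    26; 11]; [:: 28; 16; 19]; [:: 23; 24; 19]; [:: 30; 24; 21]; [:: 25; 27;
    21]; [:: 29; 27; 8]; [:: 29; 26; 11]; [:: 28; 26; 19]; [:: 30; 24; 19]].

Definition hemi_truncated_dodecahedral := signed_map_data 29
   [:: [:: 0; 2; 4]; [:: 0; 4; 10; 22; 34; 58; 36; 24; 12; 6]; [:: 0; 6; 14;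
    26; 42; 44; 28; 16; 8; 2]; [:: 2; 8; 18; 30; 50; 52; 32; 20; 10; 4]; [::
    6; 12; 14]; [:: 8; 16; 18]; [:: 10; 20; 22]; [:: 12; 24; 38; 49; 51; 53;
    55; 40; 26; 14]; [:: 16; 28; 46; 57; 59; 37; 39; 48; 30; 18]; [:: 20; 32;
    54; 41; 43; 45; 47; 56; 34; 22]; [:: 24; 36; 38]; [:: 26; 40; 42]; [:: 28;
    44; 46]; [:: 30; 48; 50]; [:: 32; 52; 54]; [:: 34; 56; 58]]
   [:: zv 25 (-15) 7; zv 20 (-22) 1; zv 26 (-15) (-3); zv 24 (-9) 15; zv 11
    (-28) 1; zv 26 (-9) (-11); zv 24 0 18; zv 18 (-7) 23; zv 3 (-29) 5; zv 3
    (-29) (-5); zv 21 (-7) (-20); zv 26 0 (-15); zv 24 10 15; zv 10 (-8) 27;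
    zv (-3) (-27) 13; zv (-2) (-27) (-13); zv 13 (-8) (-26); zv 26 10 (-12);
    zv 25 16 7; zv 19 18 15; zv 1 (-4) 30; zv 1 (-14) 27; zv (-4) (-21) 21; zv
    (-12) (-23) 16; zv (-10) (-23) (-17); zv (-1) (-21) (-22); zv 5 (-14)
    (-26); zv 5 (-4) (-29); zv 21 18 (-12); zv 25 16 (-3)]
   [:: zv 24 (-18) 2; zv 29 0 2; zv 12 (-21) 16; zv 14 (-21) (-14); zv 23 (-5)
    19; zv 6 (-29) 0; zv 25 (-5) (-16); zv 11 8 25; zv (-13) (-26) (-1); zv 14
    8 (-24); zv 23 15 12; zv 4 (-9) 28; zv (-7) (-24) 17; zv (-4) (-24) (-18);
    zv 8 (-9) (-27); zv 24 15 (-9)]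
   [:: [:: 0; 2; 1]; [:: 0; 3; 2]; [:: 0; 1; 3]; [:: 4; 1; 2]; [:: 5; 2; 3];
    [:: 6; 3; 1]; [:: 4; 7; 1]; [:: 4; 2; 7]; [:: 5; 8; 2]; [:: 5; 3; 8]; [::
    6; 9; 3]; [:: 6; 1; 9]; [:: 10; 1; 7]; [:: 11; 7; 2]; [:: 12; 2; 8]; [::
    13; 8; 3]; [:: 14; 3; 9]; [:: 15; 9; 1]; [:: 10; 8; 1]; [:: 10; 7; 8]; [::
    11; 9; 7]; [:: 11; 2; 9]; [:: 12; 9; 2]; [:: 12; 8; 9]; [:: 13; 7; 8]; [::
    13; 3; 7]; [:: 14; 7; 3]; [:: 14; 9; 7]; [:: 15; 8; 9]; [:: 15; 1; 8]].

Definition hemi_truncated_icosahedral := signed_map_data 29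
   [:: [:: 0; 2; 10; 12; 4]; [:: 0; 4; 14; 30; 16; 6]; [:: 0; 6; 18; 20; 8;
    2]; [:: 2; 8; 22; 40; 24; 10]; [:: 4; 12; 26; 46; 28; 14]; [:: 6; 16; 32;
    34; 18]; [:: 8; 20; 36; 38; 22]; [:: 10; 24; 42; 44; 26; 12]; [:: 14; 28;
    48; 50; 30]; [:: 16; 30; 50; 59; 52; 32]; [:: 18; 34; 54; 56; 36; 20]; [::
    22; 38; 49; 51; 58; 40]; [:: 24; 40; 58; 53; 42]; [:: 26; 44; 55; 57; 46];
    [:: 28; 46; 57; 37; 39; 48]; [:: 32; 52; 43; 45; 54; 34]]
   [:: zv (-13) (-9) 4; zv (-13) (-4) 9; zv (-15) (-6) (-1); zv (-8) (-13) 5;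
    zv (-8) (-4) 13; zv (-15) 1 6; zv (-16) 0 0; zv (-12) (-8) (-7); zv (-5)
    (-15) (-1); zv (-3) (-13) 9; zv (-3) (-8) 13; zv (-5) 2 15; zv (-12) 7 8;
    zv (-15) 4 (-5); zv (-11) (-4) (-11); zv (-7) (-13) (-7); zv 1 (-16) 0; zv
    2 (-15) 6; zv 2 (-5) 15; zv 1 1 16; zv (-7) 7 12; zv (-11) 11 3; zv (-12)
    10 (-3); zv (-12) 2 (-10); zv (-5) (-6) (-14); zv (-3) (-11) (-11); zv 5
    (-14) (-5); zv 8 (-12) 8; zv 8 (-7) 12; zv (-3) 12 10]
   [:: zv (-15) (-4) 4; zv (-11) (-12) (-1); zv (-9) (-9) 10; zv (-11) 2 11;
    zv (-15) (-2) (-6); zv (-3) (-15) 4; zv (-3) (-3) 15; zv (-15) 6 2; zv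
    (-8) (-9) (-11); zv (-1) (-15) (-6); zv 2 (-11) 12; zv (-1) 7 14; zv (-8)
    11 8; zv (-11) 8 (-8); zv (-7) 1 (-14); zv 7 (-14) 2]
   [:: [:: 0; 2; 1]; [:: 0; 3; 2]; [:: 0; 1; 4]; [:: 5; 1; 2]; [:: 6; 2; 3];
    [:: 0; 7; 3]; [:: 0; 4; 7]; [:: 8; 4; 1]; [:: 5; 9; 1]; [:: 5; 2; 10]; [::
    6; 10; 2]; [:: 6; 3; 11]; [:: 12; 3; 7]; [:: 13; 7; 4]; [:: 8; 14; 4]; [::
    8; 1; 9]; [:: 5; 15; 9]; [:: 5; 10; 15]; [:: 6; 14; 10]; [:: 6; 11; 14];
    [:: 12; 11; 3]; [:: 12; 7; 15]; [:: 13; 15; 7]; [:: 13; 4; 14]; [:: 8; 11;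
    14]; [:: 8; 9; 11]; [:: 12; 9; 15]; [:: 13; 15; 10]; [:: 13; 10; 14]; [::
    12; 9; 11]].

Definition hemi_maps : seq (vtype * map_data) :=
  [:: ([:: (5, 3)], hemi_dodecahedral);
      ([:: (3, 5)], hemi_icosahedral);
      ([:: (4, 1); (6, 2)], hemi_truncated_octahedral);
      ([:: (3, 1); (5, 1); (3, 1); (5, 1)], hemi_icosidodecahedral);
      ([:: (3, 1); (4, 3)], hemi_rhombicuboctahedral);
      ([:: (4, 1); (6, 1); (8, 1)], hemi_truncated_cuboctahedral);
      ([:: (3, 1); (4, 1); (5, 1); (4, 1)], hemi_rhombicosidodecahedral);
      ([:: (4, 1); (6, 1); (10, 1)], hemi_truncated_icosidodecahedral);
      ([:: (3, 1); (10, 2)], hemi_truncated_dodecahedral);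
      ([:: (5, 1); (6, 2)], hemi_truncated_icosahedral)].

Lemma hemi_maps_check :
  all (fun x => proper_vtype x.1 && md_check x.2 (Defs.expand x.1)) hemi_maps.
Proof. by vm_compute. Qed.

End Examples.

(** * Existence, and the Euler characteristic of the projective plane *)

Section ProjectivePlaneMaps.
Variable R : realType.

Lemma homeomorphic_sym (S T : topologicalType) : homeomorphic S T -> homeomorphic T S.
Proof. by case=> f [g [cf cg fg gf]]; exists g, f. Qed.

Lemma homeomorphic_trans (S T U : topologicalType) :
  homeomorphic S T -> homeomorphic T U -> homeomorphic S U.
Proof.
case=> f [g [cf cg fg gf]] [f' [g' [cf' cg' fg' gf']]].
exists (f' \o f), (g \o g'); split.
- by move=> x; apply: continuous_comp; [exact: cf|exact: cf'].
- by move=> x; apply: continuous_comp; [exact: cg'|exact: cg].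
- by move=> x /=; rewrite fg' fg.
- by move=> x /=; rewrite gf gf'.
Qed.

Lemma md_map_on d t : md_check d (Defs.expand t) -> proper_vtype t ->
  map_on R (RP2 R) (md_map d) /\ semi_equivelar (md_map d) t.
Proof.
move=> hc ht; have hwf := proj1 (andP hc).
have pY := md_polyhedral hwf hc; split; last exact: md_semi_equivelar.
split=> //; apply: (md_homeomorphic R hc).
have [f uf] := vert_face pY (ord0 : 'I_(md_top d).+1).
by exists (f, (ord0 : 'I_(md_top d).+1), next (bnd f) ord0); exact: edge_of_next.
Qed.

Lemma hemi_map_exists s : s \in map fst hemi_maps ->
  exists Y, map_on R (RP2 R) Y /\ semi_equivelar Y s.
Proof.
move: hemi_maps_check; elim: hemi_maps => //= -[t d] l IH.
move=> /andP[/andP[pt hc] hl]; rewrite inE => /predU1P[->|]; last exact: IH.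
by exists (md_map d); exact: md_map_on.
Qed.

(** The six vertices of the hemi-icosahedron are pairwise adjacent, so each lies in a face with
    vertex 0. *)
Lemma hemi_icosahedral_connected : incidence_connected (md_map hemi_icosahedral).
Proof.
have hc : md_check hemi_icosahedral (Defs.expand [:: (3, 5)%nat]) by vm_compute.
have hwf := proj1 (andP hc); have pY := md_polyhedral hwf hc.
have h u : exists f : face (md_map hemi_icosahedral),
    (u \in bnd f) && ((ord0 : 'I_6) \in bnd f).
  have : all (fun u => has (fun f => (u \in md_face hemi_icosahedral f) &&
    (0%nat \in md_face hemi_icosahedral f)) (iota 0 10)) (iota 0 6) by vm_compute.
  move=> /allP/(_ (val u)); rewrite mem_iota ltn_ord => /(_ isT)/hasP[f].
  rewrite mem_iota => fm uf; exists (Ordinal (fm : (f < 10)%nat)).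
  by rewrite !(md_mem hwf).
move=> S hS p q.
have A r : S r = S (inl (ord0 : 'I_6)).
  case: r => [u|f].
    by have [f /andP[uf zf]] := h u; rewrite (hS f u uf) (hS f _ zf).
  have [u uf] := face_vert pY f; rewrite -(hS f u uf).
  by have [g /andP[ug zg]] := h u; rewrite (hS g u ug) (hS g _ zg).
by rewrite !A.
Qed.

Lemma hemi_icosahedral_edges : #|{: edge (md_map hemi_icosahedral)}| = 15%nat.
Proof.
have hc : md_check hemi_icosahedral (Defs.expand [:: (3, 5)%nat]) by vm_compute.
have hwf := proj1 (andP hc); have pY := md_polyhedral hwf hc.
have := card_corner pY; rewrite (card_corner_sum pY).
rewrite (eq_bigr (fun f : 'I_10 => size (md_face hemi_icosahedral f))); last first.
  by move=> f _; rewrite -(md_bnd hwf) size_map.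
rewrite -(big_mkord xpredT (fun f => size (md_face hemi_icosahedral f))).
rewrite (_ : \sum_(0 <= f < 10) _ = 30)%nat; last by rewrite unlock.
by move: #|_| => e; lia.
Qed.

(** Every map is compared with the hemi-icosahedron, which has 6 vertices, 15 edges and 10 faces and
    is already realized on the projective plane. *)
Theorem RP2_euler (Y : cellmap) : map_on R (RP2 R) Y ->
  [/\ incidence_connected Y, inhabited (vert Y) &
   (#|vert Y| + #|face Y|)%nat = #|{: edge Y}|.+1].
Proof.
move=> [pY hY].
have hc : md_check hemi_icosahedral (Defs.expand [:: (3, 5)%nat]) by vm_compute.
have [[pI hI] _] := md_map_on hc isT.
have p0 : vert (md_map hemi_icosahedral) + face (md_map hemi_icosahedral).
  by left; exact: (ord0 : 'I_6).
have hYI := homeomorphic_trans hI (homeomorphic_sym hY).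
have [u0] : inhabited (vert Y).
  have [f uf] := vert_face pI (ord0 : 'I_6).
  have Xf : realization R (md_map hemi_icosahedral) (corner_pt R (inr f)).
    apply: (simplex_realization (edge_of_next uf)); apply: corner_simplex.
    by rewrite !inE eqxx !orbT.
  have [h _] := hYI.
  have /realizationP[g [u _]] := set_type_in (h (in_set_type Xf)).
  by constructor.
have [cY E] := euler_invariance pI pY hemi_icosahedral_connected p0 (inl u0) hYI.
split; [exact: cY|exact: (inhabits u0)|].
by move: E; rewrite hemi_icosahedral_edges !card_sum !card_ord /=; lia.
Qed.

End ProjectivePlaneMaps.

(** * Flags *)

Section Flags.
Local Open Scope nat_scope.
Variable Y : cellmap.
Hypothesis pY : polyhedral_map Y.
Implicit Types (u v : vert Y) (f g : face Y).

(** The second component is the other end of the edge. The three operations below are total on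
    triples, but are meaningful, and involutive, on those satisfying [is_flag]. *)
Definition flag : Type := vert Y * vert Y * face Y.
HB.instance Definition _ := Finite.on flag.
Implicit Types x y : flag.

Definition fvert x : vert Y := x.1.1.
Definition fend x : vert Y := x.1.2.
Definition fface x : face Y := x.2.
Definition is_flag x := edge_of (fface x) (fvert x) (fend x).
Definition fsize x := size (bnd (fface x)).

Definition flag0 x : flag := (fend x, fvert x, fface x).
Definition flag1 x : flag :=
  (fvert x,
   if fend x == next (bnd (fface x)) (fvert x) then prev (bnd (fface x)) (fvert x)
   else next (bnd (fface x)) (fvert x),
   fface x).
Definition flag2 x : flag :=
  (fvert x, fend x,
   odflt (fface x) [pick g | (g != fface x) && edge_of g (fvert x) (fend x)]).
(** The rotation about the vertex that takes a flag to the next face of the face-cycle. *)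
Definition rho x := flag2 (flag1 x).

Lemma flag0_flag x : is_flag x -> is_flag (flag0 x).
Proof. by rewrite /is_flag /= (edge_of_sym pY). Qed.

Lemma flag1_flag x : is_flag x -> is_flag (flag1 x).
Proof.
rewrite /is_flag /= => /edge_ofl uf; rewrite /fend /=.
by case: ifP => _; [exact: edge_of_prev|exact: edge_of_next].
Qed.

Lemma flag2P x : is_flag x ->
  is_flag (flag2 x) /\ fface (flag2 x) != fface x.
Proof.
rewrite /is_flag /flag2 /fface /fvert /fend /= => e; case: pickP => [g /andP[]//|h].
by have [g gf eg] := other_face pY e; have := h g; rewrite gf eg.
Qed.

Lemma flag2_flag x : is_flag x -> is_flag (flag2 x).
Proof. by case/flag2P. Qed.

Lemma rho_flag x : is_flag x -> is_flag (rho x).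
Proof. by move=> fx; apply/flag2_flag/flag1_flag. Qed.

Lemma flag0K x : flag0 (flag0 x) = x.
Proof. by case: x => -[]. Qed.

Lemma flag1K x : is_flag x -> flag1 (flag1 x) = x.
Proof.
case: x => -[u v] f; rewrite /is_flag /flag1 /fvert /fend /fface /= => e.
have uf := edge_ofl e.
have np := next_neq_prev (bnd_uniq pY f) uf (bnd_size pY f).
case/andP: e => _ /orP[] /eqP ->; first by rewrite eqxx eq_sym (negPf np).
by rewrite [prev _ _ == _]eq_sym (negPf np) eqxx.
Qed.

Lemma flag2_uniq x y : is_flag x -> is_flag y -> fvert x = fvert y ->
  fend x = fend y -> fface y != fface x -> y = flag2 x.
Proof.
move=> fx; have [f2 n2] := flag2P fx.
case: x y fx f2 n2 => -[u v] f [[u' v'] g]; rewrite /is_flag /fvert /fend /fface /=.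
move=> ef e2 n2 eg uu vv fg; rewrite -{}uu -{}vv in eg *.
rewrite /flag2 /fvert /fend /fface /=; congr (_, _, _).
have := edge_faces pY ef e2; rewrite eq_sym => /(_ n2 g); rewrite eg.
by move/esym; rewrite (negPf fg) /= => /eqP.
Qed.

Lemma flag2K x : is_flag x -> flag2 (flag2 x) = x.
Proof.
move=> fx; have [f2 n2] := flag2P fx; symmetry.
by apply: flag2_uniq => //; rewrite eq_sym.
Qed.

Lemma flag02 x : is_flag x -> flag0 (flag2 x) = flag2 (flag0 x).
Proof.
move=> fx; have [f2 n2] := flag2P fx; apply: flag2_uniq => //; exact: flag0_flag.
Qed.

Lemma fsize0 x : fsize (flag0 x) = fsize x. Proof. by []. Qed.
Lemma fsize1 x : fsize (flag1 x) = fsize x. Proof. by []. Qed.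
Lemma fvert1 x : fvert (flag1 x) = fvert x. Proof. by []. Qed.
Lemma fvert2 x : fvert (flag2 x) = fvert x. Proof. by []. Qed.

Lemma fend1 x : is_flag x -> fend (flag1 x) != fend x.
Proof.
case: x => -[u v] f; rewrite /is_flag /flag1 /fvert /fend /fface /= => e.
have np := next_neq_prev (bnd_uniq pY f) (edge_ofl e) (bnd_size pY f).
case: ifPn => [/eqP ->|]; first by rewrite eq_sym.
by rewrite eq_sym.
Qed.

Lemma same_corner x y : is_flag x -> is_flag y -> fvert x = fvert y ->
  fface x = fface y -> y = x \/ y = flag1 x.
Proof.
case: x y => -[u v] f [[u' v'] g]; rewrite /is_flag /flag1 /fvert /fend /fface /=.
move=> e e' uu fg; rewrite -{}uu -{}fg in e' *.
have np := next_neq_prev (bnd_uniq pY f) (edge_ofl e) (bnd_size pY f).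
case/andP: e => _ /orP[] /eqP ->; case/andP: e' => _ /orP[] /eqP ->;
  rewrite ?eqxx ?[prev _ _ == _]eq_sym ?(negPf np); by [left|right].
Qed.

Lemma iter_rho_flag x i : is_flag x -> is_flag (iter i rho x).
Proof. by move=> fx; elim: i => //= i; exact: rho_flag. Qed.

Lemma fvert_iter_rho x i : fvert (iter i rho x) = fvert x.
Proof. by elim: i. Qed.

Lemma rho_inj x y : is_flag x -> is_flag y -> rho x = rho y -> x = y.
Proof.
move=> fx fy h; rewrite -(flag1K fx) -(flag1K fy).
by rewrite -(flag2K (flag1_flag fx)) -(flag2K (flag1_flag fy)) -/(rho x) h.
Qed.

(* The step [flag0 \o flag1] moves to the preceding edge of the same face. *)
Definition face_step x := flag0 (flag1 x).

Lemma face_step_flag x : is_flag x -> is_flag (face_step x).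
Proof. by move=> fx; apply/flag0_flag/flag1_flag. Qed.

Lemma iter_face_step x k : is_flag x ->
  fface (iter k face_step x) = fface x /\
  ((forall j, iter j face_step x =
     (iter j (prev (bnd (fface x))) (fvert x), iter j (prev (bnd (fface x))) (fend x), fface x)) \/
   (forall j, iter j face_step x =
     (iter j (next (bnd (fface x))) (fvert x), iter j (next (bnd (fface x))) (fend x), fface x))).
Proof.
case: x => -[u v] f; rewrite /is_flag /fvert /fend /fface /= => e.
have uf := edge_ofl e; have ub := bnd_uniq pY f.
split; first by elim: k => //= k; rewrite /face_step.
have np w : w \in bnd f -> next (bnd f) w == prev (bnd f) w = false.
  by move=> wf; apply/negbTE/next_neq_prev => //; exact: bnd_size.
have pp j w : w \in bnd f -> iter j (prev (bnd f)) w \in bnd f.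
  by move=> wf; elim: j => //= j; rewrite mem_prev.
have nn j w : w \in bnd f -> iter j (next (bnd f)) w \in bnd f.
  by move=> wf; elim: j => //= j; rewrite mem_next.
case/andP: e => _ /orP[] /eqP ->; [left|right]; elim=> //= j ->.
  rewrite /face_step /flag0 /flag1 /fvert /fend /fface /=.
  have -> : iter j (prev (bnd f)) (next (bnd f) u) = next (bnd f) (iter j (prev (bnd f)) u).
    elim: j => //= j ->; rewrite prev_next // next_prev //.
  by rewrite eqxx prev_next.
rewrite /face_step /flag0 /flag1 /fvert /fend /fface /=.
have -> : iter j (next (bnd f)) (prev (bnd f) u) = prev (bnd f) (iter j (next (bnd f)) u).
  elim: j => //= j ->; rewrite prev_next // next_prev //.
by rewrite eq_sym np ?nn // next_prev.
Qed.

Lemma iter_prev_size (T : eqType) (s : seq T) w : uniq s -> w \in s ->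
  iter (size s) (prev s) w = w.
Proof.
move=> us ws; have K k z : iter k (prev s) (iter k (next s) z) = z.
  by elim: k z => // k IH z; rewrite iterSr iterS prev_next // IH.
by rewrite -[in LHS](iter_next_size us ws) K.
Qed.

Lemma iter_prev_eq (T : eqType) (s : seq T) w k : uniq s -> w \in s ->
  k < size s -> iter k (prev s) w = w -> k = 0.
Proof.
move=> us ws ks h; apply: (iter_next_eq us ws ks).
have K z : iter k (next s) (iter k (prev s) z) = z.
  by elim: k {ks h} z => // k IH z; rewrite iterSr iterS next_prev // IH.
by rewrite -[in LHS]h K.
Qed.

Lemma face_step_size x : is_flag x -> iter (fsize x) face_step x = x.
Proof.
move=> fx; have uf := edge_ofl fx; have vf := edge_ofr fx.
have ub := bnd_uniq pY (fface x).
have [_ [->|->]] := iter_face_step 0 fx.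
  by rewrite /fsize !iter_prev_size //; case: (x) => -[].
by rewrite /fsize !iter_next_size //; case: (x) => -[].
Qed.

Lemma face_step_vert x k : is_flag x -> k < fsize x ->
  fvert (iter k face_step x) = fvert x -> k = 0.
Proof.
move=> fx ks; have uf := edge_ofl fx; have ub := bnd_uniq pY (fface x).
have [_ [->|->]] := iter_face_step 0 fx; rewrite {1}/fvert /= => h.
  exact: iter_prev_eq ub uf ks h.
exact: iter_next_eq ub uf ks h.
Qed.

Lemma fsize_iter_face_step x k : is_flag x -> fsize (iter k face_step x) = fsize x.
Proof. by move=> fx; rewrite /fsize (proj1 (iter_face_step k fx)). Qed.

Lemma adjacent_flag u f g x : adjacent_at u f g -> is_flag x ->
  fvert x = u -> fface x = f ->
  g = fface (flag2 x) \/ g = fface (flag2 (flag1 x)).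
Proof.
move=> /andP[fg /existsP[w /andP[ef eg]]] fx xu xf.
pose y : flag := (u, w, f); pose z : flag := (u, w, g).
have fy : is_flag y by []. have fz : is_flag z by [].
have zy : z = flag2 y by apply: flag2_uniq => //; rewrite eq_sym.
have [yx|yx] := same_corner fx fy xu xf; [left|right]; by rewrite -yx -zy.
Qed.

(** With only two faces at [u], both would contain [u] and its two neighbours, three common vertices
    against [faces_meet_properly]. A single face would be adjacent to itself. *)
Lemma face_cycle_size u c : face_cycle u c -> 2 < size c.
Proof.
case=> uc mc; have [f uf] := vert_face pY u.
case: c uc mc => [_ /(_ f)|h [|k [|//]]]; first by rewrite uf.
  by move=> _ _ /=; rewrite andbT /adjacent_at eqxx.
move=> uhk mc _; have uh : u \in bnd h by rewrite -mc mem_head.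
have uk : u \in bnd k by rewrite -mc !inE eqxx orbT.
have hk : h != k by move: uhk; rewrite /= inE andbT.
have K v : edge_of h u v -> v \in bnd k.
  move=> e; have [g gh eg] := other_face pY e.
  have : g \in [:: h; k] by rewrite mc; exact: edge_ofl eg.
  rewrite !inE (negPf gh) /= => /eqP gk; rewrite gk in eg; exact: edge_ofr eg.
have sub : {subset [:: u; next (bnd h) u; prev (bnd h) u] <= common_vertices h k}.
  move=> v; rewrite !inE => /or3P[] /eqP ->.
  - by rewrite uh uk.
  - by rewrite mem_next uh K ?edge_of_next.
  - by rewrite mem_prev uh K ?edge_of_prev.
have un : uniq [:: u; next (bnd h) u; prev (bnd h) u].
  have np := next_neq_prev (bnd_uniq pY h) uh (bnd_size pY h).
  have nn := edge_of_neq pY (edge_of_next uh).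
  have pp := edge_of_neq pY (edge_of_prev uh).
  by rewrite /= !inE negb_or nn pp np.
have c3 : 3 <= #|common_vertices h k|.
  rewrite (_ : 3 = #|[:: u; next (bnd h) u; prev (bnd h) u]|); last by rewrite (card_uniqP un).
  exact/subset_leq_card/fintype.subsetP.
have : faces_meet_properly h k by case: pY => _ _ meet _ _; exact: meet.
case=> [E|[v E]|[v [w [_ _ E]]]]; move: c3; rewrite E.
- by rewrite cards0.
- by rewrite cards1.
- by rewrite cards2; case: (_ != _).
Qed.

(** Adjacency of faces at [u] is symmetric, whereas [rho] has a direction; the initial flag is
    oriented so that iterating [rho] runs through [c] forwards. *)
Lemma face_cycle_flag u c : face_cycle u c ->
  exists x, [/\ is_flag x, fvert x = u, iter (size c) rho x = x &
    forall i, fface (iter i rho x) = nth (fface x) c (i %% size c)].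
Proof.
move=> fc; have c3 := face_cycle_size fc; case: fc => uc mc cyc.
have [f0 f0c] : exists f0, f0 \in c.
  by case: (c) c3 => // f s _; exists f; rewrite mem_head.
pose C i := nth f0 c (i %% size c).
have c0 : 0 < size c by exact: ltn_trans c3.
have Cin i : C i \in c by rewrite mem_nth // ltn_pmod.
have Cadj i : adjacent_at u (C i) (C i.+1).
  have := next_cycle cyc (Cin i); rewrite next_nth_mod ?ltn_pmod //.
  by rewrite -[(_ %% _).+1]addn1 modnDml addn1.
(* A face has just two neighbours at [u]; excluding a step back forces the direction. *)
have C2 i : C i.+2 != C i.
  rewrite /C nth_uniq ?ltn_pmod // -[X in _ %% _ != X %% _]addn0 -addn2 eqn_modDl.
  by rewrite mod0n modn_small.
have /andP[_ /existsP[w /andP[e0 e1]]] := Cadj 0.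
pose x0 : flag := (u, w, C 0); have fx0 : is_flag x0 by [].
pose x := flag1 x0; have fx : is_flag x by exact: flag1_flag.
have fx1 : fface (rho x) = C 1.
  rewrite /rho /x flag1K //.
  have -> : flag2 x0 = (u, w, C 1) by symmetry; apply: flag2_uniq => //; case/andP: (Cadj 0); rewrite eq_sym.
  by [].
have H i : fface (iter i rho x) = C i /\ fface (iter i.+1 rho x) = C i.+1.
  elim: i => [|i [IH1 IH2]]; first by split.
  split=> //; have fi : is_flag (iter i rho x) by exact: iter_rho_flag.
  have fi1 : is_flag (iter i.+1 rho x) by exact: iter_rho_flag.
  have := adjacent_flag (Cadj i.+1) fi1 (fvert_iter_rho x i.+1) IH2.
  case=> [h|h]; last by rewrite iterS.
  case/eqP: (C2 i); rewrite h iterS /rho flag2K; last exact: flag1_flag.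
  by rewrite -IH1.
have H1 i : fface (iter i rho x) = C i by case: (H i).
exists x; split=> //; last first.
  by move=> i; rewrite H1 /C; apply: set_nth_default; rewrite ltn_pmod.
have fd : is_flag (iter (size c) rho x) by exact: iter_rho_flag.
have E0 : fface x = fface (iter (size c) rho x) by rewrite H1 (H1 0) /C modnn mod0n.
have [//|h] := same_corner fx fd (esym (fvert_iter_rho _ _)) E0.
have cp : (size c).-1.+1 = size c by rewrite prednK.
have : fface (flag2 (flag1 x)) = C (size c).-1.
  rewrite -h -cp iterS /rho flag2K -?H1 //.
  by apply: flag1_flag; exact: iter_rho_flag.
rewrite -/(rho x) fx1 /C => /eqP; rewrite nth_uniq ?ltn_pmod //.
rewrite !modn_small ?cp //; last exact: ltn_trans c3.
by move=> /eqP h1; move: c3; rewrite -cp -h1.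
Qed.

End Flags.

(** * The dihedral action on the flags of a vertex *)

Section Patterns.
Local Open Scope nat_scope.

Definition rot_pattern (p : seq nat) k :=
  mkseq (fun i => nth 0 p ((k + i) %% size p)) (size p).
Definition ref_pattern (p : seq nat) k :=
  mkseq (fun i => nth 0 p ((k + size p - i) %% size p)) (size p).
Definition dihedral_patterns (p : seq nat) :=
  undup (map (rot_pattern p) (iota 0 (size p)) ++ map (ref_pattern p) (iota 0 (size p))).

Variable Y : cellmap.
Hypothesis pY : polyhedral_map Y.
Variable p : seq nat.
Let d := size p.
Hypothesis hp : forall u : vert Y,
  exists c, face_cycle u c /\ [seq size (bnd f) | f <- c] = p.
Implicit Types x y : flag Y.

Lemma vertex_flag (u : vert Y) : exists x, [/\ is_flag x, fvert x = u,
  iter d (@rho Y) x = x,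
  forall i, fsize (iter i (@rho Y) x) = nth 0 p (i %% d) &
  (forall f : face Y, u \in bnd f -> exists2 i, i < d & f = fface (iter i (@rho Y) x)) /\
  (forall i j, i < d -> j < d ->
     fface (iter i (@rho Y) x) = fface (iter j (@rho Y) x) -> i = j)].
Proof.
have [c [fc hc]] := hp u; have [x [fx xu xd hx]] := face_cycle_flag pY fc.
have dE : size c = d by rewrite /d -hc size_map.
have c0 : 0 < size c by exact: ltn_trans (face_cycle_size pY fc).
have [uc mc _] := fc.
exists x; split=> //; first by rewrite -dE.
  move=> i; rewrite /fsize hx -hc -dE (nth_map (fface x)) //.
  by rewrite ltn_pmod.
split=> [f uf|i j id jd].
  have fin : f \in c by rewrite mc.
  exists (index f c); first by rewrite -dE index_mem.
  by rewrite hx modn_small ?index_mem // nth_index.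
rewrite !hx !modn_small ?dE // => /eqP; rewrite nth_uniq ?dE // => /eqP.
by [].
Qed.

Lemma pattern_size (u : vert Y) : 2 < d.
Proof.
have [c [fc hc]] := hp u.
by rewrite /d -hc size_map; exact: face_cycle_size pY _ _ fc.
Qed.

Lemma rho_flag2_rho x : is_flag x -> rho (flag2 (rho x)) = flag2 x.
Proof.
by move=> fx; rewrite /rho flag2K ?flag1K //; exact: flag1_flag.
Qed.

(** The dihedral relation: the reflection [flag2] conjugates [rho] to its inverse. *)
Lemma iter_rho_flag2 m x : is_flag x ->
  iter m (@rho Y) (flag2 (iter m (@rho Y) x)) = flag2 x.
Proof.
move=> fx; elim: m => // m IH; rewrite iterSr iterS rho_flag2_rho //.
exact: iter_rho_flag.
Qed.

Lemma iter_rho_inj m x y : is_flag x -> is_flag y ->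
  iter m (@rho Y) x = iter m (@rho Y) y -> x = y.
Proof.
move=> fx fy; elim: m => //= m IH /(rho_inj pY) h; apply/IH/h; exact: iter_rho_flag.
Qed.

(** Halving the rotation moves the equation to the middle flag, where [flag2] (for [i] even) or
    [flag1] (for [i] odd) would have a fixed point. *)
Lemma iter_rho_neq_flag2 i x : is_flag x -> iter i (@rho Y) x <> flag2 x.
Proof.
move=> fx; rewrite -(odd_double_half i); set m := i./2; case: (odd i).
  rewrite add1n -addnn -addnS iterD => h.
  have fy : is_flag (iter m.+1 (@rho Y) x) by exact: iter_rho_flag.
  set y := iter m.+1 (@rho Y) x in h fy.
  have E : rho (flag2 y) = y.
    apply: (@iter_rho_inj m) => //; first exact/rho_flag/flag2_flag.
    by rewrite -iterSr iter_rho_flag2 // h.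
  have f2 := flag2_flag pY fy.
  have E2 : flag1 (flag2 y) = flag2 y.
    by rewrite -[in RHS]E /rho flag2K //; exact: flag1_flag.
  by have := fend1 pY f2; rewrite E2 eqxx.
rewrite add0n -addnn iterD => h.
have fy : is_flag (iter m (@rho Y) x) by exact: iter_rho_flag.
have E : flag2 (iter m (@rho Y) x) = iter m (@rho Y) x.
  by apply: (@iter_rho_inj m); [exact: flag2_flag| |rewrite iter_rho_flag2 // h].
by have [_] := flag2P pY fy; rewrite E eqxx.
Qed.

Lemma flag_cover u x y : is_flag x -> is_flag y -> fvert y = u -> fvert x = u ->
  (forall f : face Y, u \in bnd f -> exists2 i, i < d & f = fface (iter i (@rho Y) x)) ->
  iter d (@rho Y) x = x ->
  exists k, y = iter k (@rho Y) x \/ y = flag2 (iter k.+1 (@rho Y) x).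
Proof.
move=> fx fy yu xu hx hd.
have uy : u \in bnd (fface y) by rewrite -yu; exact: edge_ofl fy.
have [i id hi] := hx _ uy.
have fi : is_flag (iter i (@rho Y) x) by exact: iter_rho_flag.
have E : fvert (iter i (@rho Y) x) = fvert y by rewrite fvert_iter_rho xu yu.
exists i; case: (same_corner pY fi fy E (esym hi)) => ->; [by left|right].
by rewrite iterS /rho flag2K //; exact: flag1_flag.
Qed.

(** The vertex type supplies one well-placed flag per vertex. Any other flag there is a rotation of
    it or the reflection of a rotation, and so sees [p] rotated or reversed. *)
Lemma flag_pattern x : is_flag x ->
  [/\ iter d (@rho Y) x = x, (forall i, i < d -> iter i (@rho Y) x = x -> i = 0)
   & mkseq (fun i => fsize (iter i (@rho Y) x)) d \in dihedral_patterns p].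
Proof.
move=> fx; have [w [fw wu wd ws [wf wi]]] := vertex_flag (fvert x).
have d0 : 0 < d by exact: ltn_trans (pattern_size (fvert x)).
have per k : iter (k %% d) (@rho Y) w = iter k (@rho Y) w.
  rewrite [in RHS](divn_eq k d) addnC iterD; congr iter.
  by elim: (k %/ d) => // m IH; rewrite mulSn iterD -IH wd.
have w0 i : iter i (@rho Y) w = w -> i %% d = 0.
  by move=> h; apply: wi; rewrite ?ltn_pmod // per h.
have [k [xE|xE]] := flag_cover fw fx (erefl _) wu wf wd; rewrite {}xE; split.
- by rewrite -iterD addnC iterD wd.
- move=> i id; rewrite -iterD addnC iterD => /(iter_rho_inj (iter_rho_flag pY _ fw) fw) h.
  by rewrite -(modn_small id) w0.
- rewrite mem_undup mem_cat; apply/orP; left.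
  apply/mapP; exists (k %% d); first by rewrite mem_iota ltn_pmod.
  rewrite /rot_pattern; apply/eq_in_map => i _.
  by rewrite -iterD ws addnC modnDml.
- have fk := iter_rho_flag pY k.+1 fw.
  have := iter_rho_flag2 d fk; rewrite -iterD addnC iterD wd; exact.
- move=> i id h.
  have fk := iter_rho_flag pY k.+1 fw.
  have := iter_rho_flag2 i fk; rewrite -[in RHS]h => E.
  have : iter i (@rho Y) (iter k.+1 (@rho Y) w) = iter k.+1 (@rho Y) w.
    have := iter_rho_inj (flag2_flag pY (iter_rho_flag pY i fk)) (flag2_flag pY fk) E.
    by move/(congr1 (@flag2 Y)); rewrite !flag2K //; exact: iter_rho_flag.
  rewrite -iterD addnC iterD => /(iter_rho_inj (iter_rho_flag pY _ fw) fw) h'.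
  by rewrite -(modn_small id) w0.
rewrite mem_undup mem_cat; apply/orP; right.
apply/mapP; exists (k %% d); first by rewrite mem_iota ltn_pmod.
rewrite /ref_pattern; apply/eq_in_map => i; rewrite mem_iota add0n => /andP[_ id].
pose m := k + d - i; have mi : m.+1 + i = k.+1 + d by rewrite /m; lia.
have -> : iter k.+1 (@rho Y) w = iter i (@rho Y) (iter m.+1 (@rho Y) w).
  by rewrite -iterD addnC mi iterD wd.
rewrite iter_rho_flag2; last exact: iter_rho_flag.
have -> : fsize (flag2 (iter m.+1 (@rho Y) w)) = fsize (iter m (@rho Y) w).
  by rewrite iterS /rho flag2K // ; apply: flag1_flag => //; exact: iter_rho_flag.
rewrite ws -/d /m -addnBA ?(ltnW id) // -[in RHS]addnBA ?(ltnW id) //.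
by rewrite modnDml.
Qed.

Lemma vertex_invariant (T : Type) (g : flag Y -> T) :
  (forall x, is_flag x -> g (flag1 x) = g x /\ g (flag2 x) = g x) ->
  forall x y, is_flag x -> is_flag y -> fvert x = fvert y -> g x = g y.
Proof.
move=> hg x y fx fy xy.
have grho i z : is_flag z -> g (iter i (@rho Y) z) = g z.
  move=> fz; elim: i => //= i IH; rewrite /rho.
  have fi := iter_rho_flag pY i fz.
  by rewrite (proj2 (hg _ (flag1_flag fi))) (proj1 (hg _ fi)).
have [w [fw wu wd ws [wf wi]]] := vertex_flag (fvert x).
suff A z : is_flag z -> fvert z = fvert x -> g z = g w by rewrite (A x) // (A y).
move=> fz zx; have [k [->|->]] := flag_cover fw fz zx wu wf wd; first exact: grho.
by rewrite (proj2 (hg _ (iter_rho_flag pY k.+1 fw))) grho.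
Qed.

Lemma face_invariant (T : Type) (g : flag Y -> T) :
  (forall x, is_flag x -> g (flag0 x) = g x /\ g (flag1 x) = g x) ->
  forall x y, is_flag x -> is_flag y -> fface x = fface y -> g x = g y.
Proof.
move=> hg x y fx fy xy; have ub := bnd_uniq pY (fface x).
pose a u := g (u, next (bnd (fface x)) u, fface x).
have fa u : u \in bnd (fface x) -> is_flag ((u, next (bnd (fface x)) u, fface x) : flag Y).
  exact: edge_of_next.
have astep u : u \in bnd (fface x) -> a (next (bnd (fface x)) u) = a u.
  move=> uf; rewrite /a; have [<- _] := hg _ (fa u uf).
  have fb := flag0_flag pY (fa u uf); have [_ <-] := hg _ fb.
  rewrite /flag0 /flag1 /fvert /fend /fface /=.
  have np := next_neq_prev (bnd_uniq pY x.2) (x := next (bnd x.2) u).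
  rewrite mem_next prev_next ?(bnd_uniq pY) // in np.
  by rewrite eq_sym (negPf (np uf (bnd_size pY _))).
have az z : is_flag z -> fface z = fface x -> g z = a (fvert z).
  move=> fz zx; have uz := edge_ofl fz.
  have fn : is_flag ((fvert z, next (bnd (fface x)) (fvert z), fface x) : flag Y).
    by apply: fa; rewrite -zx.
  case: (same_corner pY fn fz (erefl _) (esym zx)) => [-> //|->].
  by have [_ ->] := hg _ fn.
have ai i u : u \in bnd (fface x) -> a (iter i (next (bnd (fface x))) u) = a u.
  move=> uf; elim: i => //= i IH; rewrite astep ?IH //.
  by elim: i {IH} => //= i; rewrite mem_next.
rewrite (az x) // (az y) //.
have ux := edge_ofl fx; have uy : fvert y \in bnd (fface x) by rewrite xy; exact: edge_ofl fy.
have s0 : 0 < size (bnd (fface x)) by case: (bnd _) ux.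
have nz z : z \in bnd (fface x) -> a z = a (nth (fvert x) (bnd (fface x)) 0).
  move=> zf; rewrite -(ai (index z (bnd (fface x))) (nth _ _ 0)) ?mem_nth //.
  by rewrite iter_next_nth // add0n modn_small ?index_mem // nth_index.
by rewrite nz // [RHS]nz.
Qed.

(** An invariant function depends only on the vertex and also only on the face of a flag, so it is a
    colouring of cells to which [incidence_connected] applies. *)
Lemma flag_invariant_const (g : flag Y -> bool) :
  incidence_connected Y ->
  (forall x, is_flag x -> [/\ g (flag0 x) = g x, g (flag1 x) = g x & g (flag2 x) = g x]) ->
  forall x y, is_flag x -> is_flag y -> g x = g y.
Proof.
move=> cY hg.
have gv := vertex_invariant (fun x fx => let: And3 h0 h1 h2 := hg x fx in conj h1 h2).
have gf := face_invariant (fun x fx => let: And3 h0 h1 h2 := hg x fx in conj h0 h1).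
pose S (q : vert Y + face Y) := match q with
  | inl u => [exists x : flag Y, [&& is_flag x, fvert x == u & g x]]
  | inr f => [exists x : flag Y, [&& is_flag x, fface x == f & g x]] end.
have Sv x : is_flag x -> S (inl (fvert x)) = g x.
  move=> fx; apply/existsP/idP => [[y /and3P[fy /eqP yx gy]]|gx].
    by rewrite (gv x y).
  by exists x; rewrite fx eqxx.
have Sf x : is_flag x -> S (inr (fface x)) = g x.
  move=> fx; apply/existsP/idP => [[y /and3P[fy /eqP yx gy]]|gx].
    by rewrite (gf x y).
  by exists x; rewrite fx eqxx.
move=> x y fx fy; rewrite -Sv // -(Sv y) //; apply: cY => f u uf.
have fz : is_flag ((u, next (bnd f) u, f) : flag Y) by exact: edge_of_next.
exact: etrans (Sv _ fz) (esym (Sf _ fz)).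
Qed.

Lemma card_vertex_faces (u : vert Y) (h : nat -> nat) :
  \sum_(f | u \in bnd f) h (size (bnd f)) = \sum_(a <- p) h a.
Proof.
have [c [[uc mc _] hc]] := hp u.
rewrite -hc big_map big_uniq //=; apply: eq_bigl => f.
by rewrite mc.
Qed.

Lemma card_corner_vert : #|{: corner Y}| = size p * #|vert Y|.
Proof.
rewrite card_corner_sum //.
rewrite (eq_bigr (fun f => \sum_(u | u \in bnd f) 1)) => [|f _]; last first.
  by rewrite sum1_card; symmetry; exact: card_uniqP (bnd_uniq pY f).
rewrite (exchange_big_dep xpredT) //= (eq_bigr (fun _ => d)) => [|u _].
  by rewrite sum_nat_const mulnC.
by rewrite (card_vertex_faces u (fun _ => 1)) sum1_size.
Qed.

Lemma card_flags : #|[pred x : flag Y | is_flag x]| = 2 * (d * #|vert Y|).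
Proof.
rewrite -card_corner_vert card_corner_sum // big_distrr /=.
rewrite -sum1_card.
rewrite (eq_bigl (fun x : flag Y => (x.1 \in predT) && edge_of x.2 x.1.1 x.1.2)) //.
rewrite -(pair_big_dep xpredT (fun (e : vert Y * vert Y) f => edge_of f e.1 e.2)
  (fun _ _ => 1)) /=.
rewrite (exchange_big_dep xpredT) //=; apply: eq_bigr => f _.
rewrite -(pair_big_dep xpredT (fun u v => edge_of f u v) (fun _ _ => 1)) /=.
rewrite (bigID (fun u => u \in bnd f)) /= [X in _ + X]big1 ?addn0; last first.
  by move=> u uf; apply: big1 => v /edge_ofl; rewrite (negPf uf).
rewrite (eq_bigr (fun _ => 2)).
  by rewrite sum_nat_const (card_uniqP (bnd_uniq pY f)) mulnC.
move=> u uf; rewrite sum1_card.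
rewrite (eq_card (B := pred2 (next (bnd f) u) (prev (bnd f) u))).
  by rewrite card2 next_neq_prev ?(bnd_uniq pY) ?(bnd_size pY).
by move=> v; rewrite !inE -[LHS]/(edge_of f u v) /edge_of uf.
Qed.

End Patterns.

(** * Covers of semi-equivelar maps *)

Section Development.
Local Open Scope nat_scope.
Variable p : seq nat.
Let d := size p.
Implicit Types (pats : seq (seq nat)) (gl : seq (seq (option (nat * nat)))).
Implicit Types D E X : nat * nat.

(** A dart [(v, i)] is the i-th edge leaving [v]. The corner with the same index lies between edges
    i and i + 1, so the face on the other side of the dart is that of [shift d.-1 D]. *)
Definition shift (k : nat) (D : nat * nat) := (D.1, (D.2 + k) %% d).
Definition get gl D : option (nat * nat) := nth None (nth [::] gl D.1) D.2.
Definition corner_size pats D := nth 0 (nth [::] pats D.1) D.2.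

(** For [k = 1] the walk goes round the face after the dart, for [k = d.-1] round the face before
    it. *)
Fixpoint walk gl k m X : option (nat * nat) :=
  if m is m'.+1 then
    if get gl (shift k X) is Some X' then walk gl k m' X' else None
  else Some X.

(** If all edges but one of a face at [D] are glued, the walk of one step less than the face size
    ends at the vertex where the partner of [D] must be. Both faces along [D] are tried. *)
Definition closing pats gl D : option (nat * nat) :=
  if walk gl 1 (corner_size pats D).-1 D is Some X then Some (shift 1 X)
  else if walk gl d.-1 (corner_size pats (shift d.-1 D)).-1 D is Some X
  then Some (shift d.-1 X) else None.

Definition compatible pats D E :=
  (corner_size pats D == corner_size pats (shift d.-1 E)) &&
  (corner_size pats (shift d.-1 D) == corner_size pats E).

Definition glue1 gl D E := set_nth [::] gl D.1
  (set_nth None (nth [::] gl D.1) D.2 (Some E)).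
Definition glue2 gl D E := glue1 (glue1 gl D E) E D.

Definition new_patterns pats D := [seq q <- dihedral_patterns p |
  (nth 0 q d.-1 == corner_size pats D) &&
  (nth 0 q 0 == corner_size pats (shift d.-1 D))].

(* Builds all covers of maps with vertex pattern [p], starting from one vertex:
   the darts (vertex, position) are glued in pairs, a pair being forced when it
   closes a face, and otherwise leading to a new vertex, whose pattern may have
   to be guessed. *)
Fixpoint develop fuel cur pats gl : seq (seq (seq nat) * seq (seq (option (nat * nat)))) :=
  if fuel is fuel'.+1 then
    if cur < size pats then
      let i := find (fun i => get gl (cur, i) == None) (iota 0 d) in
      if i < d then
        let D := (cur, i) in
        if closing pats gl D is Some E then
          if compatible pats D E then develop fuel' cur pats (glue2 gl D E) else [::]
        else flatten [seq develop fuel' cur (rcons pats q) (glue2 gl D (size pats, 0))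
                     | q <- new_patterns pats D]
      else develop fuel' cur.+1 pats gl
    else [:: (pats, gl)]
  else [:: (pats, gl)].

Lemma get_glue1 gl D E D' :
  get (glue1 gl D E) D' = if D' == D then Some E else get gl D'.
Proof.
rewrite /get /glue1 nth_set_nth /=; case: D D' => [v i] [v' i'] /=.
rewrite xpair_eqE; case: eqP => [->|] //=; by rewrite nth_set_nth.
Qed.

Variable Y : cellmap.
Hypothesis pY : polyhedral_map Y.
Hypothesis hp : forall u : vert Y,
  exists c, face_cycle u c /\ [seq size (bnd f) | f <- c] = p.
Implicit Types (w : nat -> flag Y).

Definition dart_flag w D : flag Y := iter D.2 (@rho Y) (w D.1).

Definition realized pats gl w :=
  (forall v, v < size pats -> is_flag (w v) /\
     forall i, i < d -> fsize (dart_flag w (v, i)) = corner_size pats (v, i)) /\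
  (forall D E, get gl D = Some E ->
     [/\ D.1 < size pats /\ D.2 < d, E.1 < size pats /\ E.2 < d &
        flag0 (dart_flag w D) = flag2 (dart_flag w E)]).

Lemma iter_rho_mod x i : is_flag x -> iter (i %% d) (@rho Y) x = iter i (@rho Y) x.
Proof.
move=> fx; have [per _ _] := flag_pattern pY hp fx.
rewrite [in RHS](divn_eq i d) addnC iterD; congr iter.
by elim: (i %/ d) => // m IH; rewrite mulSn iterD -IH per.
Qed.

Lemma iter_rho_pred x : is_flag x -> iter d.-1 (@rho Y) x = flag1 (flag2 x).
Proof.
move=> fx; have [per _ _] := flag_pattern pY hp fx.
apply: (rho_inj pY) => //.
- exact: iter_rho_flag.
- exact/flag1_flag/flag2_flag.
rewrite -iterS prednK ?(leq_ltn_trans _ (pattern_size pY hp (fvert x))) // per.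
by rewrite /rho (flag1K pY) ?(flag2K pY) //; exact: flag2_flag.
Qed.

Section Realized.
Variables (pats : seq (seq nat)) (gl : seq (seq (option (nat * nat)))).
Variable (w : nat -> flag Y).
Hypothesis hr : realized pats gl w.
Let valid D := (D.1 < size pats) && (D.2 < d).

Lemma dart_flag_flag D : valid D -> is_flag (dart_flag w D).
Proof. by case/andP => vD _; apply: iter_rho_flag => //; case: (proj1 hr _ vD). Qed.

Lemma valid_shift k D : valid D -> valid (shift k D).
Proof.
by case/andP => vD dD; rewrite /valid vD /= ltn_pmod //; exact: leq_ltn_trans dD.
Qed.

Lemma dart_flag_shift1 D : valid D -> dart_flag w (shift 1 D) = rho (dart_flag w D).
Proof.
case/andP => vD _; have [fw _] := proj1 hr _ vD.
by rewrite /dart_flag /= iter_rho_mod // addn1.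
Qed.

Lemma dart_flag_shiftV D : valid D ->
  dart_flag w (shift d.-1 D) = flag1 (flag2 (dart_flag w D)).
Proof.
move=> vD; have [fw _] := proj1 hr _ (proj1 (andP vD)).
rewrite /dart_flag /= iter_rho_mod // addnC iterD iter_rho_pred //.
exact: iter_rho_flag.
Qed.

Lemma dart_flag_size D : valid D -> fsize (dart_flag w D) = corner_size pats D.
Proof. by case: D => v i /andP[vD dD]; have [_] := proj1 hr _ vD; apply. Qed.

Lemma walk1 m X X' : valid X -> walk gl 1 m X = Some X' ->
  valid X' /\ iter m (@face_step Y) (dart_flag w X) = dart_flag w X'.
Proof.
elim: m X => [|m IH] X vX /=; first by case=> <-.
case E: (get _ _) => [X1|] // hw.
have [_ [v1 d1] h] := proj2 hr _ _ E.
have vX1 : valid X1 by rewrite /valid v1.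
have [vX' <-] := IH _ vX1 hw; split=> //; rewrite -iterS iterSr; congr iter.
have fX := dart_flag_flag vX; have fX1 := dart_flag_flag vX1.
move: h; rewrite dart_flag_shift1 // /rho (flag02 pY) //; last exact: flag1_flag.
move=> /(congr1 (@flag2 Y)); rewrite !(flag2K pY) //.
by apply/flag0_flag/flag1_flag.
Qed.

Lemma walkV m X X' : valid X -> walk gl d.-1 m X = Some X' ->
  valid X' /\ iter m (@face_step Y) (flag2 (dart_flag w X)) = flag2 (dart_flag w X').
Proof.
elim: m X => [|m IH] X vX /=; first by case=> <-.
case E: (get _ _) => [X1|] // hw.
have [_ [v1 d1] h] := proj2 hr _ _ E.
have vX1 : valid X1 by rewrite /valid v1.
have [vX' <-] := IH _ vX1 hw; split=> //; rewrite -iterS iterSr; congr iter.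
by move: h; rewrite dart_flag_shiftV.
Qed.

Lemma closing_sound D E : valid D -> closing pats gl D = Some E ->
  valid E /\ flag0 (dart_flag w D) = flag2 (dart_flag w E).
Proof.
move=> vD; have fD := dart_flag_flag vD; rewrite /closing.
have sz (x : flag Y) : is_flag x -> 0 < fsize x by move=> fx; have := bnd_size pY (fface x); rewrite /fsize; case: (size _).
case E1: (walk _ _ _ _) => [X|].
  case=> <-; have [vX hX] := walk1 vD E1; split; first exact: valid_shift.
  have fX := dart_flag_flag vX.
  have := face_step_size pY fD; rewrite dart_flag_size //.
  rewrite -(prednK (n := corner_size pats D)); last by rewrite -dart_flag_size ?sz.
  rewrite iterS hX => <-; rewrite dart_flag_shift1 // /rho (flag2K pY); last exact: flag1_flag.
  by rewrite /face_step flag0K.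
case E2: (walk _ _ _ _) => [X|] // [<-].
have [vX hX] := walkV vD E2; split; first exact: valid_shift.
have fX := dart_flag_flag vX; have f2 := flag2_flag pY fD.
have csz : corner_size pats (shift d.-1 D) = fsize (flag2 (dart_flag w D)).
  by rewrite -dart_flag_size ?valid_shift // dart_flag_shiftV.
have := face_step_size pY f2.
rewrite -(prednK (sz _ f2)) -csz iterS hX => h.
rewrite dart_flag_shiftV // -[LHS](flag2K pY) ?flag0_flag // -(flag02 pY) // -h.
by rewrite /face_step flag0K.
Qed.

Lemma compatible_sound D E : valid D -> valid E ->
  flag0 (dart_flag w D) = flag2 (dart_flag w E) -> compatible pats D E.
Proof.
move=> vD vE h; have fD := dart_flag_flag vD; have fE := dart_flag_flag vE.
rewrite /compatible -!dart_flag_size ?valid_shift // !dart_flag_shiftV // !fsize1.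
apply/andP; split; first by rewrite -h fsize0.
by rewrite -[dart_flag w E](flag2K pY) // -h -(flag02 pY) // fsize0.
Qed.

Lemma glue2_realized D E : valid D -> valid E ->
  flag0 (dart_flag w D) = flag2 (dart_flag w E) -> realized pats (glue2 gl D E) w.
Proof.
move=> vD vE h; split; first exact: proj1 hr.
move=> D' E'; rewrite /glue2 !get_glue1.
have [/andP[? ?] /andP[? ?]] := (vD, vE).
have fD := dart_flag_flag vD; have fE := dart_flag_flag vE.
case: eqP => [-> [<-]|_]; last case: eqP => [-> [<-]|_]; last exact: (proj2 hr).
  split=> //; rewrite -[dart_flag w E](flag2K pY) // -h.
  by rewrite -(flag02 pY fD) flag0K.
by split.
Qed.

Lemma add_vertex_realized D : valid D ->
  exists2 q, q \in new_patterns pats D &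
    exists w', realized (rcons pats q) (glue2 gl D (size pats, 0)) w'.
Proof.
move=> vD; have fD := dart_flag_flag vD.
(* The base flag of the new vertex is the far end of [D], reflected so that its dart 0 is the
   reverse of [D]; its pattern is read off from [Y]. *)
pose x := flag2 (flag0 (dart_flag w D)).
have fx : is_flag x by exact/flag2_flag/flag0_flag.
have [per _ hq] := flag_pattern pY hp fx.
set q := mkseq _ _ in hq.
have d0 : 0 < d by exact: ltn_trans (pattern_size pY hp (fvert x)).
have qn i : i < d -> nth 0 q i = fsize (iter i (@rho Y) x).
  by move=> id; rewrite nth_mkseq.
pose w' v := if v == size pats then x else w v.
have w'E v : v < size pats -> w' v = w v by rewrite /w'; case: eqP => // ->; rewrite ltnn.
have cs v i : corner_size (rcons pats q) (v, i) =
    if v == size pats then nth 0 q i else corner_size pats (v, i).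
  rewrite /corner_size /= nth_rcons; case: ltngtP => // h.
  by rewrite (nth_default [::] (ltnW h)) nth_nil.
have hr' : realized (rcons pats q) gl w'.
  split=> [v|D' E' /(proj2 hr)[[v1 d1] [v2 d2] h]].
    rewrite size_rcons ltnS leq_eqVlt => /orP[/eqP ->|vn].
      by rewrite /w' eqxx; split=> // i id; rewrite cs eqxx qn // /dart_flag /= eqxx.
    rewrite w'E //; have [fv hv] := proj1 hr v vn; split=> // i id.
    rewrite cs (ltn_eqF vn) -hv //; by rewrite /dart_flag /= w'E.
  split; rewrite ?size_rcons; [by split=> //; exact: ltnW..|].
  by rewrite /dart_flag !w'E.
exists q.
  have c2 : corner_size pats (shift d.-1 D) = fsize (flag2 (dart_flag w D)).
    by rewrite -dart_flag_size ?valid_shift // dart_flag_shiftV.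
  rewrite mem_filter hq andbT !qn ?prednK //= iter_rho_pred // fsize1 c2.
  rewrite -(dart_flag_size vD) /x (flag2K pY) ?fsize0 ?eqxx //=; last exact: flag0_flag.
  by rewrite -(flag02 pY fD) fsize0.
exists w'; have [/andP[v1 d1] _] := (vD, tt).
have dE : dart_flag w' D = dart_flag w D by rewrite /dart_flag w'E.
split; first by case: hr'.
move=> D' E'; rewrite /glue2 !get_glue1 size_rcons.
case: eqP => [-> [<-]|_]; last case: eqP => [-> [<-]|_].
- split=> //=; first by split=> //; exact: ltnW.
  rewrite dE /dart_flag /= /w' eqxx /x (flag02 pY) ?flag0K //; exact: flag0_flag.
- split=> //=; first by split=> //; exact: ltnW.
  rewrite dE /dart_flag /= /w' eqxx /x (flag2K pY) //; exact: flag0_flag.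
- by move=> /(proj2 hr'); rewrite size_rcons.
Qed.

End Realized.

(** Some branch always follows [Y]: forced gluings hold in [Y], and its pattern at a new vertex is
    among the guesses. Exhausted fuel returns the unfinished state, so the statement holds for any
    fuel, and termination is checked afterwards by [complete]. *)
Lemma develop_sound fuel cur pats gl w : realized pats gl w ->
  exists st w', st \in develop fuel cur pats gl /\ realized st.1 st.2 w'.
Proof.
elim: fuel cur pats gl w => [|fuel IH] cur pats gl w hr /=.
  by exists (pats, gl), w; rewrite mem_head.
case: ifP => [vc|_]; last by exists (pats, gl), w; rewrite mem_head.
set i := find _ _; case: ifP => [id|_]; last exact: IH hr.
have vD : ((cur, i).1 < size pats) && ((cur, i).2 < d) by rewrite vc.
case E: (closing _ _ _) => [X|].
  have [vX h] := closing_sound hr vD E.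
  rewrite (compatible_sound hr vD vX h); apply: IH.
  exact: (glue2_realized hr vD vX h).
have [q hq [w' hr']] := add_vertex_realized hr vD.
have [st [w'' [h1 h2]]] := IH cur _ _ _ hr'.
exists st, w''; split=> //; apply/flatten_mapP; by exists q.
Qed.

Lemma develop_start (u : vert Y) fuel :
  exists st w, st \in develop fuel 0 [:: p] [::] /\ realized st.1 st.2 w.
Proof.
have [x [fx xu xd xs _]] := vertex_flag pY hp u.
apply: (@develop_sound fuel 0 [:: p] [::] (fun _ => x)); split.
  case=> // _; split=> // i id.
  by rewrite /dart_flag /= xs modn_small.
by move=> D E; rewrite /get nth_nil nth_nil.
Qed.

End Development.

(** * Double covers and their sheet exchange *)

Section Cover.
Local Open Scope nat_scope.
Variable p : seq nat.
Let d := size p.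
Variables (pats : seq (seq nat)) (gl : seq (seq (option (nat * nat)))).
Let n := size pats.
Local Notation pflag := (nat * nat * bool)%type.
Implicit Types x y z : pflag.

(** Each dart carries two flags; the Boolean is true for the face after the dart and false for the
    face before it. *)
Definition pvalid x := (x.1.1 < n) && (x.1.2 < d).
Definition pflag0 x : pflag := (odflt x.1 (get gl x.1), ~~ x.2).
Definition pflag1 x : pflag :=
  if x.2 then (shift p 1 x.1, false) else (shift p d.-1 x.1, true).
Definition pflag2 x : pflag := (x.1, ~~ x.2).
Definition prho x := pflag2 (pflag1 x).

Definition complete := all (fun v => all (fun i =>
  if get gl (v, i) is Some E then [&& E.1 < n, E.2 < d & get gl E == Some (v, i)]
  else false) (iota 0 d)) (iota 0 n).

Definition pall : seq pflag :=
  [seq (D, b) | D <- [seq (v, i) | v <- iota 0 n, i <- iota 0 d], b <- [:: true; false]].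

(* A deck transformation commutes with [pflag0], [pflag1] and [pflag2], so it is
   determined by the image [z] of the base flag [(0, 0, true)]: the vertex [v]
   was created through its dart [(v, 0)] from an earlier vertex. *)
Definition deck_table z : seq pflag :=
  foldl (fun tab v => rcons tab (let D := odflt (v, 0) (get gl (v, 0)) in
    pflag2 (pflag0 (iter D.2 prho (nth z tab D.1))))) [:: z] (iota 1 n.-1).
Definition deck z (tab : seq pflag) x : pflag :=
  let y := iter x.1.2 prho (nth z tab x.1.1) in if x.2 then y else pflag2 y.
Definition tree_ok := all (fun v =>
  if get gl (v, 0) is Some D then D.1 < v else false) (iota 1 n.-1).

Definition pstep x := pflag0 (pflag1 x).
Definition star v : seq nat := flatten [seq [seq (iter k pstep (v, i, true)).1.1
  | k <- iota 0 (corner_size pats (v, i))] | i <- iota 0 d].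

Definition psize x := corner_size pats (if x.2 then x.1 else shift p d.-1 x.1).

(* Nested [if]s, and [find] in place of [all], stop at the first failure under
   call by value. *)
Definition deck_ok z :=
  if [seq psize (iter i prho z) | i <- iota 0 d] == [seq psize (0, i, true) | i <- iota 0 d]
  then let tab := deck_table z in
    if deck z tab z == (0, 0, true)
    then find (fun v => (deck z tab (v, 0, true)).1.1 \in star v) (iota 0 n) == n
    else false
  else false.

Lemma mem_pall x : (x \in pall) = pvalid x.
Proof.
case: x => -[v i] b; rewrite /pvalid /=; apply/allpairsP/idP => [[[D b']]|].
  by move=> [/= /allpairsP[[v' i'] [/=]]]; rewrite !mem_iota !add0n => /andP[_ h1] /andP[_ h2] -> _ [-> -> _]; rewrite h1.
move=> /andP[vn id]; exists ((v, i), b); split=> //=; last by case: b.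
by apply/allpairsP; exists (v, i); rewrite !mem_iota.
Qed.

Lemma uniq_pall : uniq pall.
Proof.
apply: allpairs_uniq => //; last by move=> [x1 x2] [y1 y2] _ _ /= [-> ->].
by apply: allpairs_uniq; rewrite ?iota_uniq // => -[x1 x2] [y1 y2] _ _ /= [-> ->].
Qed.

Lemma size_pall : size pall = 2 * (n * d).
Proof. by rewrite !size_allpairs !size_iota mulnC. Qed.

Hypothesis hc : complete.

Lemma completeP D : D.1 < n -> D.2 < d -> exists E,
  [/\ get gl D = Some E, E.1 < n, E.2 < d & get gl E = Some D].
Proof.
case: D => v i /= vn id; have /allP/(_ v) := hc; rewrite mem_iota => /(_ vn).
move/allP/(_ i); rewrite mem_iota => /(_ id); case: (get gl (v, i)) => // E.
by case/and3P => ? ? /eqP ?; exists E.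
Qed.

Lemma pflag0_valid x : pvalid x -> pvalid (pflag0 x).
Proof.
case/andP => xn xd; have [E [h ? ? _]] := completeP xn xd.
by rewrite /pvalid /pflag0 h /=; apply/andP.
Qed.

Lemma pflag1_valid x : pvalid x -> pvalid (pflag1 x).
Proof.
case/andP => xn xd; rewrite /pvalid /pflag1.
by case: x.2; rewrite /= xn ltn_pmod //; exact: leq_ltn_trans xd.
Qed.

Lemma pflag2_valid x : pvalid x -> pvalid (pflag2 x).
Proof. by []. Qed.

Lemma prho_valid i x : pvalid x -> pvalid (iter i prho x).
Proof. by move=> vx; elim: i => //= i; exact: pflag1_valid. Qed.

Lemma pflag0K x : pvalid x -> pflag0 (pflag0 x) = x.
Proof.
case/andP => xn xd; have [E [h ? ? h']] := completeP xn xd.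
by rewrite /pflag0 h /= h' /= negbK; case: (x).
Qed.

Lemma pflag2K x : pflag2 (pflag2 x) = x.
Proof. by case: x => D b; rewrite /pflag2 /= negbK. Qed.

Lemma pflag1K x : pvalid x -> pflag1 (pflag1 x) = x.
Proof.
case: x => -[v i] b /andP[/= vn id]; have d0 : 0 < d by exact: leq_ltn_trans id.
rewrite /pflag1; case: b => /=; rewrite /shift /=; congr (_, _, _).
  by rewrite modnDml -addnA add1n prednK // modnDr modn_small.
by rewrite modnDml -addnA addn1 prednK // modnDr modn_small.
Qed.

Lemma perm_pall (h : pflag -> pflag) : (forall x, pvalid x -> pvalid (h x)) ->
  (forall x, pvalid x -> h (h x) = x) -> perm_eq (map h pall) pall.
Proof.
move=> hv hK; apply: uniq_perm; last first.
- move=> x; apply/mapP/idP => [[y + ->]|]; rewrite !mem_pall; first exact: hv.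
  by move=> vx; exists (h x); rewrite ?mem_pall ?hv // hK.
- exact: uniq_pall.
rewrite map_inj_in_uniq ?uniq_pall // => x y; rewrite !mem_pall => vx vy.
by move/(congr1 h); rewrite !hK.
Qed.

Lemma iter_prho (v i : nat) : i <= d -> v < n ->
  iter i prho (v, 0, true) = (v, i %% d, true).
Proof.
move=> id vn; elim: i id => [|i IH] id; first by rewrite mod0n.
rewrite iterS IH; last exact: ltnW.
by congr (_, _, _); rewrite -[LHS]/((i %% d + 1) %% d) modnDml addn1.
Qed.

Section OneMap.
Variable Y : cellmap.
Hypothesis pY : polyhedral_map Y.
Hypothesis hp : forall u : vert Y,
  exists c, face_cycle u c /\ [seq size (bnd f) | f <- c] = p.
Hypothesis cY : incidence_connected Y.
Variable w : nat -> flag Y.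
Hypothesis hr : realized p pats gl w.

Definition pmap x : flag Y :=
  if x.2 then dart_flag w x.1 else flag2 (dart_flag w x.1).

Lemma dart_pvalid x : pvalid x -> is_flag (dart_flag w x.1).
Proof. by move=> vx; exact: (dart_flag_flag pY hr). Qed.

Lemma pmap_flag x : pvalid x -> is_flag (pmap x).
Proof.
by move=> /dart_pvalid fx; rewrite /pmap; case: ifP => // _; exact: flag2_flag.
Qed.

Lemma pmap2 x : pvalid x -> pmap (pflag2 x) = flag2 (pmap x).
Proof.
move=> /dart_pvalid fx; rewrite /pmap /pflag2 /=.
by case: x.2 => //=; rewrite (flag2K pY).
Qed.

Lemma pmap0 x : pvalid x -> pmap (pflag0 x) = flag0 (pmap x).
Proof.
move=> vx; have fx := dart_pvalid vx; case/andP: (vx) => xn xd.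
have [E [h En Ed h']] := completeP xn xd.
have [_ _ e] := proj2 hr _ _ h.
rewrite /pmap /pflag0 h /=; case: x.2 => //=.
rewrite (flag02 pY fx) e (flag2K pY) //.
by apply: (@dart_pvalid (E, true)); apply/andP.
Qed.

Lemma pmap1 x : pvalid x -> pmap (pflag1 x) = flag1 (pmap x).
Proof.
move=> vx; have fx := dart_pvalid vx; rewrite /pmap /pflag1.
case: x.2 => /=; last by rewrite (dart_flag_shiftV pY hp hr).
rewrite (dart_flag_shift1 pY hp hr) // /rho (flag2K pY) //; exact: flag1_flag.
Qed.

Lemma count_pmap (h : pflag -> pflag) (k : flag Y -> flag Y) (y : flag Y) :
  (forall x, pvalid x -> pvalid (h x)) -> (forall x, pvalid x -> h (h x) = x) ->
  (forall f, is_flag f -> is_flag (k f)) -> (forall f, is_flag f -> k (k f) = f) ->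
  (forall x, pvalid x -> pmap (h x) = k (pmap x)) -> is_flag y ->
  count (fun x => pmap x == k y) pall = count (fun x => pmap x == y) pall.
Proof.
move=> hv hK kf kK hk fy; rewrite -(permP (perm_pall hv hK)) count_map.
apply: eq_in_count => x; rewrite mem_pall => vx /=; rewrite hk //.
apply/eqP/eqP => [h1|-> //].
by rewrite -(kK (pmap x)) ?h1 ?kK //; exact: pmap_flag.
Qed.

(** The involutions permute the flags of the cover compatibly with the projection, so the fibre size
    is invariant and connectedness of flags applies. *)
Lemma fibre_const (y z : flag Y) : is_flag y -> is_flag z ->
  count (fun x => pmap x == y) pall = count (fun x => pmap x == z) pall.
Proof.
move=> fy fz; pose g (f : flag Y) := count (fun x' => pmap x' == f) pall == count (fun x' => pmap x' == z) pall.
suff : g y = g z by rewrite /g eqxx => /eqP.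
apply: (flag_invariant_const pY hp (g := g)) => // x fx; rewrite /g; split; congr (_ == _).
- by apply: (count_pmap pflag0_valid pflag0K) => // ? ?; rewrite ?flag0K //;
    [exact: flag0_flag|exact: pmap0].
- by apply: (count_pmap pflag1_valid pflag1K) => // ? ?; [exact: flag1_flag|exact: flag1K|exact: pmap1].
- by apply: (count_pmap pflag2_valid (fun x _ => pflag2K x)) => // ? ?;
    [exact: flag2_flag|exact: flag2K|exact: pmap2].
Qed.

Hypothesis hV : n = 2 * #|vert Y|.
Hypothesis d0 : 0 < d.
Hypothesis V0 : 0 < #|vert Y|.

(** The cover has 2 n d flags with n = 2 V, and the map has 2 d V; the fibres are equally large. *)
Lemma fibre_size (y : flag Y) : is_flag y -> count (fun x => pmap x == y) pall = 2.
Proof.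
move=> fy; set k := count _ _.
have S : \sum_(f : flag Y | is_flag f) count (fun x => pmap x == f) pall = size pall.
  rewrite (eq_bigr (fun f : flag Y => \sum_(x <- pall) (pmap x == f))) => [|z _]; last first.
    by rewrite -sum1_count big_mkcond; apply: eq_bigr => x _; case: eqP.
  rewrite exchange_big /= -sum1_size; apply: eq_big_seq => x; rewrite mem_pall => vx.
  rewrite (bigD1 (pmap x)) ?pmap_flag //= eqxx big1 => [|z /andP[_ /negPf]].
    by rewrite addn0.
  by rewrite eq_sym => ->.
move: S; rewrite (eq_bigr (fun _ => k)) => [|z fz]; last exact: fibre_const.
rewrite sum_nat_const size_pall (card_flags pY hp) hV.
rewrite (_ : 2 * (2 * #|vert Y| * d) = 2 * (d * #|vert Y|) * 2); last by lia.
move/eqP; rewrite eqn_mul2l -/d !muln_eq0 /= (gtn_eqF d0) (gtn_eqF V0) /=.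
by move/eqP.
Qed.

Lemma pmap_surj (y : flag Y) : is_flag y -> exists2 x, pvalid x & pmap x = y.
Proof.
move=> fy; have : has (fun x => pmap x == y) pall by rewrite has_count fibre_size.
by case/hasP => x; rewrite mem_pall => vx /eqP; exists x.
Qed.

Lemma partner_exists x : pvalid x -> exists y, [/\ pvalid y, y != x & pmap y = pmap x].
Proof.
move=> vx; have c2 := fibre_size (pmap_flag vx).
have : has (fun y => (pmap y == pmap x) && (y != x)) pall.
  apply: contraT => /hasPn h.
  have : count (fun y => pmap y == pmap x) pall = count (pred1 x) pall.
    apply: eq_in_count => y yp /=; apply/idP/eqP => [e|-> //].
    by have := h y yp; rewrite e /= negbK => /eqP.
  by rewrite c2 count_uniq_mem ?uniq_pall //; case: (_ \in _).
by case/hasP => y; rewrite mem_pall => vy /andP[/eqP e ne]; exists y.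
Qed.

Lemma partner_uniq x y z : pvalid x -> pvalid y -> pvalid z -> y != x -> z != x ->
  pmap y = pmap x -> pmap z = pmap x -> y = z.
Proof.
move=> vx vy vz yx zx ey ez; apply: contraTeq isT => yz.
have c2 := fibre_size (pmap_flag vx).
have u3 : uniq [:: x; y; z] by rewrite /= !inE negb_or ![x == _]eq_sym yx zx yz.
have := uniq_leq_size u3 (s2 := [seq y <- pall | pmap y == pmap x]).
rewrite size_filter c2 /= => h; exfalso; suff : 3 <= 2 by [].
apply: h => t; rewrite !inE mem_filter mem_pall.
by case/or3P => /eqP ->; rewrite ?eqxx ?ey ?ez ?eqxx.
Qed.

Definition partner x := head x [seq y <- pall | (pmap y == pmap x) && (y != x)].

Lemma partnerP x : pvalid x ->
  [/\ pvalid (partner x), partner x != x & pmap (partner x) = pmap x].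
Proof.
move=> vx; have : partner x \in [seq y <- pall | (pmap y == pmap x) && (y != x)].
  have [y [vy yx /eqP e]] := partner_exists vx.
  have : y \in [seq y <- pall | (pmap y == pmap x) && (y != x)].
    by rewrite mem_filter e yx mem_pall.
  by rewrite /partner; case: [seq _ <- _ | _] => // a s _; rewrite mem_head.
by rewrite mem_filter mem_pall => /andP[/andP[/eqP ? ?] ?].
Qed.

Lemma partner_eq x y : pvalid x -> pvalid y -> y != x -> pmap y = pmap x ->
  partner x = y.
Proof.
by move=> vx vy yx e; have [? ? ?] := partnerP vx; exact: (@partner_uniq x).
Qed.

Lemma partnerK x : pvalid x -> partner (partner x) = x.
Proof.
by move=> vx; have [v n' e] := partnerP vx; apply: partner_eq; rewrite // eq_sym.
Qed.

(** The other point of a two-element fibre is unique, so anything commuting with the projection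
    commutes with exchanging the two points. *)
Lemma partner_equiv (h : pflag -> pflag) (k : flag Y -> flag Y) :
  (forall x, pvalid x -> pvalid (h x)) -> (forall x, pvalid x -> h (h x) = x) ->
  (forall x, pvalid x -> pmap (h x) = k (pmap x)) ->
  forall x, pvalid x -> partner (h x) = h (partner x).
Proof.
move=> hv hK hk x vx; have [v n' e] := partnerP vx.
apply: partner_eq; [exact: hv..| |by rewrite !hk ?e].
by apply: contra n' => /eqP e'; rewrite -(hK _ v) e' hK.
Qed.

Lemma partner0 x : pvalid x -> partner (pflag0 x) = pflag0 (partner x).
Proof. exact: (partner_equiv pflag0_valid pflag0K pmap0). Qed.

Lemma partner1 x : pvalid x -> partner (pflag1 x) = pflag1 (partner x).
Proof. exact: (partner_equiv pflag1_valid pflag1K pmap1). Qed.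

Lemma partner2 x : pvalid x -> partner (pflag2 x) = pflag2 (partner x).
Proof. exact: (partner_equiv pflag2_valid (fun x _ => pflag2K x) pmap2). Qed.

Lemma partner_rho i x : pvalid x -> partner (iter i prho x) = iter i prho (partner x).
Proof.
move=> vx; elim: i => //= i IH; have vi := prho_valid i vx.
by rewrite /prho partner2 ?partner1 ?IH //; exact: pflag1_valid.
Qed.

Lemma deck_table_partner : tree_ok -> 0 < n ->
  forall v, v < n -> nth (partner (0, 0, true)) (deck_table (partner (0, 0, true))) v
                     = partner (v, 0, true).
Proof.
move=> ht n0; set z := partner (0, 0, true); rewrite /deck_table.
set f := fun _ _ => _.
suff A m : m < n -> size (foldl f [:: z] (iota 1 m)) = m.+1 /\
    forall v, v <= m -> nth z (foldl f [:: z] (iota 1 m)) v = partner (v, 0, true).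
  have n1 : n.-1 < n by rewrite prednK.
  have [_ h] := A _ n1; move=> v vn; apply: h.
  by rewrite -ltnS prednK.
elim: m => [|m IH] mn; first by split=> // v; rewrite leqn0 => /eqP ->.
have [s1 h1] := IH (ltnW mn).
have -> : iota 1 m.+1 = rcons (iota 1 m) m.+1.
  by have := iotaD 1 m 1; rewrite addn1 cats1 add1n.
rewrite foldl_rcons; set tab := foldl f _ _ in s1 h1 *.
rewrite /f size_rcons s1; split=> // v; rewrite nth_rcons s1.
rewrite leq_eqVlt => /orP[/eqP ->|vm]; last by rewrite vm h1.
rewrite ltnn eqxx.
have /allP/(_ m.+1) := ht; rewrite mem_iota => /(_ _).
have [E [gE En Ed gE']] := completeP (D := (m.+1, 0)) mn d0.
rewrite gE /= => h; have {h} Em : E.1 <= m by apply: h; rewrite add1n prednK.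
have vE : pvalid (E.1, 0, true) by rewrite /pvalid /= En.
rewrite h1 // -partner_rho // iter_prho ?(ltnW Ed) // modn_small //.
have vE' : pvalid (E.1, E.2, true) by rewrite /pvalid /= En.
rewrite -partner0 // -partner2; last exact: pflag0_valid.
by congr partner; rewrite /pflag0 /= -surjective_pairing gE'.
Qed.

Lemma deck_partner x : tree_ok -> 0 < n -> pvalid x ->
  deck (partner (0, 0, true)) (deck_table (partner (0, 0, true))) x = partner x.
Proof.
move=> ht n0 vx; case/andP: (vx) => xn xd.
have v0 : pvalid (x.1.1, 0, true) by rewrite /pvalid /= xn.
rewrite /deck deck_table_partner // -partner_rho // iter_prho ?(ltnW xd) //.
rewrite modn_small //; case: x vx xn xd v0 => -[v i] [] //= vx _ _ _.
by rewrite -partner2.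
Qed.

Lemma pmap_step k x : pvalid x ->
  pvalid (iter k pstep x) /\ pmap (iter k pstep x) = iter k (@face_step Y) (pmap x).
Proof.
move=> vx; elim: k => //= k [vk <-]; have v1 := pflag1_valid vk.
by split; [exact: pflag0_valid|rewrite /pstep pmap0 ?pmap1].
Qed.

Lemma fvert_pmap x : fvert (pmap x) = fvert (w x.1.1).
Proof. by rewrite /pmap; case: ifP => _; rewrite ?fvert2 /dart_flag fvert_iter_rho. Qed.

Lemma fsize_pmap x : pvalid x -> fsize (pmap x) = psize x.
Proof.
move=> vx; have vD : (x.1.1 < size pats) && (x.1.2 < size p) := vx.
rewrite /pmap /psize; case: ifP => _; first exact: (dart_flag_size hr).
rewrite -fsize1 -(dart_flag_shiftV pY hp hr) // (dart_flag_size hr) //.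
exact: valid_shift.
Qed.

(** The partner of a vertex in its own star would lie on a common face with it, and both project to
    one vertex. A face boundary repeats no vertex, which leaves only the case of a vertex sent to
    itself. *)
Lemma deck_ok_partner : tree_ok -> 0 < n -> deck_ok (partner (0, 0, true)).
Proof.
move=> ht n0; have vb : pvalid (0, 0, true) by rewrite /pvalid /= n0.
have [vz _ _] := partnerP vb; rewrite /deck_ok ifT; last first.
  apply/eqP/eq_in_map => i; rewrite mem_iota add0n => /andP[_ id].
  have vi := prho_valid i vb; have vpi : pvalid (partner (iter i prho (0, 0, true))).
    by have [] := partnerP vi.
  rewrite -partner_rho // -fsize_pmap //; have [_ _ ->] := partnerP vi.
  by rewrite fsize_pmap // iter_prho ?modn_small // ltnW.
rewrite deck_partner // partnerK // eqxx -[X in _ == X](size_iota 0 n).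
rewrite eqn_leq find_size leqNgt -has_find; apply/hasPn => v.
rewrite mem_iota add0n => /andP[_ vn].
have vv : pvalid (v, 0, true) by rewrite /pvalid /= vn.
rewrite deck_partner //; have [vp np ep] := partnerP vv.
apply/negP => /flatten_mapP[i]; rewrite mem_iota add0n => /andP[_ id].
case/mapP => k; rewrite mem_iota add0n => /andP[_ ks] e.
have vi : pvalid (v, i, true) by rewrite /pvalid /= vn.
have [vk hk] := pmap_step k vi.
have fi := pmap_flag vi.
have := fvert_pmap (partner (v, 0, true)).
rewrite ep e -(fvert_pmap (iter k pstep _)) hk /= => /esym h.
have k0 : k = 0.
  apply: (face_step_vert pY fi); last by rewrite h !fvert_pmap.
  by rewrite [fsize _](dart_flag_size hr) // vn.
(* The partner now lies at [v] itself. It would differ from the base flag by a rotation or a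
   reflection with the same image, but the dihedral group acts freely on the flags of a vertex. *)
move: e ep np vp; rewrite k0 /=; have [fw _] := proj1 hr _ vn.
case: (partner _) => -[v' i'] b /= -> + + /andP[/= _ i'd].
rewrite /pmap /= /dart_flag /=; case: b => [h1|h1 _].
  have [_ hi _] := flag_pattern pY hp fw.
  by rewrite (hi i') ?eqxx.
apply: (iter_rho_neq_flag2 pY (i := i') fw).
by rewrite -[in RHS]h1 (flag2K pY) //; exact: iter_rho_flag.
Qed.

(** The fibres, and with them the map up to isomorphism, can be recomputed from the image [z] of the
    base flag alone. *)
Lemma pmap_fibres : tree_ok -> 0 < n -> exists z,
  [/\ z \in pall, z != (0, 0, true), deck_ok z & forall x y, pvalid x -> pvalid y ->
     (pmap x == pmap y) = (y == x) || (y == deck z (deck_table z) x)].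
Proof.
move=> ht n0; have vb : pvalid (0, 0, true) by rewrite /pvalid /= n0.
have [vz nz _] := partnerP vb; exists (partner (0, 0, true)).
split=> //; [by rewrite mem_pall|exact: deck_ok_partner|].
move=> x y vx vy; rewrite deck_partner //; have [vp np ep] := partnerP vx.
apply/eqP/orP => [e|[/eqP -> //|/eqP ->]]; last by [].
by case: (eqVneq y x) => [|yx]; [left|right; rewrite -(partner_eq vx vy yx)].
Qed.

End OneMap.
End Cover.

Section CyclicNext.
Local Open Scope nat_scope.

Lemma mkseq_iter_next (T : eqType) (s : seq T) w : uniq s -> w \in s ->
  mkseq (fun j => iter j (next s) w) (size s) = rot (index w s) s.
Proof.
move=> us ws; set s' := rot _ s.
have us' : uniq s' by rewrite rot_uniq.
have s0 : 0 < size s' by rewrite size_rot; case: (s) ws.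
have w0 : nth w s' 0 = w by rewrite /s' rot_index.
rewrite -[RHS](mkseq_nth w) /mkseq size_rot; apply/eq_in_map => j.
rewrite mem_iota add0n => /andP[_ js]; rewrite -{1}w0.
rewrite (eq_iter (f' := next s')) => [|t]; last by rewrite next_rot.
by rewrite iter_next_nth // add0n modn_small // size_rot.
Qed.

End CyclicNext.

(** * From flags back to vertices and faces *)

Section FlagMorphism.
Local Open Scope nat_scope.
Variables (p : seq nat) (Y Z : cellmap).
Hypothesis pY : polyhedral_map Y.
Hypothesis hY : forall u : vert Y,
  exists c, face_cycle u c /\ [seq size (bnd f) | f <- c] = p.
Variable th : flag Y -> flag Z.
Hypothesis th0 : forall x, is_flag x -> th (flag0 x) = flag0 (th x).
Hypothesis th1 : forall x, is_flag x -> th (flag1 x) = flag1 (th x).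
Hypothesis th2 : forall x, is_flag x -> th (flag2 x) = flag2 (th x).

Lemma flag_morphism_cells : exists (phi : vert Y -> vert Z) (psi : face Y -> face Z),
  forall x, is_flag x -> phi (fvert x) = fvert (th x) /\ psi (fface x) = fface (th x).
Proof.
have [av hav] : {av & forall u, is_flag (av u : flag Y) /\ fvert (av u) = u}.
  apply: (@boolp.choice _ _ (fun u (x : flag Y) => is_flag x /\ fvert x = u)) => u.
  by have [x [fx xu _]] := vertex_flag pY hY u; exists x.
have [af haf] : {af & forall f, is_flag (af f : flag Y) /\ fface (af f) = f}.
  apply: (@boolp.choice _ _ (fun f (x : flag Y) => is_flag x /\ fface x = f)) => f.
  by have [u uf] := face_vert pY f; exists (u, next (bnd f) u, f); split=> //; exact: edge_of_next.
exists (fun u => fvert (th (av u))), (fun f => fface (th (af f))) => x fx; split.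
  have [fa ea] := hav (fvert x).
  apply: (vertex_invariant pY hY (g := fun x => fvert (th x))) => // y fy.
  by rewrite th1 // th2 // fvert1 fvert2.
have [fa ea] := haf (fface x).
apply: (face_invariant pY (g := fun x => fface (th x))) => // y fy.
by rewrite th1 // th0.
Qed.

End FlagMorphism.

Section FlagIsomorphism.
Local Open Scope nat_scope.
Variables (p : seq nat) (Y Z : cellmap).
Hypotheses (pY : polyhedral_map Y) (pZ : polyhedral_map Z).
Hypothesis hY : forall u : vert Y,
  exists c, face_cycle u c /\ [seq size (bnd f) | f <- c] = p.
Hypothesis hZ : forall u : vert Z,
  exists c, face_cycle u c /\ [seq size (bnd f) | f <- c] = p.
Variables (th : flag Y -> flag Z) (th' : flag Z -> flag Y).
Hypothesis th_flag : forall x, is_flag x -> is_flag (th x) /\ fsize (th x) = fsize x.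
Hypothesis th0 : forall x, is_flag x -> th (flag0 x) = flag0 (th x).
Hypothesis th1 : forall x, is_flag x -> th (flag1 x) = flag1 (th x).
Hypothesis th2 : forall x, is_flag x -> th (flag2 x) = flag2 (th x).
Hypothesis th'_flag : forall x, is_flag x -> is_flag (th' x).
Hypothesis thK : forall x, is_flag x -> th' (th x) = x.
Hypothesis th'K : forall x, is_flag x -> th (th' x) = x.

(** Vertices and faces are orbits of flags, so the bijections descend. Walking along a face by
    [face_step] is preserved, which matches the boundaries up to the starting point and the
    direction. *)
Lemma flag_isomorphism : isomorphic Y Z.
Proof.
have inv (k : flag Z -> flag Z) (h : flag Y -> flag Y) :
    (forall x, is_flag x -> is_flag (h x)) ->
    (forall x, is_flag x -> th (h x) = k (th x)) ->
    forall x, is_flag x -> th' (k x) = h (th' x).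
  move=> hf hk x fx; have f' := th'_flag fx.
  by rewrite -{1}(th'K fx) -hk // thK //; exact: hf.
have [phi [psi hphi]] := flag_morphism_cells pY hY th0 th1 th2.
have [phi' [psi' hphi']] := flag_morphism_cells pZ hZ
  (inv _ _ (@flag0_flag Y pY) th0) (inv _ _ (@flag1_flag Y) th1) (inv _ _ (@flag2_flag Y pY) th2).
have ev u : exists2 x : flag Y, is_flag x & fvert x = u.
  by have [x [fx xu _]] := vertex_flag pY hY u; exists x.
have ev' u : exists2 x : flag Z, is_flag x & fvert x = u.
  by have [x [fx xu _]] := vertex_flag pZ hZ u; exists x.
have ef f : exists2 x : flag Y, is_flag x & fface x = f.
  by have [u uf] := face_vert pY f; exists (u, next (bnd f) u, f) => //; exact: edge_of_next.
have ef' f : exists2 x : flag Z, is_flag x & fface x = f.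
  by have [u uf] := face_vert pZ f; exists (u, next (bnd f) u, f) => //; exact: edge_of_next.
exists phi, psi; split.
- exists phi' => u; [have [x fx <-] := ev u|have [x fx <-] := ev' u].
    by rewrite (proj1 (hphi x fx)) (proj1 (hphi' _ (proj1 (th_flag fx)))) thK.
  by rewrite (proj1 (hphi' x fx)) (proj1 (hphi _ (th'_flag fx))) th'K.
- exists psi' => f; [have [x fx <-] := ef f|have [x fx <-] := ef' f].
    by rewrite (proj2 (hphi x fx)) (proj2 (hphi' _ (proj1 (th_flag fx)))) thK.
  by rewrite (proj2 (hphi' x fx)) (proj2 (hphi _ (th'_flag fx))) th'K.
move=> f; have [u uf] := face_vert pY f; have ub := bnd_uniq pY f.
(* From this flag [face_step] runs forwards along [bnd f]. The direction of the image is not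
   determined, whence the rotation or the reversal. *)
pose x : flag Y := (u, prev (bnd f) u, f).
have fx : is_flag x by exact: edge_of_prev.
have [ftx stx] := th_flag fx.
have [pv pf] := hphi x fx; have {pf} pf : psi f = fface (th x) by [].
have st k : is_flag (iter k (@face_step Y) x) /\
    th (iter k (@face_step Y) x) = iter k (@face_step Z) (th x).
  elim: k => //= k [fk <-]; split; first exact: face_step_flag.
  by rewrite /face_step th0 ?th1 //; exact: flag1_flag.
have nx j : iter j (@face_step Y) x = (iter j (next (bnd f)) u, iter j (next (bnd f)) (prev (bnd f) u), f).
  have [_ [h|h]] := iter_face_step pY 0 fx; last exact: h.
  have := h 1; rewrite /= /face_step /flag0 /flag1 /fvert /fend /fface /=.
  rewrite eq_sym (negPf (next_neq_prev ub uf (bnd_size pY f))) => -[h' _].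
  by have := next_neq_prev ub uf (bnd_size pY f); rewrite h' eqxx.
have us := bnd_uniq pZ (psi f); set w := phi u in pv.
have wE : w = fvert (th x) by [].
have ws : w \in bnd (psi f) by rewrite wE pf; exact: edge_ofl ftx.
have sz : size (bnd f) = size (bnd (psi f)) by rewrite pf; exact: esym stx.
have rotE : map phi (rot (index u (bnd f)) (bnd f)) =
    mkseq (fun j => fvert (iter j (@face_step Z) (th x))) (size (bnd (psi f))).
  rewrite -mkseq_iter_next // -map_comp -sz; apply/eq_in_map => j _ /=.
  have [fj ej] := st j; rewrite -ej -(proj1 (hphi _ fj)) nx //.
have [_ h] := iter_face_step pZ 0 ftx.
set i := index u (bnd f) in rotE; set s := bnd (psi f) in us ws sz rotE *.
suff [k hk] : exists k, rot i (map phi (bnd f)) = rot k s \/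
    rot i (map phi (bnd f)) = rot k (rev s).
  have fin t : size t = size (map phi (bnd f)) -> rot i (map phi (bnd f)) = rot k t ->
      exists j, map phi (bnd f) = rot j t.
    move=> st' /(congr1 (rotr i)); rewrite rotK => ->.
    by rewrite /rotr size_rot rot_rot_add; eexists.
  case: hk => /fin; rewrite ?size_rev size_map sz => /(_ (erefl _)) [j ->].
    by exists j; left.
  by exists j; right.
rewrite -map_rot rotE; case: h => h.
  exists (index w (rev s)); right; rewrite -mkseq_iter_next ?rev_uniq ?mem_rev //.
  rewrite size_rev; apply/eq_in_map => j _.
  rewrite (_ : fvert _ = iter j (prev (bnd (fface (th x)))) (fvert (th x))) ?h //.
  by rewrite -wE -pf; apply: eq_iter => t; rewrite next_rev.
exists (index w s); left; rewrite -mkseq_iter_next //; apply/eq_in_map => j _.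
rewrite (_ : fvert _ = iter j (next (bnd (fface (th x)))) (fvert (th x))) ?h //.
by rewrite -wE -pf.
Qed.

End FlagIsomorphism.

Section CoverIsomorphism.
Local Open Scope nat_scope.
Variables (p : seq nat) (pats : seq (seq nat)) (gl : seq (seq (option (nat * nat)))).
Variables Y Z : cellmap.
Hypotheses (pY : polyhedral_map Y) (pZ : polyhedral_map Z).
Hypothesis hY : forall u : vert Y,
  exists c, face_cycle u c /\ [seq size (bnd f) | f <- c] = p.
Hypothesis hZ : forall u : vert Z,
  exists c, face_cycle u c /\ [seq size (bnd f) | f <- c] = p.
Variables (wY : nat -> flag Y) (wZ : nat -> flag Z).
Hypotheses (rY : realized p pats gl wY) (rZ : realized p pats gl wZ).
Hypothesis hc : complete p pats gl.
Local Notation pvalid := (pvalid p pats).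
Local Notation pall := (pall p pats).

Hypothesis surjY : forall x : flag Y, is_flag x -> exists2 a, pvalid a & pmap wY a = x.
Hypothesis surjZ : forall x : flag Z, is_flag x -> exists2 a, pvalid a & pmap wZ a = x.
Hypothesis fibres : forall a b, pvalid a -> pvalid b ->
  (pmap wY a == pmap wY b) = (pmap wZ a == pmap wZ b).

(** Both maps are quotients of the same flags by the same fibres, so lifting to the cover and
    projecting again is well defined on flags. *)
Lemma cover_isomorphic : isomorphic Y Z.
Proof.
pose pre (X : cellmap) (w : nat -> flag X) x : nat * nat * bool :=
  head (0, 0, true) [seq a <- pall | pmap w a == x].
have preP (X : cellmap) (w : nat -> flag X) (x : flag X) :
    (exists2 a, pvalid a & pmap w a = x) -> pvalid (pre X w x) /\ pmap w (pre X w x) = x.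
  move=> [a va ax]; have : pre X w x \in [seq a <- pall | pmap w a == x].
    have : a \in [seq a <- pall | pmap w a == x] by rewrite mem_filter ax eqxx mem_pall.
    by rewrite /pre; case: [seq _ <- _ | _] => // b t _; rewrite mem_head.
  by rewrite mem_filter mem_pall => /andP[/eqP ? ?].
pose th x := pmap wZ (pre Y wY x); pose th' x := pmap wY (pre Z wZ x).
have thE a : pvalid a -> th (pmap wY a) = pmap wZ a.
  move=> va; have [] := preP Y wY (pmap wY a); first by exists a.
  by move=> vb /eqP; rewrite fibres // => /eqP.
have th'E a : pvalid a -> th' (pmap wZ a) = pmap wY a.
  move=> va; have [] := preP Z wZ (pmap wZ a); first by exists a.
  by move=> vb /eqP; rewrite -fibres // => /eqP.
apply: (@flag_isomorphism p Y Z pY pZ hY hZ th th').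
- move=> x /surjY [a va <-]; rewrite thE // (fsize_pmap pY hY rY) // (fsize_pmap pZ hZ rZ) //; split=> //; exact: (pmap_flag pZ rZ).
- move=> x /surjY [a va <-]; rewrite -(pmap0 hc pY rY) // !thE ?(pmap0 hc pZ rZ) //.
  exact: pflag0_valid.
- move=> x /surjY [a va <-]; rewrite -(pmap1 pY hY rY) // !thE ?(pmap1 pZ hZ rZ) //.
  exact: pflag1_valid.
- move=> x /surjY [a va <-]; rewrite -(pmap2 pY rY) // !thE ?(pmap2 pZ rZ) //.
- by move=> x /surjZ [a va <-]; rewrite th'E //; exact: (pmap_flag pY rY).
- by move=> x /surjY [a va <-]; rewrite thE // th'E.
- by move=> x /surjZ [a va <-]; rewrite th'E // thE.
Qed.

End CoverIsomorphism.

(** * The census of covers and involutions *)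

Section Census.
Local Open Scope nat_scope.
Local Notation state := (seq (seq nat) * seq (seq (option (nat * nat))))%type.
Implicit Types (p : seq nat) (st : state).

Variable fuel : nat.
Definition covers p : seq state := develop p fuel 0 [:: p] [::].
Definition cover_ok p V st :=
  [&& size st.1 == 2 * V, complete p st.1 st.2 & tree_ok st.1 st.2].
Definition deck_candidates p : seq (state * (nat * nat * bool)) :=
  flatten [seq [seq (st, z) | z <- pall p st.1 & (z != (0, 0, true)) && deck_ok p st.1 st.2 z]
          | st <- covers p].
(** The candidates of all covers are counted together: with [k = 1] two maps must share both the
    cover and the involution, with [k = 0] there is no map. *)
Definition census p V k := all (cover_ok p V) (covers p) && (size (deck_candidates p) <= k).

Section OneMap.
Variables (p : seq nat) (V k : nat) (Y : cellmap).
Hypothesis hcen : census p V k.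
Hypothesis pY : polyhedral_map Y.
Hypothesis hp : forall u : vert Y,
  exists c, face_cycle u c /\ [seq size (bnd f) | f <- c] = p.
Hypothesis cY : incidence_connected Y.
Hypothesis VY : #|vert Y| = V.
Hypothesis V0 : 0 < V.

Lemma census_deck : exists st w z, [/\ st \in covers p, realized p st.1 st.2 w,
    (st, z) \in deck_candidates p,
    forall x : flag Y, is_flag x -> exists2 a, pvalid p st.1 a & pmap w a = x
  & forall a b, pvalid p st.1 a -> pvalid p st.1 b -> (pmap w a == pmap w b) =
      (b == a) || (b == deck p z (deck_table p st.1 st.2 z) a)].
Proof.
have [u _] : exists u : vert Y, u \in predT by apply/card_gt0P; rewrite VY.
have [st [w [sc hr]]] : exists st (w : nat -> flag Y), st \in covers p /\ realized p st.1 st.2 w.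
  by rewrite /covers; exact: (develop_start pY hp u fuel).
have [/allP hall _] := andP hcen.
have /and3P[/eqP sz hc ht] := hall st sc.
have n0 : 0 < size st.1 by rewrite sz muln_gt0.
have d0 : 0 < size p by exact: ltn_trans (pattern_size pY hp u).
have VY0 := V0; rewrite -VY in VY0 sz.
have [z [zp nz dz hz]] := pmap_fibres hc pY hp cY hr sz d0 VY0 ht n0.
exists st, w, z; split=> //; last exact: (pmap_surj hc pY hp cY hr sz d0 VY0).
apply/flatten_mapP; exists st => //; apply/mapP; exists z => //.
by rewrite mem_filter nz dz.
Qed.

End OneMap.

Lemma census_isomorphic p V Y Z : census p V 1 -> 0 < V ->
  polyhedral_map Y -> polyhedral_map Z ->
  (forall u : vert Y, exists c, face_cycle u c /\ [seq size (bnd f) | f <- c] = p) ->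
  (forall u : vert Z, exists c, face_cycle u c /\ [seq size (bnd f) | f <- c] = p) ->
  incidence_connected Y -> incidence_connected Z ->
  #|vert Y| = V -> #|vert Z| = V -> isomorphic Y Z.
Proof.
move=> hcen V0 pY pZ hY hZ cY cZ VY VZ.
have [st [w [z [sc rY mY sY fY]]]] := census_deck hcen pY hY cY VY V0.
have [st' [w' [z' [sc' rZ mZ sZ fZ]]]] := census_deck hcen pZ hZ cZ VZ V0.
have [/allP hall h1] := andP hcen.
have /and3P[_ hc _] := hall st sc.
have E : (st, z) = (st', z').
  by move: mY mZ h1; case: deck_candidates => [|a [|//]] //; rewrite !inE => /eqP -> /eqP ->.
case: E => E1 E2; rewrite -E1 -E2 in rZ sZ fZ.
apply: (cover_isomorphic pY pZ hY hZ rY rZ hc sY sZ) => a b va vb.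
by rewrite fY // fZ.
Qed.

Lemma census_empty p V Y : census p V 0 -> 0 < V -> polyhedral_map Y ->
  (forall u : vert Y, exists c, face_cycle u c /\ [seq size (bnd f) | f <- c] = p) ->
  incidence_connected Y -> #|vert Y| = V -> False.
Proof.
move=> hcen V0 pY hY cY VY.
have [st [w [z [_ _ mY _ _]]]] := census_deck hcen pY hY cY VY V0.
by case/andP: hcen => _; rewrite leqn0 size_eq0 => /eqP E; rewrite E in mY.
Qed.

End Census.

(** * Numerical constraints *)

Section VertexStar.
Local Open Scope nat_scope.
Variable Y : cellmap.
Hypothesis pY : polyhedral_map Y.
Implicit Types (f g : face Y) (u z : vert Y).

Lemma common_edge f g u z : f != g -> u != z -> u \in bnd f -> u \in bnd g ->
  z \in bnd f -> z \in bnd g -> edge_of f u z.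
Proof.
move=> fg uz uf ug zf zg; case: (pY) => _ _ /(_ f g fg) h _ _.
have uc : u \in common_vertices f g by rewrite inE uf.
have zc : z \in common_vertices f g by rewrite inE zf.
case: h => [E|[v E]|[v [v' [e _ E]]]].
- by move: uc; rewrite E inE.
- by move: uc zc uz; rewrite E !inE => /eqP -> /eqP ->; rewrite eqxx.
have e' := edge_of_symW pY e.
by move: uc zc uz; rewrite E !inE => /orP[] /eqP -> /orP[] /eqP -> //; rewrite eqxx.
Qed.

Lemma sum_bool_card (T : finType) (P Q : pred T) :
  \sum_(i | P i) (Q i : nat) = #|[pred i | P i && Q i]|.
Proof. by rewrite -sum1_card big_mkcondr; apply: eq_bigr => i _; case: (Q i). Qed.

(** A vertex [z] adjacent to [u] lies in at most two faces at [u], both having [uz] as an edge; any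
    other [z] lies in at most one. Hence 2 N z <= 2 + M z, with N z faces containing both and M z of
    them having the edge; the sum over [z] is the bound. *)
Lemma vertex_star_bound u :
  \sum_(f | u \in bnd f) (size (bnd f) - 2) < #|vert Y|.
Proof.
pose N z := \sum_(f | u \in bnd f) (z \in bnd f : nat).
pose M z := \sum_(f | u \in bnd f) (edge_of f u z : nat).
have NM z : z != u -> 2 * N z <= 2 + M z.
  rewrite eq_sym => uz; rewrite /N /M !sum_bool_card.
  rewrite [X in _ <= _ + X](_ : _ = #|[pred f | edge_of f u z]|); last first.
    by apply: eq_card => f; rewrite !inE; case e: (edge_of f u z); rewrite ?andbF ?andbT ?(edge_ofl e).
  case: (pickP [pred f | edge_of f u z]) => [f /= e|e0].
    rewrite (edge_card pY e) -[2 + 2]/(2 * 2) leq_mul2l /= -(edge_card pY e).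
    apply/subset_leq_card/fintype.subsetP => g; rewrite !inE => /andP[ug zg].
    case: (eqVneq g f) => [-> //|gf].
    exact: (common_edge gf uz ug (edge_ofl e) zg (edge_ofr e)).
  apply: leq_trans (leq_addr _ _); rewrite -[X in _ <= X]/(2 * 1) leq_mul2l /=.
  rewrite leqNgt; apply/negP => /card_gt1P[f [g [+ + fg]]]; rewrite !inE => /andP[uf zf] /andP[ug zg].
  by have := e0 f; rewrite /= (common_edge fg uz uf ug zf zg).
have S1 : \sum_(z | z != u) N z = \sum_(f | u \in bnd f) (size (bnd f)).-1.
  rewrite exchange_big /=; apply: eq_bigr => f uf.
  rewrite sum_bool_card.
  have -> : (size (bnd f)).-1 = size (rem u (bnd f)) by rewrite size_rem.
  rewrite -(card_uniqP (rem_uniq u (bnd_uniq pY f))).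
  by apply: eq_card => z; rewrite !inE mem_rem_uniq ?(bnd_uniq pY) // !inE.
have S2 : \sum_(z | z != u) M z = \sum_(f | u \in bnd f) 2.
  rewrite exchange_big /=; apply: eq_bigr => f uf.
  rewrite sum_bool_card.
  rewrite (eq_card (B := pred2 (next (bnd f) u) (prev (bnd f) u))).
    by rewrite card2 next_neq_prev ?(bnd_uniq pY) ?(bnd_size pY).
  move=> z; rewrite !inE /edge_of uf /= andb_idl //.
  have e1 := edge_of_neq pY (edge_of_next uf); have e2 := edge_of_neq pY (edge_of_prev uf).
  by case/orP => /eqP ->; rewrite eq_sym.
have : \sum_(z | z != u) 2 * N z <= \sum_(z | z != u) (2 + M z) by exact: leq_sum.
rewrite -big_distrr big_split /= S1 S2 sum_nat_const.
have -> : #|[pred z | z != u]| = #|vert Y|.-1 by rewrite cardC1.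
have -> : \sum_(f | u \in bnd f) (size (bnd f)).-1 =
   \sum_(f | u \in bnd f) (size (bnd f) - 2) + \sum_(f | u \in bnd f) 1.
  rewrite -big_split /=; apply: eq_bigr => f _; have := bnd_size pY f; lia.
have -> : \sum_(f | u \in bnd f) 2 = 2 * \sum_(f | u \in bnd f) 1.
  by rewrite big_distrr.
have : 0 < #|vert Y| by apply/card_gt0P; exists u.
move: (\sum_(f | _) (size _ - 2)) (\sum_(f | _) 1) #|vert Y| => a b c; lia.
Qed.

End VertexStar.

Section Arithmetic.
Local Open Scope nat_scope.
Variables (p : seq nat) (Y : cellmap).
Hypothesis pY : polyhedral_map Y.
Hypothesis hp : forall u : vert Y,
  exists c, face_cycle u c /\ [seq size (bnd f) | f <- c] = p.
Let V := #|vert Y|.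
Let d := size p.
Let L := \prod_(a <- p) a.

Lemma pattern_face_size (u : vert Y) a : a \in p -> 2 < a.
Proof.
have [c [fc <-]] := hp u => /mapP[f _ ->]; exact: bnd_size.
Qed.

Lemma face_size_dvd (f : face Y) : size (bnd f) %| L.
Proof.
have [u uf] := face_vert pY f; have [c [[_ mc _] hc]] := hp u.
have fp : size (bnd f) \in p by rewrite -hc; apply/mapP; exists f; rewrite ?mc.
by rewrite /L (big_rem _ fp) /= dvdn_mulr.
Qed.

(** [L] clears denominators: weighing each incidence by [L] over the face size, every face
    contributes [L]. *)
Lemma face_count : L * #|face Y| = V * \sum_(a <- p) L %/ a.
Proof.
rewrite -sum_nat_const (eq_bigr (fun u => \sum_(f | u \in bnd f) L %/ size (bnd f))).
  rewrite mulnC -sum_nat_const (exchange_big_dep xpredT) //=; apply: eq_bigr => f _.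
  rewrite sum_nat_const (_ : #|_| = size (bnd f)); last exact/card_uniqP/(bnd_uniq pY).
  by rewrite mulnC divnK // face_size_dvd.
by move=> u _; rewrite (card_vertex_faces hp u (fun a => L %/ a)).
Qed.

Hypothesis chi : V + #|face Y| = #|{: edge Y}|.+1.

Lemma euler_equation :
  V * (2 * L + 2 * \sum_(a <- p) L %/ a) = V * (d * L) + 2 * L.
Proof.
have := card_corner pY; rewrite (card_corner_vert pY hp) -/V -/d => e.
have := face_count; move: chi e.
move: (\sum_(a <- p) _) #|face Y| #|{: edge Y}| => S F E h1 h2 h3.
have : 2 * (L * (V + F)) = L * (2 * E) + 2 * L by rewrite h1; lia.
rewrite -h2 mulnDr h3; lia.
Qed.

Lemma star_bound (u : vert Y) : \sum_(a <- p) (a - 2) < V.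
Proof.
rewrite -(card_vertex_faces hp u (fun a => a - 2)); exact: vertex_star_bound.
Qed.

End Arithmetic.

(** * The parity obstruction *)

Section Parity.
Local Open Scope nat_scope.

Definition alternating p a b := all (fun r => (nth 0 r 0 == a) ==>
  ((nth 0 r 1 == b) (+) (nth 0 r (size p).-1 == b))) (dihedral_patterns p).
Definition parity_bad p := has (fun a => odd a && has (alternating p a) p) p.

Variables (p : seq nat) (Y : cellmap).
Hypothesis pY : polyhedral_map Y.
Hypothesis hp : forall u : vert Y,
  exists c, face_cycle u c /\ [seq size (bnd f) | f <- c] = p.

(* Around a face of size [a] the edges shared with a face of size [b] would
   alternate with the other ones. *)
Lemma parity_good (u : vert Y) : ~~ parity_bad p.
Proof.
apply/hasP => -[a ap /andP[oa /hasP[b _ alt]]].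
pose beta (x : flag Y) := fsize (flag2 x) == b.
have [x [fx xu xd xs _]] := vertex_flag pY hp u.
have [y fy ya] : exists2 y : flag Y, is_flag y & fsize y = a.
  exists (iter (index a p) (@rho Y) x); first exact: iter_rho_flag.
  by rewrite xs modn_small ?index_mem // nth_index.
have flip z : is_flag z -> fsize z = a -> beta (flag1 z) = ~~ beta z.
  move=> fz za; have [_ _ /(allP alt)] := flag_pattern pY hp fz.
  have d2 := pattern_size pY hp u; have d0 : 0 < size p by exact: ltn_trans d2.
  rewrite !nth_mkseq ?prednK ?(ltn_trans _ d2) //= za eqxx /=.
  rewrite (iter_rho_pred pY hp fz) fsize1 -[fsize (rho z) == b]/(beta (flag1 z)).
  by rewrite -/(beta z); case: (beta _); case: (beta _).
have step k : beta (iter k (@face_step Y) y) = odd k (+) beta y.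
  elim: k => //= k IH; have fk := face_step_flag pY.
  have fyk : is_flag (iter k (@face_step Y) y) by elim: (k) => //= j; exact: fk.
  rewrite {1}/face_step /beta -(flag02 pY) ?fsize0; last exact: flag1_flag.
  rewrite -/(beta _) flip //; first by rewrite IH addNb.
  by rewrite fsize_iter_face_step.
by have := step (fsize y); rewrite face_step_size // ya oa /=; case: (beta y).
Qed.

End Parity.

(** * Solutions of the numerical constraints *)

Section Classification.
Local Open Scope nat_scope.
Implicit Types (p q s : seq nat) (V : nat).

Definition arith p V :=
  [&& V * (2 * \prod_(a <- p) a + 2 * \sum_(a <- p) (\prod_(b <- p) b) %/ a)
        == V * (size p * \prod_(a <- p) a) + 2 * \prod_(a <- p) a,
      \sum_(a <- p) (a - 2) < V, all (leq 3) p & 2 < size p].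

Lemma vertex_equation_absurd V T U L : T <= U -> 0 < L -> V * T = V * U + L -> False.
Proof.
move=> TU L0 h; have : V * T <= V * U by rewrite leq_mul2l TU orbT.
by rewrite h -[leqRHS]addn0 leq_add2l leqNgt L0.
Qed.

Lemma arith_perm p q V : perm_eq p q -> arith p V = arith q V.
Proof.
move=> h; rewrite /arith (perm_size h) (perm_all _ h) !(perm_big q h) /=.
by congr [&& _ == _, _, _ & _].
Qed.

Lemma prod_gt0 p : all (leq 3) p -> 0 < \prod_(a <- p) a.
Proof.
move=> /allP p3; rewrite big_seq; apply: prodn_cond_gt0 => a /p3.
exact: ltn_trans.
Qed.

(** The curvature 1 - d/2 + sum 1/a is positive, and 1/a is at most 1/3. *)
Lemma arith_small_size p V : arith p V -> size p < 6.
Proof.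
case/and4P => /eqP e _ p3 _; move: e; set L := \prod_(a <- p) a.
have L0 : 0 < L by exact: prod_gt0.
have : 3 * \sum_(a <- p) L %/ a <= size p * L.
  rewrite big_distrr /= -sum1_size big_distrl /= big_seq [leqRHS]big_seq.
  apply: leq_sum => a ap; rewrite mul1n; apply: leq_trans (leq_divM L a).
  by rewrite mulnC leq_mul2l (allP p3) ?orbT.
move: (\sum_(a <- p) _) (size p) => S d; nia.
Qed.

(** The reciprocals must sum to more than 1/2, and (6, 6, 6), (3, 12, 12) and (3, 7, 42) give
    exactly 1/2. For (4, 4, c) and (3, 6, c) the curvature is 1/c for every c; there V = c, too
    small for the star of a vertex. *)
Lemma arith3 a b c V : a <= b -> b <= c -> arith [:: a; b; c] V ->
  [/\ a <= 5, b <= 11 & c <= 41].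
Proof.
move=> ab bc /and4P[+ + /and4P[a3 b3 c3 _] _].
have [a0 [b0 c0]] : 0 < a /\ 0 < b /\ 0 < c by lia.
rewrite !(big_cons, big_nil) /= muln1 !addn0.
rewrite mulKn // (mulnCA a b) mulKn // (mulnC a c) (mulnCA b c) mulKn //.
move=> /eqP e l.
have {}e : V * (2 * (b * c) + 2 * (a * c) + 2 * (a * b)) = V * (a * b * c) + 2 * (a * b * c) by lia.
have a5 : a <= 5.
  rewrite leqNgt; apply/negP => a6.
  have : 2 * (b * c) + 2 * (a * c) + 2 * (a * b) <= a * b * c by nia.
  have : 0 < a * b * c by rewrite !muln_gt0 a0 b0 c0.
  by move: (a * b * c) e => L e L0 /vertex_equation_absurd; apply; [|exact: e]; rewrite muln_gt0.
have b11 : b <= 11.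
  rewrite leqNgt; apply/negP => b12.
  have h : 2 * (b * c) + 2 * (a * c) + 2 * (a * b) <= a * b * c.
    have : a = 3 \/ a = 4 \/ a = 5 by lia.
    by clear e l; case=> [?|[?|?]]; subst a; nia.
  have : 0 < a * b * c by rewrite !muln_gt0 a0 b0 c0.
  by move: (a * b * c) e h => L e /vertex_equation_absurd h L0; apply: h e; rewrite muln_gt0.
split=> //; rewrite leqNgt; apply/negP => c42.
have {}e : V * (2 * (a * b)) + V * (2 * (a + b)) * c = V * (a * b) * c + 2 * (a * b) * c by nia.
have {}l : c + (a - 2) + (b - 2) - 1 <= V by lia.
have : a = 3 \/ a = 4 \/ a = 5 by lia.
case=> [?|[?|?]]; subst a.
- have [b7|b6] := leqP 7 b.
    have : V * (2 * (3 * b)) <= V * (b - 6) * c by nia.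
    nia.
  have : b = 3 \/ b = 4 \/ b = 5 \/ b = 6 by lia.
  case=> [?|[?|[?|?]]]; subst b; nia.
- have [?|b5] : b = 4 \/ 5 <= b by lia.
    subst b; nia.
  nia.
nia.
Qed.

(** The reciprocals must sum to more than 1; the limiting cases include (4, 4, 4, 4), (3, 3, 6, 6)
    and (3, 3, 4, 12). The antiprism family (3, 3, 3, e) has V = e and is excluded by the star
    bound. *)
Lemma arith4 a b c e V : a <= b -> b <= c -> c <= e -> arith [:: a; b; c; e] V ->
  [/\ a = 3, b <= 4, c <= 5 & e <= 11].
Proof.
move=> ab bc ce /and4P[+ + /and5P[a3 b3 c3 e3 _] _].
have [a0 [b0 [c0 e0]]] : 0 < a /\ 0 < b /\ 0 < c /\ 0 < e by lia.
rewrite !(big_cons, big_nil) /= muln1 !addn0.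
have -> : a * (b * (c * e)) %/ a = b * c * e by rewrite mulKn ?mulnA.
have -> : a * (b * (c * e)) %/ b = a * c * e by rewrite mulnCA mulKn ?mulnA.
have -> : a * (b * (c * e)) %/ c = a * b * e.
  by rewrite (mulnCA b c) (mulnCA a c) mulKn ?mulnA.
have -> : a * (b * (c * e)) %/ e = a * b * c.
  by rewrite (mulnC c e) (mulnCA b e) (mulnCA a e) mulKn ?mulnA.
move=> /eqP h l.
have {}h : V * (b * c * e + a * c * e + a * b * e + a * b * c) =
    V * (a * b * c * e) + a * b * c * e by lia.
have L0 : 0 < a * b * c * e by rewrite !muln_gt0 a0 b0 c0 e0.
have aE : a = 3.
  apply/eqP; rewrite eqn_leq a3 andbT leqNgt; apply/negP => a4.
  have : b * c * e + a * c * e + a * b * e + a * b * c <= a * b * c * e.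
    have [? [? [? ?]]] : 4 * (b * c * e) <= a * (b * c * e) /\ 4 * (a * c * e) <= b * (a * c * e)
      /\ 4 * (a * b * e) <= c * (a * b * e) /\ 4 * (a * b * c) <= e * (a * b * c).
      by do 3?split; rewrite leq_mul2r; lia.
    lia.
  by move=> /vertex_equation_absurd/(_ L0)/(_ h).
subst a; have {}h : V * (3 * (c * e) + 3 * (b * e) + 3 * (b * c)) =
    V * (2 * (b * c * e)) + 3 * (b * c * e) by lia.
have X3 : 0 < 3 * (b * c * e) by rewrite !muln_gt0 b0 c0 e0.
have b4 : b <= 4.
  rewrite leqNgt; apply/negP => b5.
  have : 3 * (c * e) + 3 * (b * e) + 3 * (b * c) <= 2 * (b * c * e).
    have [? [? ?]] : 5 * (c * e) <= b * (c * e) /\ 5 * (b * e) <= c * (b * e)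
      /\ 5 * (b * c) <= e * (b * c).
      by do 2?split; rewrite leq_mul2r; lia.
    lia.
  by move=> /vertex_equation_absurd/(_ X3)/(_ h).
have c5 : c <= 5.
  rewrite leqNgt; apply/negP => c6.
  have : 3 * (c * e) + 3 * (b * e) + 3 * (b * c) <= 2 * (b * c * e).
    have [? [? ?]] : 3 * (c * e) <= b * (c * e) /\ 6 * (b * e) <= c * (b * e)
      /\ 6 * (b * c) <= e * (b * c).
      by do 2?split; rewrite leq_mul2r; lia.
    lia.
  by move=> /vertex_equation_absurd/(_ X3)/(_ h).
split=> //; rewrite leqNgt; apply/negP => e12.
have : b = 3 \/ b = 4 by lia.
have : c = 3 \/ c = 4 \/ c = 5 by lia.
by case=> [?|[?|?]] [?|?]; subst b; subst c; nia.
Qed.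

(** The limit is 3/2, attained by (3, 3, 3, 4, 4) and (3, 3, 3, 3, 6). *)
Lemma arith5 a b c f e V : a <= b -> b <= c -> c <= f -> f <= e ->
  arith [:: a; b; c; f; e] V -> [/\ a = 3, b = 3, c = 3, f = 3 & e <= 5].
Proof.
move=> ab bc cf fe /and4P[+ + /and5P[a3 b3 c3 f3 /andP[e3 _]] _].
have [a0 [b0 [c0 [f0 e0]]]] : 0 < a /\ 0 < b /\ 0 < c /\ 0 < f /\ 0 < e by lia.
move=> + _; rewrite !(big_cons, big_nil) /= muln1 !addn0.
set L := a * _.
have L0 : 0 < L by rewrite !muln_gt0 a0 b0 c0 f0.
have La : a * (L %/ a) = L by rewrite mulnC divnK //; exact: dvdn_mulr.
have Lb : b * (L %/ b) = L by rewrite mulnC divnK //; apply: dvdn_mull; exact: dvdn_mulr.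
have Lc : c * (L %/ c) = L by rewrite mulnC divnK //; do 2!apply: dvdn_mull; exact: dvdn_mulr.
have Lf : f * (L %/ f) = L by rewrite mulnC divnK //; do 3!apply: dvdn_mull; exact: dvdn_mulr.
have Le : e * (L %/ e) = L by rewrite mulnC divnK //; do 4!apply: dvdn_mull.
have bnd k x : k <= x -> x * (L %/ x) = L -> k * (L %/ x) <= L.
  by move=> kx E; rewrite -[leqRHS]E leq_mul2r kx orbT.
move=> /eqP h.
have fE : f = 3.
  apply/eqP; rewrite eqn_leq f3 andbT leqNgt; apply/negP => f4.
  have := bnd _ _ a3 La; have := bnd _ _ b3 Lb; have := bnd _ _ c3 Lc.
  have := bnd _ _ f4 Lf; have := bnd _ _ (leq_trans f4 fe) Le.
  move: (L %/ a) (L %/ b) (L %/ c) (L %/ f) (L %/ e) h => A B C D E h *.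
  have : 2 * (A + (B + (C + (D + E)))) <= 3 * L by lia.
  have L2 : 0 < 2 * L by rewrite muln_gt0.
  move: (A + _) h => S h S3; apply: (vertex_equation_absurd _ L2 h).
  by rewrite /=; lia.
have [? [? ?]] : c = 3 /\ b = 3 /\ a = 3 by lia.
subst a; subst b; subst c; subst f; split=> //.
rewrite leqNgt; apply/negP => e6; have := bnd _ _ e6 Le.
move: (L %/ 3) (L %/ e) La h => A E LA h l.
have : 2 * (A + (A + (A + (A + E)))) <= 3 * L by lia.
have L2 : 0 < 2 * L by rewrite muln_gt0.
move: (A + _) h => S h S3; apply: (vertex_equation_absurd _ L2 h).
by rewrite /=; lia.
Qed.

Definition cyclic_eqb (T : eqType) (s t : seq T) :=
  has (fun i => (s == rot i t) || (s == rot i (rev t))) (iota 0 (size t)).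

Lemma cyclic_eqbP (T : eqType) (s t : seq T) : cyclic_eqb s t -> cyclic_eq s t.
Proof. by case/hasP => i _ /orP[] /eqP ->; exists i; [left|right]. Qed.

Definition vertex_number p := let L := foldr muln 1 p in
  (2 * L) %/ (2 * L + 2 * sumn [seq L %/ a | a <- p] - size p * L).

Definition arithb p V := let L := foldr muln 1 p in
  [&& V * (2 * L + 2 * sumn [seq L %/ a | a <- p]) == V * (size p * L) + 2 * L,
      sumn [seq a - 2 | a <- p] < V, all (leq 3) p & 2 < size p].

Lemma arithE p V : arith p V = arithb p V.
Proof. by rewrite /arith /arithb foldrE !sumnE !big_map. Qed.

Lemma arith_vertex_number p V : arith p V -> V = vertex_number p.
Proof.
rewrite arithE => /and4P[/eqP e l /prod_gt0 + _]; rewrite -foldrE /vertex_number; move: e.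
move: (foldr _ _ _) (sumn [seq _ %/ _ | _ <- _]) => L S e L0.
have V0 : 0 < V by exact: leq_ltn_trans l.
have h : 2 * L = V * (2 * L + 2 * S - size p * L) by rewrite mulnBr e addKn.
by rewrite {1}h mulnK // lt0n; apply: contraTneq L0 => D0; move: h; rewrite D0 muln0; lia.
Qed.

Definition patterns3 :=
  [seq [:: x.1; x.2; c] | x <- [seq (a, b) | a <- iota 3 3, b <- iota 3 9], c <- iota 3 39].
Definition patterns4 :=
  [seq [:: 3; x.1; x.2; e] | x <- [seq (b, c) | b <- iota 3 2, c <- iota 3 3], e <- iota 3 9].
Definition patterns5 := [seq [:: 3; 3; 3; 3; e] | e <- iota 3 3].
Definition small_patterns : seq (seq nat) := patterns3 ++ (patterns4 ++ patterns5).

Lemma arith_small p V : sorted leq p -> arith p V -> p \in small_patterns.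
Proof.
move=> sp ap; have d6 := arith_small_size ap; have /and4P[_ _ p3 d3] := ap.
have in3 n x : 3 <= x -> x < 3 + n -> x \in iota 3 n by rewrite mem_iota => -> ->.
case: p d6 sp ap p3 d3 => [|a [|b [|c [|e [|f [|]]]]]] // _.
- rewrite [sorted _ _]/= [all _ _]/=; case/and3P => ab bc _ ap /and4P[a3 b3 c3 _] _.
  have [? ? ?] := arith3 ab bc ap; rewrite mem_cat; apply/orP; left; rewrite /patterns3.
  apply/allpairsP; exists ((a, b), c); split; [|by apply: in3 => //=; lia|by []].
  by apply/allpairsP; exists (a, b); split=> [|| //]; apply: in3 => //=; lia.
- rewrite [sorted _ _]/= [all _ _]/=; case/and4P => ab bc ce _ ap /and5P[a3 b3 c3 e3 _] _.
  have [? ? ? ?] := arith4 ab bc ce ap; subst a; rewrite mem_cat; apply/orP; right; rewrite mem_cat; apply/orP; left; rewrite /patterns4.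
  apply/allpairsP; exists ((b, c), e); split; [|by apply: in3 => //=; lia|by []].
  by apply/allpairsP; exists (b, c); split=> [|| //]; apply: in3 => //=; lia.
rewrite [sorted _ _]/= [all _ _]/=; case/and5P => ab bc ce ef _ ap /and5P[a3 b3 c3 e3 /andP[f3 _]] _.
have [? ? ? ? ?] := arith5 ab bc ce ef ap; subst; rewrite mem_cat; apply/orP; right; rewrite mem_cat; apply/orP; right; rewrite /patterns5.
by apply/mapP; exists f => //; apply: in3 => //; lia.
Qed.

Definition good_patterns : seq (seq nat * nat) :=
  [:: ([:: 5; 5; 5], 10); ([:: 3; 3; 3; 3; 3], 6); ([:: 4; 6; 6], 12);
      ([:: 3; 5; 3; 5], 15); ([:: 3; 4; 4; 4], 12); ([:: 4; 6; 8], 24);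
      ([:: 3; 4; 5; 4], 30); ([:: 4; 6; 10], 60); ([:: 3; 10; 10], 30);
      ([:: 5; 6; 6], 30)].
(** The patterns of the snub cube and the snub dodecahedron, with half their vertex numbers. Being
    chiral, these solids have no central symmetry, yet the arithmetic and parity tests cannot see
    this; only the census excludes them. *)
Definition snub_patterns : seq (seq nat * nat) :=
  [:: ([:: 3; 3; 3; 3; 4], 12); ([:: 3; 3; 3; 3; 5], 30)].

Lemma small_patterns_check : all (fun q =>
  if arithb q (vertex_number q)
  then all (fun p => if parity_bad p then true else
         has (fun x => cyclic_eqb p x.1 && (vertex_number q == x.2))
           (good_patterns ++ snub_patterns)) (permutations q)
  else true) small_patterns.
Proof. by vm_compute. Qed.

(** The arithmetic ignores the order of the faces, so it is solved for the sorted pattern; the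
    parity test is then applied to every permutation. *)
Lemma arith_classification p V : arith p V -> ~~ parity_bad p ->
  exists2 s, cyclic_eqb p s & (s, V) \in good_patterns ++ snub_patterns.
Proof.
move=> ap gp; set q := sort leq p; have pq : perm_eq q p by rewrite perm_sort.
have aq : arith q V by rewrite (arith_perm V pq).
have qs := arith_small (sort_sorted leq_total p) aq.
have := allP small_patterns_check _ qs; rewrite -(arith_vertex_number aq) -arithE aq.
move/allP => /(_ p); rewrite mem_permutations perm_sym pq => /(_ isT).
rewrite (negPf gp) => /hasP[[s V'] hs /andP[/= h /eqP E]].
by exists s; rewrite // E.
Qed.

End Classification.

(** * The theorem *)

Section FaceCycles.
Local Open Scope nat_scope.
Variable Y : cellmap.
Implicit Types (u : vert Y) (c : seq (face Y)).

Lemma face_cycle_rot i u c : face_cycle u c -> face_cycle u (rot i c).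
Proof.
case=> uc mc cc; split; rewrite ?rot_uniq ?rot_cycle // => f.
by rewrite mem_rot.
Qed.

Lemma face_cycle_rev u c : face_cycle u c -> face_cycle u (rev c).
Proof.
case=> uc mc cc; split; [by rewrite rev_uniq|by move=> f; rewrite mem_rev|].
rewrite rev_cycle; apply: sub_cycle cc => f g; rewrite /adjacent_at eq_sym.
case/andP => -> /existsP[w /andP[e1 e2]]; apply/existsP; exists w.
by rewrite e1 e2.
Qed.

Lemma face_cycle_cyclic_eqb u p s : cyclic_eqb p s ->
  (exists c, face_cycle u c /\ [seq size (bnd f) | f <- c] = p) ->
  exists c, face_cycle u c /\ [seq size (bnd f) | f <- c] = s.
Proof.
case/hasP => i _ h [c [fc hc]]; have fr := face_cycle_rot (size c - i) fc.
have E t : p = rot i t -> [seq size (bnd f) | f <- rotr i c] = t.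
  by rewrite map_rotr hc => ->; rewrite rotK.
case/orP: h => /eqP /E h; first by exists (rotr i c).
exists (rev (rotr i c)); rewrite map_rev h revK; split=> //; exact: face_cycle_rev.
Qed.

End FaceCycles.

Section RunLengths.
Local Open Scope nat_scope.

(** The inverse of [expand] on proper types. It leads from the classification of expanded patterns
    back to types in exponent notation. *)
Fixpoint run_lengths (s : seq nat) : vtype :=
  if s is x :: s' then
    if run_lengths s' is (y, n) :: r then
      if x == y then (y, n.+1) :: r else (x, 1) :: (y, n) :: r
    else [:: (x, 1)]
  else [::].

Lemma run_lengths_cons x s : run_lengths (x :: s) =
  if run_lengths s is (y, n) :: r then
    if x == y then (y, n.+1) :: r else (x, 1) :: (y, n) :: r
  else [:: (x, 1)].
Proof. by []. Qed.

Lemma run_lengths_expand (t : vtype) : proper_vtype t -> run_lengths (Defs.expand t) = t.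
Proof.
case/and3P => _ pos cyc.
have {cyc} : sorted (fun x y : nat * nat => x.1 != y.1) t.
  case/orP: cyc; first by case: (t) => [|x [|]].
  by case: (t) => //= x r; rewrite rcons_path => /andP[].
elim: t pos => [|[x n] t IH] //= /andP[n0 pos] pt.
have {IH} : run_lengths (Defs.expand t) = t by apply: IH => //; exact: path_sorted pt.
rewrite /Defs.expand /= -/(Defs.expand t); case: n n0 pt => // n _ pt E.
have {}pt : if t is y :: _ then x != y.1 else true by case: t pt {E pos} => //= y t /andP[].
elim: n => [|n IH]; last first.
  by rewrite -[nseq n.+2 x]/(x :: nseq n.+1 x) cat_cons run_lengths_cons IH eqxx.
rewrite -[nseq 1 x]/[:: x] cat_cons run_lengths_cons E.
by case: t pt {E pos} => //= -[y m] t /negPf ->.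
Qed.

End RunLengths.

Section Final.
Variable R : realType.

Local Notation types :=
    ([:: [:: (5, 3)];
        [:: (3, 5)];
        [:: (4, 1); (6, 2)];
        [:: (3, 1); (5, 1); (3, 1); (5, 1)];
        [:: (3, 1); (4, 3)];
        [:: (4, 1); (6, 1); (8, 1)];
        [:: (3, 1); (4, 1); (5, 1); (4, 1)];
        [:: (4, 1); (6, 1); (10, 1)];
        [:: (3, 1); (10, 2)];
        [:: (5, 1); (6, 2)]]%nat : seq vtype).

(** A run spends one unit of fuel per glued pair and one per finished vertex, about 300 for the
    largest covers, so 1000 is ample. *)
Lemma census_true :
  all (fun x => census 1000 x.1 x.2 1) good_patterns && all (fun x => census 1000 x.1 x.2 0) snub_patterns.
Proof. by vm_compute. Qed.

(** A rotation of an expanded pattern may cut through a run, as 6, 4, 6 does for [4, 6^2]. The first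
    and last entries of the type so read agree, [proper_vtype] rejects it, and only genuine
    rotations of the type remain. *)
Lemma run_lengths_check : all (fun s : vtype =>
  ((Defs.expand s, vertex_number (Defs.expand s)) \in good_patterns) &&
  all (fun i => all (fun p => proper_vtype (run_lengths p) ==> cyclic_eqb (run_lengths p) s)
    [:: rot i (Defs.expand s); rot i (rev (Defs.expand s))]) (iota 0 (size (Defs.expand s)))) types.
Proof. by vm_compute. Qed.

Lemma good_patterns_types : [seq x.1 | x <- good_patterns] = [seq Defs.expand s | s <- types].
Proof. by []. Qed.

Lemma map_on_arith (Y : cellmap) (t : vtype) : map_on R (RP2 R) Y -> semi_equivelar Y t ->
  arith (Defs.expand t) #|vert Y|.
Proof.
move=> mY [_ hp]; have [cY [u] chi] := RP2_euler mY; have [pY _] := mY.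
apply/and4P; split.
- by apply/eqP; exact: (euler_equation pY hp chi).
- exact: (star_bound pY hp u).
- by apply/allP => a; exact: (pattern_face_size pY hp u).
- exact: (pattern_size pY hp u).
Qed.

Lemma map_on_type (Y : cellmap) (t : vtype) : map_on R (RP2 R) Y -> semi_equivelar Y t ->
  exists2 s, s \in types & cyclic_eq t s.
Proof.
move=> mY sY; have ar := map_on_arith mY sY; have [pt hp] := sY.
have [cY [u] _] := RP2_euler mY; have [pY _] := mY.
have [q pq] := arith_classification ar (parity_good pY hp u).
have V0 : (0 < #|vert Y|)%nat by apply/card_gt0P; exists u.
have [_ /allP snub] := andP census_true.
rewrite mem_cat => /orP[qg|/snub /= cq]; last first.
  by case: (census_empty cq V0 pY (fun u => face_cycle_cyclic_eqb pq (hp u)) cY (erefl _)).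
have : q \in [seq x.1 | x <- good_patterns] by apply/mapP; exists (q, #|vert Y|).
rewrite good_patterns_types => /mapP[s st qs]; exists s => //; rewrite qs in pq.
have /andP[_ /allP h] := allP run_lengths_check _ st.
case/hasP: pq => i /h /= /and3P[h1 h2 _] /orP[] /eqP E; rewrite -E run_lengths_expand // pt /= in h1 h2.
  exact: cyclic_eqbP.
exact: cyclic_eqbP.
Qed.

Lemma map_on_unique (s : vtype) (Y Z : cellmap) : s \in types ->
  map_on R (RP2 R) Y -> semi_equivelar Y s ->
  map_on R (RP2 R) Z -> semi_equivelar Z s -> isomorphic Y Z.
Proof.
move=> st mY sY mZ sZ; have aY := map_on_arith mY sY; have aZ := map_on_arith mZ sZ.
have [cY [u] _] := RP2_euler mY; have [cZ _ _] := RP2_euler mZ.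
have [[pY _] [pZ _]] := (mY, mZ); have [[_ hY] [_ hZ]] := (sY, sZ).
have /andP[/= gs _] := allP run_lengths_check _ st.
have YZ : #|vert Y| = #|vert Z|.
  by rewrite (arith_vertex_number aY) (arith_vertex_number aZ).
rewrite -(arith_vertex_number aY) in gs.
have [/allP hall _] := andP census_true; have cs := hall _ gs.
apply: (census_isomorphic cs _ pY pZ hY hZ cY cZ); [|by []|exact: esym YZ].
by apply/card_gt0P; exists u.
Qed.

End Final.

Theorem theorem1p2 (R : realType) :
  let types : seq vtype :=
    [:: [:: (5, 3)];
        [:: (3, 5)];
        [:: (4, 1); (6, 2)];
        [:: (3, 1); (5, 1); (3, 1); (5, 1)];
        [:: (3, 1); (4, 3)];
        [:: (4, 1); (6, 1); (8, 1)];
        [:: (3, 1); (4, 1); (5, 1); (4, 1)];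
        [:: (4, 1); (6, 1); (10, 1)];
        [:: (3, 1); (10, 2)];
        [:: (5, 1); (6, 2)]]%N in
  (forall (Y : cellmap) (t : vtype),
     map_on R (RP2 R) Y -> semi_equivelar Y t ->
     exists2 s, s \in types & cyclic_eq t s)
  /\
  (forall s : vtype, s \in types ->
     (exists Y : cellmap, map_on R (RP2 R) Y /\ semi_equivelar Y s) /\
     (forall Y Z : cellmap,
        map_on R (RP2 R) Y -> semi_equivelar Y s ->
        map_on R (RP2 R) Z -> semi_equivelar Z s ->
        isomorphic Y Z)).
Proof.
split=> [Y t|s st]; first exact: map_on_type.
split; first exact: (@hemi_map_exists R s st).
by move=> Y Z; exact: map_on_unique.
Qed.
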